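(* Let $X$ be a spectrally negative Lévy process under the probabilities $(\mathsf P_x)_{x\in\mathbb R}$, let $q\in[0,\infty)$, let $\omega:\mathbb R\to[0,\infty)$ be Borel measurable and locally bounded, and let $c\in\mathbb R$, $\gamma\in(0,\infty)$. With $\mathcal H^{(\omega)}_q$, $\mathcal H^{(\gamma\omega)}_q$, $\tau_c^+$, $e_q$ and (for strictly positive $\omega$) $\zeta$, $\rho$, $Y$, $T_c^+$ as defined in the context, define the processes $$Z_t:=\exp\left(-\int_0^t\omega(X_u)\,du-qt\right)\mathcal H^{(\omega)}_q(X_t),\quad t\in[0,\infty),$$ and $$W_s:=e^{-\gamma s}\,\mathcal H^{(\gamma\omega)}_q(Y_s)\,\mathbf 1_{\{s<\zeta\}},\quad s\in[0,\infty).$$ Let further $\mathcal F=(\mathcal F_t)_{t\in[0,\infty)}$ be any filtration relative to which $X$ is adapted and has independent increments. Then: (i) The stopped process $Z^{\tau_c^+}$ is a bounded càdlàg martingale in the filtration $\mathcal F$ under $\mathsf P_x$ for each $x\in\mathbb R$; for real $x\le c$ the $\mathsf P_x$-terminal value of this martingale is $$\mathcal H^{(\omega)}_q(c)\exp\left\{-\int_0^{\tau_c^+}\omega(X_s)\,ds-q\tau_c^+\right\}\mathbf 1_{\{\tau_c^+<\infty\}}.$$ (ii) Assume $\omega$ is strictly positive and $e_q$ is independent of $\mathcal F_\infty$ (under $\mathsf P_x$ for each $x\in\mathbb R$). Then the stopped process $W^{T_c^+}$ is a càdlàg bounded martingale in the filtration $\mathcal G=(\mathcal G_s)_{s\in[0,\infty)}:=\big(\mathcal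 F_{\rho_s}\vee\sigma(\{\{\rho_u<e_q\}:u\in[0,s]\})\big)_{s\in[0,\infty)}$ under $\mathsf P_x$ for each $x\in\mathbb R$.
   Context: Spectrally negative Lévy process: $X=(X_t)_{t\in[0,\infty)}$ is a càdlàg real-valued process with no positive jumps and non-monotone paths which, under $\mathsf P_0$, a.s. vanishes at zero and has stationary independent increments; for each $x\in\mathbb R$ the law of $X$ under $\mathsf P_x$ is that of $x+X$ under $\mathsf P_0$. For $c\in\mathbb R$, $\tau_c^+:=\inf\{t\in(0,\infty):X_t>c\}$. $e_q$ is an exponential random variable with mean $q^{-1}$ ($e_0=\infty$ a.s.), independent of $X$ under $\mathsf P_x$ for all $x\in\mathbb R$. For a locally bounded Borel function $\omega:\mathbb R\to[0,\infty)$ and real $x\le c$, $$\mathcal B^{(\omega)}_q(x,c):=\mathsf P_x\left[\exp\left\{-\int_0^{\tau_c^+}\omega(X_u)\,du\right\};\tau_c^+<e_q\right],$$ where $\mathsf Q[V;A]$ denotes the expectation of $V\mathbf 1_A$ under $\mathsf Q$. The function $\mathcal H^{(\omega)}_q:\mathbb R\to(0,\infty)$ is the unique function with $\mathcal H^{(\omega)}_q(0)=1$ and $\mathcal B^{(\omega)}_q(x,c)=\mathcal H^{(\omega)}_q(x)/\mathcal H^{(\omega)}_q(c)$ for all real $x\le c$; explicitly, $\mathcal H^{(\omega)}_q(x)=\mathcal B^{(\omega)}_q(x,c)/\mathcal B^{(\omega)}_q(0,c)$ for any $c\ge\max(x,0)$. $\mathcal H^{(\gamma\omega)}_q$ is the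 same object with $\gamma\omega$ in place of $\omega$. When $\omega$ is strictly positive everywhere: $\zeta:=\int_0^{e_q}\omega(X_u)\,du$; $\rho_s:=\inf\{t\in[0,\infty):\int_0^t\omega(X_u)\,du>s\}$ for $s\in[0,\infty)$ (with $\inf\emptyset=\infty$); the process $Y=(Y_s)_{s\in[0,\infty)}$ is given by $Y_s:=X_{\rho_s}$ for $s\in[0,\zeta)$ and $Y_s:=\partial$ for $s\ge\zeta$, where $\partial\notin\mathbb R$ is a cemetery state; and $T_c^+:=\inf\{s\in(0,\infty):Y_s\in(c,\infty)\}$. The product defining $W_s$ is understood to be $0$ on $\{s\ge\zeta\}$. For a process $V$ and a random time $T$, $V^T$ denotes the stopped process $V^T_t=V_{t\wedge T}$. *)

(* Defs.v *)
From HB Require Import structures.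
From mathcomp Require Import all_boot all_order all_algebra.
From mathcomp Require Import all_classical all_reals all_analysis.
From mathcomp Require Import measurable_realfun.

Set Implicit Arguments.
Unset Strict Implicit.
Unset Printing Implicit Defensive.

Import Order.TTheory GRing.Theory Num.Theory.
Import numFieldNormedType.Exports.

Local Open Scope classical_set_scope.
Local Open Scope ring_scope.

(* Time runs through the nonnegative elements of R: processes and filtrations
   are families indexed by R whose members at negative indices are ignored.
   Random times take values in \bar R, and ereal_inf set0 = +oo.  A sub-sigma-
   algebra of a measurable space is given by the collection of its events. *)

Section paths.
Variable R : realType.
Implicit Type f : R -> R.

Definition cadlag f :=
  (forall t, 0 <= t -> f s @[s --> t^'+] --> f t) /\
  (forall t, 0 < t -> cvg (f s @[s --> t^'-])).

Definition no_positive_jumps f := forall t, 0 < t -> f t <= lim (f s @[s --> t^'-]).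

Definition monotone_path f :=
  (forall s t, 0 <= s -> s <= t -> f s <= f t) \/
  (forall s t, 0 <= s -> s <= t -> f t <= f s).

End paths.

Section events.
Variables (R : realType) (T : Type).

Definition sigma_rv d (S : measurableType d) (Y : T -> S) : set (set T) :=
  preimage_set_system setT Y measurable.

Definition sigma_process (X : R -> T -> R) (J : set R) : set (set T) :=
  <<s \bigcup_(t in J) sigma_rv (X t) >>.

End events.

(* The product sigma-algebra on paths. *)
Definition path_events (R : realType) : set (set (R -> R)) :=
  sigma_process (fun (t : R) (f : R -> R) => f t) [set t | 0 <= t].

Section processes.
Variables (d : measure_display) (T : measurableType d) (R : realType).
Implicit Types (Pr : probability T R) (X M : R -> T -> R).
Implicit Types (F : R -> set (set T)) (tau : T -> \bar R).

Definition independent Pr (G H : set (set T)) :=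
  forall A B, G A -> H B -> Pr (A `&` B) = (Pr A * Pr B)%E.

Definition filtration F :=
  [/\ forall t, 0 <= t -> sigma_algebra setT (F t),
      forall t, 0 <= t -> F t `<=` measurable &
      forall s t, 0 <= s -> s <= t -> F s `<=` F t].

Definition adapted F X := forall t, 0 <= t -> sigma_rv (X t) `<=` F t.

Definition sigma_infty F : set (set T) := <<s \bigcup_(t in [set t | 0 <= t]) F t >>.

Definition independent_increments Pr F X := forall s t, 0 <= s -> s <= t ->
  independent Pr (sigma_rv (fun w => X t w - X s w)) (F s).

Definition natural_filtration X : R -> set (set T) :=
  fun t => sigma_process X [set s | 0 <= s <= t].

Definition stationary_increments Pr X := forall s t, 0 <= s -> s <= t ->
  forall B : set R, measurable B ->
    Pr [set w | B (X t w - X s w)] = Pr [set w | B (X (t - s) w - X 0 w)].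

(* The events of F_tau, for a stopping time tau. *)
Definition stopped_sigma F tau : set (set T) :=
  [set A | sigma_infty F A /\
    forall t, 0 <= t -> F t (A `&` [set w | (tau w <= t%:E)%E])].

Definition stopped M tau : R -> T -> R :=
  fun t w => M (fine (Order.min t%:E (tau w))) w.

Definition martingale Pr F M :=
  [/\ filtration F, adapted F M,
      forall t, 0 <= t -> Pr.-integrable setT (EFin \o M t) &
      forall s t, 0 <= s -> s <= t -> forall A, F s A ->
        (\int[Pr]_(w in A) (M t w)%:E = \int[Pr]_(w in A) (M s w)%:E)%E].

Definition bounded_process Pr M :=
  exists K : R, {ae Pr, forall w, forall t, 0 <= t -> `|M t w| <= K}.

(* The null set matters for time-changed processes: when the lifetime is finite
   and reached only as the original time tends to +oo, the left limit at the
   lifetime exists almost surely but not for every sample point. *)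
Definition cadlag_process Pr M := {ae Pr, forall w, cadlag (M^~ w)}.

Definition terminal_value Pr M (Z : T -> R) :=
  {ae Pr, forall w, M t w @[t --> +oo] --> Z w}.

End processes.

Section levy.
Variables (d : measure_display) (T : measurableType d) (R : realType).
Implicit Types (P : R -> probability T R) (X : R -> T -> R).
Implicit Types (e : T -> \bar R) (om : R -> R).

(* All paths are cadlag, so that integrals and passage times along X are
   measurable without completing the filtrations. *)
Definition spectrally_negative_levy P X :=
  [/\ (forall t, 0 <= t -> measurable_fun setT (X t)) /\ (forall w, cadlag (X^~ w)),
      forall x, {ae P x, forall w,
        no_positive_jumps (X^~ w) /\ ~ monotone_path (X^~ w)},
      {ae P 0, forall w, X 0 w = 0},
      independent_increments (P 0) (natural_filtration X) X /\
        stationary_increments (P 0) X &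
      forall x C, path_events C ->
        P x [set w | C (X^~ w)] = P 0 [set w | C (fun t => x + X t w)]].

(* Exponential law with mean q^-1, concentrated at +oo when q = 0. *)
Definition exponential_time P (q : R) e :=
  measurable_fun setT e /\
  forall x, (q = 0 -> {ae P x, forall w, e w = +oo%E}) /\
    (0 < q -> forall B : set R, measurable B ->
      P x (e @^-1` (EFin @` B)) = exponential_prob q B).

Definition locally_bounded om := [locally [bounded om x | x in (setT : set R)]].

Definition additive_functional X om (t : \bar R) (w : T) : \bar R :=
  (\int[lebesgue_measure]_(u in [set u : R | (0 <= u)%R /\ (u%:E <= t)%E])
    (om (X u w))%:E)%E.

Definition passage_time X (c : R) (w : T) : \bar R :=
  ereal_inf [set t%:E | t in [set t | 0 < t /\ c < X t w]].

Definition passage_functional P X e om (x c : R) : R :=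
  fine 'E_(P x)[fun w =>
    expR (- fine (additive_functional X om (passage_time X c w) w))
    * \1_[set v | (passage_time X c v < e v)%E] w].

(* The quotient does not depend on the level used in place of max x 0. *)
Definition Hfun P X e om (x : R) : R :=
  passage_functional P X e om x (Num.max x 0)
  / passage_functional P X e om 0 (Num.max x 0).

Definition Zproc P X e q om : R -> T -> R := fun t w =>
  expR (- fine (additive_functional X om t%:E w) - q * t) * Hfun P X e om (X t w).

Definition Zterminal P X e q om (c : R) (w : T) : R :=
  Hfun P X e om c
  * expR (- fine (additive_functional X om (passage_time X c w) w)
          - q * fine (passage_time X c w))
  * \1_[set v | (passage_time X c v < +oo)%E] w.

Definition lifetime X e om (w : T) : \bar R := additive_functional X om (e w) w.

Definition time_change X om (s : R) (w : T) : \bar R :=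
  ereal_inf [set t%:E | t in
    [set t | (0 <= t)%R /\ (s%:E < additive_functional X om t%:E w)%E]].

(* The cemetery state is None. *)
Definition Yproc X e om (s : R) (w : T) : option R :=
  if (s%:E < lifetime X e om w)%E then Some (X (fine (time_change X om s w)) w)
  else None.

Definition Ypassage_time X e om (c : R) (w : T) : \bar R :=
  ereal_inf [set s%:E | s in
    [set s | 0 < s /\ exists2 y, Yproc X e om s w = Some y & c < y]].

Definition Wproc P X e om (gam : R) : R -> T -> R := fun s w =>
  if Yproc X e om s w is Some y
  then expR (- gam * s) * Hfun P X e (fun z => gam * om z) y
  else 0.

Definition Gfiltration X e om (F : R -> set (set T)) : R -> set (set T) := fun s =>
  <<s stopped_sigma F (time_change X om s) `|`
      <<s [set A | exists2 u, 0 <= u <= s &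
                   A = [set w | (time_change X om u w < e w)%E]] >> >>.

End levy.

(* Main.v *)
From HB Require Import structures.
Require Import Defs.
From mathcomp Require Import all_boot all_order all_algebra.
From mathcomp Require Import all_classical all_reals all_analysis.
From mathcomp Require Import measurable_realfun ring lra.

Set Implicit Arguments.
Unset Strict Implicit.
Unset Printing Implicit Defensive.

Import Order.TTheory GRing.Theory Num.Theory.
Import numFieldNormedType.Exports.

Local Open Scope classical_set_scope.
Local Open Scope ring_scope.

(** The proof rests on first passage upwards. Because there are no positive
    jumps, a path started at x <= c is exactly at c when it first exceeds c, and
    by the strong Markov property the discount expected up to the passage of c
    (passage x c) is multiplicative in the levels: passage x c' = passage x c *
    passage c c' (passage_mul). It is positive because the paths are not monotone
    (reach_neq0), equals one when c <= x (passage_eq1), and tends to one as the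
    levels merge (passage_near1). Hence passage x c = scale x / scale c for a
    positive, continuous, nondecreasing function scale. The killing at the
    independent exponential time enters the functional of the statement only
    through its survival function, that is as a discount at rate q, so that scale
    is the function H of the statement (HfunE).

    For part (i), the Markov property at time t, combined with the splitting of the
    discount at t, shows that the stopped process consists of the conditional
    expectations of its terminal value scale c * discount c (stopped_integral).
    Adaptedness, boundedness and regularity are then read off pathwise. The only
    point that needs an argument is that the stopped process tends to zero when
    the level is never passed: the maximal inequality bounds the probability of
    an excursion above eps after time n by the part of the terminal value carried
    by passages after n (stopped_vanishes).

    For part (ii), the additive functional of om is a continuous strictly
    increasing clock A, and the time change rho is its inverse. Pathwise, the
    stopped time-changed process at s is equal to exp(- gam A) H(X) evaluated at
    the minimum of rho s and of the passage time, as long as this minimum precedes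
    the exponential time, and to zero afterwards (stopped_time_change). The
    filtration is generated by the events A' and A' /\ {rho u < e} with u <= s and
    A' in the stopped sigma-algebra at rho s, and it suffices to compare integrals
    over these events. After the passage the process is constant. Before it, being
    alive at s implies being alive at u, so that the second factor can be dropped;
    averaging over the independent exponential time (exponential_freezing) then
    replaces the killing by the discount at rate q, which gives the stopped
    martingale of part (i) for the rate gam * om, sampled at the stopping time
    rho s (time_changed_integral). A lifetime that is reached at a finite clock time
    while the original time tends to infinity causes no lack of left limits,
    because almost surely the exponential time is finite, or the level has been
    passed, or the martingale of part (i) converges.

    Sub-sigma-algebras are handled by regarding the sample space with a smaller
    collection of events as a measurable space of its own. Two tools then carry
    the probabilistic part: freezing, which integrates out a variable that is
    independent of a sub-sigma-algebra, and sampling, which extends an identity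
    of integrals from fixed times to random times by right-continuity. *)

(** Measurability with respect to a sub-sigma-algebra G is measurability on the same
    points equipped with G, so that all closure properties apply. *)
Local Notation measurable_wrt G :=
  (@measurable_fun _ _ (g_sigma_algebraType G) _ setT) (only parsing).

(** * Right-continuous and cadlag paths *)

Section right_continuity.
Variable R : realType.
Implicit Types f : R -> R.

Definition rcont f := forall t, 0 <= t -> f s @[s --> t^'+] --> f t.

Lemma rcontP f t e : rcont f -> 0 <= t -> 0 < e ->
  exists2 d, 0 < d & forall s, t <= s < t + d -> `|f t - f s| < e.
Proof.
move=> rf t0 e0; have /cvgrPdist_lt/(_ e e0)[d /= d0 H] := rf t t0.
exists d => // s /andP[]; rewrite le_eqVlt => /predU1P[<- _|ts sd].
  by rewrite subrr normr0.
by apply: H => //=; rewrite ltr_distl; lra.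
Qed.

Lemma rcont_gt f t c : rcont f -> 0 <= t -> c < f t ->
  exists2 d, 0 < d & forall s, t <= s < t + d -> c < f s.
Proof.
move=> rf t0 ct; have [|d d0 H] := @rcontP f t (f t - c) rf t0.
  by rewrite subr_gt0.
by exists d => // s /H; rewrite ltr_distl; lra.
Qed.

Lemma rcont_shift f s : rcont f -> 0 <= s -> rcont (fun u => f (s + u)).
Proof.
move=> rf s0 t t0; apply/cvgrPdist_lt => e e0.
have [d d0 H] := @rcontP f (s + t) e rf (addr_ge0 s0 t0) e0.
exists d => //= u; rewrite /= ltr_distl => /andP[? ?] tu.
by apply: H; lra.
Qed.

Lemma rcont_stop f t : rcont f -> 0 <= t -> rcont (fun u => f (Num.min u t)).
Proof.
move=> rf t0 s s0; apply/cvgrPdist_lt => e e0.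
have m0 : 0 <= Num.min s t by rewrite le_min s0.
have [d d0 H] := @rcontP f (Num.min s t) e rf m0 e0.
exists d => //= u; rewrite /= ltr_distl => /andP[? ?] tu.
apply: H; rewrite /Num.min; case: ifPn; case: ifPn; rewrite -?leNgt; lra.
Qed.

Lemma cadlag_shift f s : cadlag f -> 0 <= s -> cadlag (fun u => f (s + u)).
Proof.
move=> [rf lf] s0; split; first exact: rcont_shift.
move=> t t0; have /cvg_ex[l /= /cvgrPdist_lt lfl] := lf (s + t) (ltr_wpDl s0 t0).
apply/cvg_ex; exists l; apply/cvgrPdist_lt => e /lfl[d /= d0 H].
exists d => //= u; rewrite /= ltr_distl => /andP[? ?] ut.
by apply: H => /=; [rewrite ltr_distl|]; lra.
Qed.

Lemma cadlag_stop f t : cadlag f -> 0 <= t -> cadlag (fun u => f (Num.min u t)).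
Proof.
move=> [rf lf] t0; split; first exact: rcont_stop.
move=> s s0; have [st|ts] := leP s t.
  have /cvg_ex[l /= /cvgrPdist_lt lfl] := lf s s0.
  apply/cvg_ex; exists l; apply/cvgrPdist_lt => e /lfl[d /= d0 H].
  exists d => //= u ud us; rewrite min_l; first exact: H.
  exact/ltW/(lt_le_trans us).
apply/cvg_ex; exists (f t); apply/cvgrPdist_lt => e e0.
exists (s - t); rewrite /= ?subr_gt0// => u; rewrite /= ltr_distl => /andP[? ?] us.
rewrite min_r ?subrr ?normr0//; lra.
Qed.

Lemma cadlag_addl f x : cadlag f -> cadlag (fun u => x + f u).
Proof.
move=> [rf lf]; split=> t t0.
  by apply: cvgD; [exact: cvg_cst|exact: rf].
by apply: is_cvgD; [exact: is_cvg_cst|exact: lf].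
Qed.

(** By compactness finitely many of the local bounds suffice. *)
Lemma locally_bounded_bounded (g : R -> R) a b :
  (forall x, a <= x <= b -> exists2 K, 0 <= K & exists2 d, 0 < d &
     forall u, a <= u <= b -> `|x - u| < d -> `|g u| <= K) ->
  exists2 K, 0 <= K & forall u, a <= u <= b -> `|g u| <= K.
Proof.
move=> H.
have /compact_near_coveringP := @segment_compact R a b.
move=> /(_ R (+oo%R) (fun K u => a <= u <= b -> `|g u| <= K)).
have cov : forall x : R, `[a, b]%classic x -> \forall x' \near x & i \near +oo%R,
    a <= x' <= b -> `|g x'| <= i.
  move=> x /=; rewrite in_itv/= => /H[K K0 [d d0 gK]].
  exists (ball x d, [set i | K < i]); first split.
  - exact: nbhsx_ballx.
  - by exists K; split=> //; exact: num_real.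
  by move=> [u i] /= [xu Ki] uab; rewrite (le_trans (gK _ _ _))// ltW.
move=> /(_ _ cov)[M [_ /(_ (Num.max M 0 + 1))]] H2.
exists (Num.max M 0 + 1); first by rewrite addr_ge0// le_max lexx orbT.
move=> u uab; apply: H2 => //=.
by rewrite ltr_pwDr// le_max lexx.
Qed.

(** Each point of [0, t] has a neighbourhood on which a cadlag path is
    bounded: one half is controlled by the value at the point, the other half by
    the left limit. *)
Lemma cadlag_bounded f t : cadlag f -> 0 <= t ->
  exists2 K, 0 <= K & forall u, 0 <= u <= t -> `|f u| <= K.
Proof.
move=> [rf lf] t0; apply: locally_bounded_bounded => x /andP[x0 xt].
have [d d0 Hd] := @rcontP f x 1 rf x0 ltr01.
move: x0; rewrite le_eqVlt => /predU1P[x0|x0].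
  exists (`|f x| + 1); [by rewrite addr_ge0|exists d => // u /andP[u0 _]].
  move: Hd; rewrite -x0 => Hd; rewrite ltr_distl => xu.
  have := Hd u; rewrite ltr_distl => /(_ ltac:(lra)) ?.
  by rewrite ler_norml; have := ler_norm (f 0); have := ler_norm (- f 0);
     rewrite normrN; lra.
have /cvg_ex[l /= /cvgrPdist_lt/(_ 1 ltr01)[d' /= d'0 H']] := lf x x0.
exists (`|f x| + `|l| + 1); first by rewrite !addr_ge0.
exists (Num.min d d'); first by rewrite lt_min d0.
move=> u _; rewrite lt_min => /andP[ud ud'].
have := ler_norm (f x); have := ler_norm (- f x); have := ler_norm (- l).
have := ler_norm l; rewrite !normrN; have := normr_ge0 l; have := normr_ge0 (f x).
have [xu|ux] := leP x u.
  have := Hd u; move: ud; rewrite !ltr_distl => ud /(_ ltac:(lra)).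
  by rewrite ler_norml; lra.
by have := H' u ud' ux; rewrite ltr_distl ler_norml; lra.
Qed.

Lemma cadlag_cst (x : R) : cadlag (fun _ : R => x).
Proof. by split=> t _; [exact: cvg_cst|exact: is_cvg_cst]. Qed.

Lemma eq_cadlag f g : (forall t, 0 <= t -> f t = g t) ->
  cadlag f -> cadlag g.
Proof.
move=> fg [rf lf]; split=> t t0.
  rewrite -fg//; apply: cvg_trans (rf t t0); apply: near_eq_cvg; near=> u.
  by apply: fg; apply: (le_trans t0); near: u; exact: nbhs_right_ge.
have /cvg_ex[l fl] := lf t t0.
apply/cvg_ex; exists l; apply: cvg_trans fl; apply: near_eq_cvg; near=> u.
by apply: fg; near: u; exact: nbhs_left_ge.
Unshelve. all: by end_near. Qed.

Lemma cadlag_comp (h f : R -> R) : continuous h -> cadlag f -> cadlag (h \o f).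
Proof.
move=> ch [rf lf]; split=> t t0; first exact: (cvg_comp _ _ (rf t t0) (ch _)).
have /cvg_ex[l fl] := lf t t0.
by apply/cvg_ex; exists (h l); exact: (cvg_comp _ _ fl (ch _)).
Qed.

Lemma cadlagM (f g : R -> R) : cadlag f -> cadlag g -> cadlag (fun t => f t * g t).
Proof.
move=> [rf lf] [rg lg]; split=> t t0; first by apply: cvgM; [exact: rf|exact: rg].
by apply: is_cvgM; [exact: lf|exact: lg].
Qed.

End right_continuity.

Section first_passage.
Variable R : realType.
Implicit Types (f : R -> R) (c t : R).

(** The passage time of the statement, for a single path. A path that starts at c
    may have passage time zero. *)
Definition hit c f : \bar R := ereal_inf [set t%:E | t in [set t | 0 < t /\ c < f t]].

Lemma hit_ge0 c f : (0 <= hit c f)%E.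
Proof. by apply: le_ereal_inf_tmp => _ [t [t0 _] <-]; rewrite lee_fin ltW. Qed.

Lemma hit_lt c f t : (hit c f < t%:E)%E <-> exists2 s, 0 < s < t & c < f s.
Proof.
split=> [/ereal_inf_lt[_ [s [s0 cs] <-]]|[s /andP[s0 st] cs]].
  by rewrite lte_fin => st; exists s => //; rewrite s0.
apply: (@le_lt_trans _ _ s%:E); last by rewrite lte_fin.
by apply: ereal_inf_lbound; exists s.
Qed.

(** By right-continuity a level passed at some time is passed on an interval,
    which makes passage times measurable. *)
Lemma hit_ltP c f t : rcont f ->
  (hit c f < t%:E)%E <-> exists r : rat, 0 < (ratr r : R) < t /\ c < f (ratr r).
Proof.
move=> rf; split=> [/hit_lt[s /andP[s0 st] cs]|[r [rt cr]]]; last first.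
  by apply/hit_lt; exists (ratr r).
have [d d0 H] := rcont_gt rf (ltW s0) cs.
have /rat_in_itvoo[r] : s < Num.min t (s + d) by rewrite lt_min st ltrDl.
rewrite in_itv/= lt_min => /and3P[sr rt rd]; exists r.
by split; [rewrite (lt_trans s0)|apply: H; rewrite rd ltW].
Qed.

Lemma eq_lt_ereal (x y : \bar R) : (0 <= x)%E -> (0 <= y)%E ->
  (forall t, 0 < t -> (x < t%:E)%E <-> (y < t%:E)%E) -> x = y.
Proof.
suff H (u v : \bar R) : (0 <= v)%E -> (forall t, 0 < t -> (v < t%:E)%E -> (u < t%:E)%E) ->
    (u <= v)%E.
  move=> x0 y0 xy; apply/eqP; rewrite eq_le; apply/andP; split.
    by apply: H => // t t0 yt; exact: (xy t t0).2.
  by apply: H => // t t0 xt; exact: (xy t t0).1.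
case: v => [r||] //=; rewrite ?leey// lee_fin => r0 uv.
apply/lee_addgt0Pr => e e0; apply/ltW; rewrite -EFinD.
by apply: uv; rewrite ?lte_fin; lra.
Qed.

Lemma hit_le c c' f : c <= c' -> (hit c f <= hit c' f)%E.
Proof.
move=> cc; apply: le_ereal_inf_tmp => _ [t [t0 ct] <-].
by apply: ereal_inf_lbound; exists t => //; split=> //; exact: le_lt_trans ct.
Qed.

Lemma hit_stop_lt c f t s : s <= t ->
  (hit c (fun u => f (Num.min u t)) < s%:E)%E <-> (hit c f < s%:E)%E.
Proof.
move=> st; rewrite !hit_lt; split=> -[u /andP[u0 us] cu]; exists u;
  rewrite ?u0//.
- by move: cu; rewrite min_l// ltW// (lt_le_trans us).
- by rewrite min_l// ltW// (lt_le_trans us).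
Qed.

Lemma hit_stop c f t : 0 <= t ->
  Order.min t%:E (hit c (fun u => f (Num.min u t))) = Order.min t%:E (hit c f).
Proof.
move=> t0; apply: eq_lt_ereal => [||s s0]; try by rewrite le_min lee_fin t0 hit_ge0.
rewrite !gt_min; have [ts|st] /= := ltP t%:E s%:E => //.
by rewrite hit_stop_lt// -lee_fin.
Qed.

(** The passage time of the shifted path ignores its starting point f t; should f
    exceed c there, right-continuity makes f exceed c at later times as well. *)
Lemma hit_shift c f t : rcont f -> 0 <= t -> (t%:E <= hit c f)%E ->
  hit c f = (t%:E + hit c (fun u => f (t + u)%R))%E.
Proof.
move=> rf t0 th.
apply: eq_lt_ereal => [||s s0]; rewrite ?adde_ge0 ?hit_ge0 ?lee_fin//.
rewrite -[(t%:E + _ < _)%E]lteBrDl// -EFinB !hit_lt; split.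
  move=> [u /andP[u0 us] cu].
  have : t <= u.
    rewrite -lee_fin (le_trans th)//; apply: ereal_inf_lbound.
    by exists u.
  rewrite le_eqVlt => /predU1P[tu|tu].
    have [d d0 H] := rcont_gt rf (ltW u0) cu.
    exists (Num.min (d / 2) ((s - t) / 2)).
      by rewrite /Num.min; case: ifPn => ?; lra.
    apply: H; rewrite tu /Num.min; case: ifPn => ?; lra.
  by exists (u - t); [lra|rewrite addrC subrK].
by move=> [u us cu]; exists (t + u) => //; lra.
Qed.

Lemma hit_val_ge c f t : rcont f -> hit c f = t%:E -> c <= f t.
Proof.
move=> rf ht; have t0 : 0 <= t by rewrite -lee_fin -ht hit_ge0.
rewrite leNgt; apply/negP => ft; have [d d0 H] := rcontP rf t0 (e := c - f t) ltac:(lra).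
have /hit_lt[s /andP[s0 sd] cs] : (hit c f < (t + d)%:E)%E.
  by rewrite ht lte_fin ltrDl.
have : t <= s by rewrite -lee_fin -ht; apply: ereal_inf_lbound; exists s.
by move=> ts; have := H s; rewrite ltr_distl => /(_ ltac:(lra)); lra.
Qed.

Lemma hit_before c f t : 0 < t -> (t%:E < hit c f)%E -> f t <= c.
Proof.
move=> t0; apply: contraTT; rewrite -ltNge -leNgt => cf.
by apply: ereal_inf_lbound; exists t.
Qed.

(** Up to the passage time included, the level is not exceeded: the left limit at
    that time does not exceed it, and the path does not jump upwards. *)
Lemma hit_val_le c f t : cadlag f -> no_positive_jumps f -> f 0 <= c ->
  0 <= t -> (t%:E <= hit c f)%E -> f t <= c.
Proof.
move=> [rf lf] jf f0 + th; rewrite le_eqVlt => /predU1P[<-//|t0].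
apply: le_trans (jf t t0) _; apply: limr_le; first exact: lf.
near=> s; apply: hit_before; first by near: s; exact: nbhs_left_gt.
apply: lt_le_trans th; rewrite lte_fin; near: s; exact: nbhs_left_lt.
Unshelve. all: by end_near. Qed.

Lemma hit_val c f t : cadlag f -> no_positive_jumps f -> f 0 <= c ->
  hit c f = t%:E -> f t = c.
Proof.
move=> cf jf f0 ht; apply/eqP; rewrite eq_le (hit_val_ge cf.1 ht) andbT.
by apply: hit_val_le => //; rewrite -?ht// -lee_fin -ht hit_ge0.
Qed.

Lemma hit_eq0 c f : rcont f -> c < f 0 -> hit c f = 0%E.
Proof.
move=> rf cf; have [d d0 H] := rcont_gt rf (lexx 0) cf.
apply: eq_lt_ereal; rewrite ?hit_ge0// => t t0; rewrite lte_fin t0; split=> // _.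
apply/hit_lt; exists (Num.min (d / 2) (t / 2)).
  by rewrite /Num.min; case: ifPn => ?; lra.
by apply: H; rewrite /Num.min; case: ifPn => ?; lra.
Qed.

Lemma hit_addl c f x : hit c (fun u => x + f u) = hit (c - x) f.
Proof.
by congr ereal_inf; apply/seteqP; split=> _ [t [t0 ct] <-]; exists t => //; split=> //;
  rewrite /= ?ltrBlDl// -ltrBlDl.
Qed.

Lemma hit_finE c f : (hit c f < +oo)%E -> hit c f = (fine (hit c f))%:E.
Proof. by move=> h; rewrite fineK// ge0_fin_numE ?hit_ge0. Qed.

Lemma eq_hit c f g : (forall u, 0 <= u -> f u = g u) -> hit c f = hit c g.
Proof.
move=> fg; congr ereal_inf; apply/seteqP; split=> _ [t [t0 ct] <-]; exists t => //; split=> //.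
  by rewrite -fg// ltW.
by rewrite fg// ltW.
Qed.

End first_passage.

(** * Joint measurability, and additive functionals of paths *)

Section measurable_evaluation.
Context d (T : measurableType d) (R : realType).
Implicit Types (V : R -> T -> R).

Lemma measurable_countable_choice d' (S : measurableType d') (g : T -> nat)
    (h : nat -> T -> S) :
  (forall k, measurable (g @^-1` [set k])) ->
  (forall k, measurable_fun setT (h k)) ->
  measurable_fun setT (fun w => h (g w) w).
Proof.
move=> mg mh _ Y mY; rewrite setTI.
rewrite (_ : _ @^-1` Y = \bigcup_k (g @^-1` [set k] `&` h k @^-1` Y)).
  apply: bigcup_measurable => k _; apply: measurableI => //.
  by rewrite -[_ @^-1` _]setTI; exact: mh.
by apply/seteqP; split=> [w Yw|w [k _ [/= <-]]//]; exists (g w).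
Qed.

Lemma measurable_bigcup_rat (D : set rat) (A : rat -> set T) :
  (forall r, D r -> measurable (A r)) -> measurable (\bigcup_(r in D) A r).
Proof.
move=> mA; rewrite bigcup_mkcond; apply: bigcupT_measurable_rat => r.
by case: ifPn => // /set_mem; exact: mA.
Qed.

Lemma measurable_ge0_lt (f : T -> \bar R) : (forall w, (0 <= f w)%E) ->
  (forall t, 0 < t -> measurable [set w | (f w < t%:E)%E]) -> measurable_fun setT f.
Proof.
move=> f0 mf; apply: (measurability (@ErealGenInftyO.G R)).
  exact: ErealGenInftyO.measurableE.
move=> _ [_ [r ->] <-]; rewrite setTI.
have [r0|r0] := ltP 0 r; first by move: (mf r r0); congr measurable.
rewrite (_ : _ @^-1` _ = set0)//; apply/seteqP; split=> w //=.
rewrite in_itv/= => fr; have := le_lt_trans (f0 w) fr.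
by rewrite lte_fin ltNge r0.
Qed.

(** The least multiple of 1/(n+1) strictly above t: evaluating a
    right-continuous path along these grid times recovers it in the limit. *)
Definition grid_above (n : nat) (t : R) : R :=
  (Num.truncn (n.+1%:R * t)).+1%:R / n.+1%:R.

Lemma grid_above_itv n t : 0 <= t -> t < grid_above n t <= t + n.+1%:R^-1.
Proof.
move=> t0; have n0 : 0 < n.+1%:R :> R by rewrite ltr0n.
have /truncn_itv/andP[] : 0 <= n.+1%:R * t by rewrite mulr_ge0.
rewrite /grid_above => h1 h2; rewrite ltr_pdivlMr// mulrC h2/=.
rewrite -[X in _ <= _ + X]mul1r -[X in X + _](mulfK (lt0r_neq0 n0)) -mulrDl.
apply: ler_wpM2r; first by rewrite invr_ge0 ltW.
by rewrite -natr1 lerD2r [t * _]mulrC.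
Qed.

Lemma grid_above_cvg (f : R -> R) t : rcont f -> 0 <= t ->
  f (grid_above n t) @[n --> \oo] --> f t.
Proof.
move=> rf t0; apply/cvgrPdist_lt => e e0; have [d' d0 H] := rcontP rf t0 e0.
near=> n; apply: H; have /andP[/ltW-> h] := grid_above_itv n t0.
apply: (le_lt_trans h); rewrite ltrD2l.
near: n; exact: (near_infty_natSinv_lt (PosNum d0)).
Unshelve. all: by end_near. Qed.

Lemma measurable_grid_above d' (S : measurableType d') (h : R -> T -> S) (r : T -> R) n :
  measurable_fun setT r -> (forall w, 0 <= r w) ->
  (forall t, 0 <= t -> measurable_fun setT (h t)) ->
  measurable_fun setT (fun w => h (grid_above n (r w)) w).
Proof.
move=> mr r0 mh.
apply: (@measurable_countable_choice _ _ (fun w => Num.truncn (n.+1%:R * r w))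
  (fun k => h (k.+1%:R / n.+1%:R))) => k; last by apply: mh; rewrite divr_ge0.
rewrite (_ : _ @^-1` _ = r @^-1` `[k%:R / n.+1%:R, k.+1%:R / n.+1%:R[).
  by rewrite -[_ @^-1` _]setTI; apply: mr => //; exact: measurable_itv.
apply/seteqP; split=> w /=; rewrite in_itv/= => rk.
  rewrite ler_pdivrMr// ltr_pdivlMr// mulrC -truncn_eq ?rk//.
  by rewrite mulr_ge0.
move: rk; rewrite ler_pdivrMr// ltr_pdivlMr// mulrC => rk; exact: truncn_def.
Qed.

(** Joint measurability of a right-continuous process, as a limit of its
    evaluations on the grid. *)
Lemma measurable_eval V (r : T -> R) :
  (forall t, 0 <= t -> measurable_fun setT (V t)) -> (forall w, rcont (V^~ w)) ->
  measurable_fun setT r -> (forall w, 0 <= r w) ->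
  measurable_fun setT (fun w => V (r w) w).
Proof.
move=> mV rV mr r0.
apply: (@measurable_fun_cvg _ _ _ _ (fun n w => V (grid_above n (r w)) w)).
  by move=> n; exact: measurable_grid_above.
by move=> w _; exact: (@grid_above_cvg (V^~ w)).
Qed.

Lemma measurable_hit V c :
  (forall t, 0 <= t -> measurable_fun setT (V t)) -> (forall w, rcont (V^~ w)) ->
  measurable_fun setT (fun w => hit c (V^~ w)).
Proof.
move=> mV rV; apply: measurable_ge0_lt => [w|t t0]; first exact: hit_ge0.
rewrite (_ : [set _ | _] = \bigcup_(r in [set r : rat | 0 < (ratr r : R) < t])
    (V (ratr r) @^-1` `]c, +oo[)).
  apply: measurable_bigcup_rat => r /= /andP[r0 _].
  by rewrite -[_ @^-1` _]setTI; apply: mV; rewrite ?ltW//; exact: measurable_itv.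
apply/seteqP; split=> w /=; first move=> /(hit_ltP _ _ (rV w))[r [rt cr]].
  by exists r => //=; rewrite in_itv/= cr.
by move=> [r rt]; rewrite /= in_itv/= andbT => cr; apply/(hit_ltP _ _ (rV w)); exists r.
Qed.

End measurable_evaluation.

Lemma measurable_rcont (R : realType) (f : R -> R) : rcont f ->
  measurable_fun setT (fun u : R => f (Num.max 0 u)).
Proof.
move=> rf; apply: (@measurable_eval _ _ _ (fun t _ => f t)) => //.
  by apply: measurable_maxr => //; exact: measurable_cst.
by move=> w; rewrite le_max lexx.
Qed.

Section lebesgue_translation.
Variable R : realType.
Local Notation mu := (@lebesgue_measure R).

Lemma measurable_translation s : measurable_fun setT ((fun x => s + x) : R -> measurableTypeR R).
Proof. by apply: measurable_funD => //; exact: measurable_cst. Qed.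

Lemma lebesgue_measure_translation s (A : set R) : measurable A ->
  pushforward mu ((fun x => s + x) : _ -> measurableTypeR R) A = mu A.
Proof.
have ms := measurable_translation s.
move=> mA; apply/esym/lebesgue_measure_unique => //= _ [[a b]] _ <-.
rewrite /pushforward (_ : _ @^-1` _ = [set` `](a - s), (b - s)]]); last first.
  by apply/seteqP; split=> x /=; rewrite !in_itv/=; lra.
rewrite !lebesgue_measure_itv/= !lte_fin ltrD2r.
by case: ifP => // _; rewrite -!EFinB; congr EFin; ring.
Qed.

Lemma ge0_integral_itv_shift (g : R -> \bar R) (s t : R) :
  measurable_fun setT g -> (forall x, (0 <= g x)%E) ->
  (\int[mu]_(x in `[s, (s + t)%R]) g x = \int[mu]_(x in `[0%R, t]) g (s + x)%R)%E.
Proof.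
move=> mg g0; have ms := measurable_translation s.
rewrite (_ : `[0, t]%classic =
    ((fun x => s + x) : _ -> measurableTypeR R) @^-1` `[s, s + t]); last first.
  by apply/seteqP; split=> x /=; rewrite !in_itv/=; lra.
have E := @ge0_integral_pushforward _ _ (measurableTypeR R) (measurableTypeR R) R _ ms mu
  `[s, s + t]%classic g.
rewrite -E//; last exact: measurable_funS mg.
by apply: eq_measure_integral => //= A mA AS; exact/esym/lebesgue_measure_translation.
Qed.

End lebesgue_translation.

Section clock.
Variables (R : realType) (om : R -> R).
Hypotheses (om_meas : measurable_fun setT om) (om_ge0 : forall y, 0 <= om y).
Hypothesis om_loc : locally_bounded om.
Local Notation mu := (@lebesgue_measure R).
Implicit Types (f : R -> R) (s t : R).

(** The additive functional, as a real number because om is bounded along cadlag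
    paths on compact time intervals. *)
Definition clock f t : R := fine (\int[mu]_(u in `[0%R, t]) (om (f u))%:E)%E.

Lemma om_bounded M : exists2 K, 0 <= K & forall y, `|y| <= M -> om y <= K.
Proof.
have [|K K0 H] := @locally_bounded_bounded R om (- M) M; last first.
  exists K => // y; rewrite ler_norml => yM.
  exact: le_trans (ler_norm _) (H _ yM).
move=> x _; have [K [_ /(_ (Num.max K 0 + 1))H]] := om_loc I (x := x).
exists (Num.max K 0 + 1); first by rewrite addr_ge0// le_max lexx orbT.
have [|d d0 dH] := H; first by rewrite ltr_pwDr// le_max lexx.
by exists d => // u _ xu; exact: dH.
Qed.

Lemma om_path_bounded f t : cadlag f -> 0 <= t ->
  exists2 K, 0 <= K & forall u, 0 <= u <= t -> om (f u) <= K.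
Proof.
move=> cf t0; have [M M0 HM] := cadlag_bounded cf t0; have [K K0 HK] := om_bounded M.
by exists K => // u /HM/HK.
Qed.

Lemma measurable_om_path f : rcont f ->
  measurable_fun setT (fun u : R => (om (f (Num.max 0 u)))%:E).
Proof.
move=> rf; apply/measurable_EFinP; apply: (measurableT_comp om_meas).
exact: measurable_rcont.
Qed.

Lemma integral_om_path f t :
  (\int[mu]_(u in `[0%R, t]) (om (f u))%:E =
   \int[mu]_(u in `[0%R, t]) (om (f (Num.max 0 u)))%:E)%E.
Proof.
apply: eq_integral => u; rewrite inE/= in_itv/= => /andP[u0 _].
by rewrite max_r.
Qed.

Lemma integral_om_le f t K : rcont f -> 0 <= t ->
  (forall u, 0 <= u <= t -> om (f u) <= K) ->
  (\int[mu]_(u in `[0%R, t]) (om (f u))%:E <= (K * t)%:E)%E.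
Proof.
move=> rf t0 fK; rewrite integral_om_path.
apply: (@le_trans _ _ (\int[mu]_(u in `[0%R, t]) (cst K%:E) u)%E).
  apply: ge0_le_integral => //.
  - by move=> x _; rewrite lee_fin.
  - by apply: measurable_funTS; exact: measurable_om_path.
  - by move=> x /=; rewrite in_itv/= lee_fin => xt; apply: fK; rewrite max_r//; case/andP: xt.
rewrite integral_cst//= lebesgue_measure_itv/= lte_fin.
by case: ltgtP t0 => // [t0|<-] _; rewrite -?EFinB ?subr0 -?EFinM// mulr0 mule0.
Qed.

Lemma EFin_clock f t : cadlag f ->
  (clock f t)%:E = (\int[mu]_(u in `[0%R, t]) (om (f u))%:E)%E.
Proof.
move=> cf; rewrite /clock; have [t0|t0] := leP 0 t; last first.
  by rewrite set_itv_ge ?integral_set0// bnd_simp -ltNge.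
have [K K0 HK] := om_path_bounded cf t0.
rewrite fineK// ge0_fin_numE; last by apply: integral_ge0 => u _; rewrite lee_fin.
by apply: le_lt_trans (integral_om_le cf.1 t0 HK) _; rewrite ltry.
Qed.

Lemma clock_ge0 f t : 0 <= clock f t.
Proof. by apply: fine_ge0; apply: integral_ge0 => u _; rewrite lee_fin. Qed.

Lemma clock0 f : clock f 0 = 0.
Proof. by rewrite /clock set_itv1 integral_set1. Qed.

Lemma clock_add f s t : cadlag f -> 0 <= s -> 0 <= t ->
  clock f (s + t) = clock f s + clock (fun u => f (s + u)) t.
Proof.
move=> cf s0 t0; apply: EFin_inj.
rewrite EFinD !EFin_clock//; last exact: cadlag_shift.
have mg := measurable_om_path cf.1.
have g0 x : (0 <= (om (f (Num.max 0%R x)))%:E)%E by rewrite lee_fin.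
rewrite !(integral_om_path f).
rewrite (_ : `[0, s + t]%classic = `[0, s[%classic `|` `[s, s + t]%classic); last first.
  by apply/seteqP; split=> x /=; rewrite !in_itv/=; lra.
rewrite ge0_integral_setU//=; last 2 first.
- by apply: measurable_funTS.
- by rewrite disj_set2E; apply/eqP/seteqP; split=> x //= []; rewrite !in_itv/=; lra.
rewrite ge0_integral_itv_shift//; congr (_ + _)%E.
  apply: integral_itv_bndo_bndc; exact: measurable_funTS.
apply: eq_integral => u; rewrite inE/= in_itv/= => /andP[u0 _].
by rewrite max_r// addr_ge0.
Qed.

Lemma clock_le_cst f t K : cadlag f -> 0 <= t ->
  (forall u, 0 <= u <= t -> om (f u) <= K) -> clock f t <= K * t.
Proof.
move=> cf t0 fK; rewrite -lee_fin EFin_clock//; exact: integral_om_le cf.1 t0 fK.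
Qed.

Lemma clock_le f s t : cadlag f -> 0 <= s <= t -> clock f s <= clock f t.
Proof.
move=> cf /andP[s0 st]; rewrite -[t](subrKC s) clock_add ?subr_ge0//.
by rewrite lerDl clock_ge0.
Qed.

(** A positive function has a positive integral over an interval of positive
    length, although no lower bound on it is available. *)
Lemma clock_gt0 f t : cadlag f -> (forall y, 0 < om y) -> 0 < t -> 0 < clock f t.
Proof.
move=> cf om0 t0; rewrite lt_neqAle clock_ge0 andbT; apply/eqP => c0.
have := EFin_clock t cf; rewrite -c0 integral_om_path => /esym I0.
have mg := measurable_funTS (D := `[0, t]%classic) (measurable_om_path cf.1).
have := (ae_eq_integral_abs mu (measurable_itv _) mg).1.
have -> : (\int[mu]_(x in `[0%R, t]) `|(om (f (Num.max 0 x)))%:E| = 0)%E.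
  by rewrite -[RHS]I0; apply: eq_integral => u _; rewrite abse_EFin ger0_norm.
move=> /(_ erefl)[N [mN N0 sN]].
have : (mu `[0%R, t] <= mu N)%E.
  apply: le_measure; rewrite ?inE// => u tu; apply: sN => /= /(_ tu)[] /eqP.
  by rewrite gt_eqF.
by rewrite N0 lebesgue_measure_itv/= lte_fin t0 -EFinB subr0 lee_fin leNgt t0.
Qed.

Lemma clock_lt f s t : cadlag f -> (forall y, 0 < om y) -> 0 <= s -> s < t ->
  clock f s < clock f t.
Proof.
move=> cf om0 s0 st; rewrite -[t](subrKC s) clock_add ?subr_ge0 ?(ltW st)//.
by rewrite ltrDl clock_gt0// ?subr_gt0//; exact: cadlag_shift.
Qed.

Lemma clock_continuous f t e : cadlag f -> 0 <= t -> 0 < e ->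
  exists2 d, 0 < d & forall s, 0 <= s -> `|t - s| < d -> `|clock f t - clock f s| < e.
Proof.
move=> cf t0 e0; have [|K K0 HK] := om_path_bounded (t := t + 1) cf.
  by rewrite addr_ge0.
have lip a b : 0 <= a -> a <= b -> b <= t + 1 -> `|clock f b - clock f a| <= K * (b - a).
  move=> a0 ab bt; rewrite -[b](subrKC a) clock_add ?subr_ge0//.
  rewrite [_ + _ - clock f a]addrC addKr [_ + _ - a]addrC addKr ger0_norm ?clock_ge0//.
  apply: clock_le_cst; [exact: cadlag_shift|by rewrite subr_ge0|].
  by move=> u ub; apply: HK; lra.
have K1 : 0 < K + 1 by rewrite ltr_wpDl.
exists (Num.min 1 (e / (K + 1))); first by rewrite lt_min ltr01 divr_gt0.
move=> s s0; rewrite lt_min ltr_pdivlMr// => /andP[h1 h2].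
have [st|/ltW ts] := leP s t.
  apply: le_lt_trans (lip _ _ s0 st _) _; first by lra.
  by move: h2; rewrite ger0_norm ?subr_ge0//; nra.
rewrite distrC; apply: le_lt_trans (lip _ _ t0 ts _) _.
  by move: h1; rewrite distrC ger0_norm ?subr_ge0//; lra.
by move: h2; rewrite distrC ger0_norm ?subr_ge0//; nra.
Qed.

Lemma clock_rcont f : cadlag f -> rcont (clock f).
Proof.
move=> cf t t0; apply/cvgrPdist_lt => e e0.
have [d d0 H] := clock_continuous cf t0 e0.
by exists d => //= s ts /ltW st; apply: H => //; exact: le_trans st.
Qed.

Lemma clock_cadlag f : cadlag f -> cadlag (clock f).
Proof.
move=> cf; split; first exact: clock_rcont.
move=> t t0; apply/cvg_ex; exists (clock f t); apply/cvgrPdist_lt => e e0.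
have [d' d'0 H] := clock_continuous cf (ltW t0) e0.
exists (Num.min d' t); first by rewrite /= lt_min d'0.
move=> s /=; rewrite lt_min => /andP[h1 h2] st; apply: H => //.
by move: h2; rewrite ltr_distl; lra.
Qed.

Lemma eq_clock f g t : (forall u, 0 <= u <= t -> f u = g u) -> clock f t = clock g t.
Proof.
move=> fg; congr fine; apply: eq_integral => u; rewrite inE/= in_itv/= => ut.
by rewrite fg.
Qed.

Lemma measurable_clock d (T : measurableType d) (V : R -> T -> R) t :
  (forall t, 0 <= t -> measurable_fun setT (V t)) -> (forall w, cadlag (V^~ w)) ->
  measurable_fun setT (fun w => clock (V^~ w) t).
Proof.
move=> mV cV; apply/measurable_EFinP.
(* Jointly measurable in time and the sample point, so that Tonelli's theorem applies. *)
pose h (p : T * R) := ((om (V (Num.max 0 p.2) p.1))%:E *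
  (\1_(`[0%R, t]%classic : set R) p.2)%:E)%E.
have mh : measurable_fun setT h.
  apply: emeasurable_funM; apply/measurable_EFinP.
    apply: (measurableT_comp om_meas).
    apply: (@measurable_eval _ (T * R)%type R (fun s p => V s p.1)
      (fun p : T * R => Num.max 0 p.2)) => //.
    - by move=> s s0; apply: measurableT_comp; [exact: mV|exact: measurable_fst].
    - by move=> p; exact: (cV p.1).1.
    - apply: measurable_maxr; [exact: measurable_cst|exact: measurable_snd].
    - by move=> p; rewrite le_max lexx.
  by apply: measurableT_comp; [exact: measurable_indic|exact: measurable_snd].
have h0 p : (0 <= h p)%E by rewrite mule_ge0// lee_fin.
rewrite (_ : _ \o _ = fubini_F mu h).
  exact: measurable_fun_fubini_tonelli_F.
apply/funext => w; rewrite /= EFin_clock// integral_om_path /fubini_F.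
rewrite [LHS]integral_mkcond; congr integral; apply/funext => u.
by rewrite /h /patch indicE/=; case: ifPn => _; rewrite ?mule1 ?mule0.
Qed.

End clock.

Section scaled_rate.
Variables (R : realType) (om : R -> R) (gam : R).
Hypotheses (om_meas : measurable_fun setT om) (om_ge0 : forall y, 0 <= om y).
Hypotheses (om_loc : locally_bounded om) (gam_ge0 : 0 <= gam).

Lemma locally_boundedM : locally_bounded (fun z => gam * om z).
Proof.
move=> x xT; have [M0 [_ HM]] := om_loc xT.
set M := Num.max M0 0 + 1; have M1 : M0 < M by rewrite ltr_pwDr// le_max lexx.
have := HM M M1; move=> H; exists (gam * M); split; first exact: num_real.
move=> K gK; apply: filterS H => y /= yM.
rewrite normrM (ger0_norm gam_ge0); apply: le_trans (ltW gK).
exact: ler_wpM2l.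
Qed.

Lemma clockM f t : cadlag f -> clock (fun z => gam * om z) f t = gam * clock om f t.
Proof.
move=> cf; rewrite {1}/clock integral_om_path.
transitivity (fine (gam%:E * (clock om f t)%:E)%E); last by [].
congr fine; rewrite EFin_clock// [in RHS]integral_om_path -ge0_integralZl_EFin//.
- by move=> u _; rewrite lee_fin.
- by apply: measurable_funTS; exact: measurable_om_path cf.1.
Qed.

End scaled_rate.

(** * Sub-sigma-algebras: freezing and sampling *)

Section finite_pushforward.
Context d d' (T1 : measurableType d) (T2 : measurableType d') (R : realType).
Variables (m : {finite_measure set T1 -> \bar R}) (f : {mfun T1 >-> T2}).

Let image_measure := pushforward m f.

Let image0 : image_measure set0 = 0%E.
Proof. exact: measure0. Qed.

Let image_ge0 A : (0 <= image_measure A)%E.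
Proof. exact: measure_ge0. Qed.

Let image_sigma_additive : semi_sigma_additive image_measure.
Proof. exact: measure_semi_sigma_additive. Qed.

HB.instance Definition _ := isMeasure.Build _ _ _ image_measure
  image0 image_ge0 image_sigma_additive.

Let image_fin : fin_num_fun image_measure.
Proof. by move=> A mA; apply: (fin_num_measure m); exact: measurable_funPTI. Qed.

HB.instance Definition _ :=
  Measure_isFinite.Build _ _ _ image_measure image_fin.

Lemma finite_pushforward_subproof :
  exists m1 : {finite_measure set T2 -> \bar R}, forall A, m1 A = m (f @^-1` A).
Proof. by exists image_measure. Qed.

End finite_pushforward.

(** Restricting a measure to a sub-sigma-algebra is pushing it forward along the
    identity; products of measures are available for the result only if it is known to
    be finite. *)
Lemma finite_pushforward d d' (T1 : measurableType d) (T2 : measurableType d')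
    (R : realType) (m : {finite_measure set T1 -> \bar R}) (f : T1 -> T2) :
  measurable_fun setT f ->
  exists m1 : {finite_measure set T2 -> \bar R}, forall A, m1 A = m (f @^-1` A).
Proof. by move=> mf; exact: (finite_pushforward_subproof m (mfun_Sub (mem_set mf))). Qed.

Section sub_sigma_algebras.
Context d (T : measurableType d) (R : realType).
Implicit Types (G : set (set T)).

Lemma sub_measurable_funP G d' (S : measurableType d') (f : T -> S) :
  sigma_algebra setT G ->
  measurable_wrt G f <->
  (forall B, measurable B -> G (f @^-1` B)).
Proof.
move=> sG; have mE := measurable_g_measurableTypeE sG.
split=> [mf B mB|H _ B mB]; last by rewrite mE setTI; exact: H.
by rewrite -mE -[_ @^-1` _]setTI; exact: mf.
Qed.

Lemma sub_measurable_fun G d' (S : measurableType d') (f : T -> S) :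
  G `<=` measurable -> sigma_algebra setT G ->
  measurable_wrt G f -> measurable_fun setT f.
Proof.
by move=> Gm sG /sub_measurable_funP H _ B mB; rewrite setTI; apply/Gm/H.
Qed.

Lemma sigma_algebra_setI G A B : sigma_algebra setT G -> G A -> G B -> G (A `&` B).
Proof.
move=> sG; rewrite -(measurable_g_measurableTypeE sG); exact: measurableI.
Qed.

Lemma sigma_algebra_setC G A : sigma_algebra setT G -> G A -> G (~` A).
Proof.
by move=> sG; rewrite -(measurable_g_measurableTypeE sG); exact: measurableC.
Qed.

Lemma sigma_algebra_setD G A B : sigma_algebra setT G -> G A -> G B -> G (A `\` B).
Proof.
by move=> sG; rewrite -(measurable_g_measurableTypeE sG); exact: measurableD.
Qed.

Lemma sigma_algebra_setU G A B : sigma_algebra setT G -> G A -> G B -> G (A `|` B).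
Proof.
by move=> sG; rewrite -(measurable_g_measurableTypeE sG); exact: measurableU.
Qed.

Lemma sigma_algebra_setT G : sigma_algebra setT G -> G setT.
Proof.
by move=> sG; rewrite -(measurable_g_measurableTypeE sG); exact: measurableT.
Qed.

Lemma sigma_algebra_bigcup_rat G (D : set rat) (A : rat -> set T) :
  sigma_algebra setT G -> (forall r, D r -> G (A r)) -> G (\bigcup_(r in D) A r).
Proof.
by move=> sG; rewrite -(measurable_g_measurableTypeE sG); exact: measurable_bigcup_rat.
Qed.

Lemma ge0_integral_mrestr (mu : {measure set T -> \bar R}) (D : set T)
    (mD : measurable D) (f : T -> \bar R) :
  measurable_fun setT f -> (forall w, (0 <= f w)%E) ->
  (\int[mrestr mu mD]_w f w = \int[mu]_(w in D) f w)%E.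
Proof.
move=> mf f0; rewrite -(setUv D) ge0_integral_setU//; last 3 first.
- exact: measurableC.
- by rewrite setUv.
- by apply/disj_setPCl.
rewrite [X in (_ + X)%E]null_set_integral ?adde0//=; last 3 first.
- exact: measurableC.
- exact: measurable_funTS.
- by rewrite /= /mrestr setICl measure0.
by apply: eq_measure_integral => A mA AD; rewrite /= /mrestr setIidl.
Qed.

(** Conditioning on a sub-sigma-algebra freezes the variables it contains: on a
    rectangle this is the assumed factorization, and product measures are
    determined by rectangles. The event D makes room for variables that have
    the prescribed law only on a part of the space, such as the path after a
    passage time, which need not be finite. *)
Lemma freezing (P : probability T R) (G : set (set T)) (D : set T) d'
    (S : measurableType d') (U : T -> S) (nu : probability S R) (h : T -> S -> \bar R) :
  sigma_algebra setT G -> G `<=` measurable -> G D -> measurable_fun setT U ->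
  (forall A B, G A -> A `<=` D -> measurable B -> P (A `&` U @^-1` B) = (P A * nu B)%E) ->
  measurable_fun [set: g_sigma_algebraType G * S] (fun p => h p.1 p.2) ->
  (forall w y, (0 <= h w y)%E) ->
  (\int[P]_(w in D) h w (U w) = \int[P]_(w in D) \int[nu]_y h w y)%E.
Proof.
move=> sG Gm GD mU indep mh h0.
have mE := measurable_g_measurableTypeE sG.
have mD := Gm _ GD.
pose TG := g_sigma_algebraType G.
have mid : @measurable_fun _ _ T TG setT idfun.
  by move=> _ B; rewrite mE setTI; exact: Gm.
pose J w : TG * S := (w, U w).
have mJ : measurable_fun setT J by exact: measurable_fun_pair.
have [m1 m1E] := finite_pushforward (mrestr P mD) mid.
pose m2 := measure_function_pushforward__canonical__measure_function_Measure (mrestr P mD) mJ.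
have m12 C : measurable C -> (m1 \x nu)%E C = m2 C.
  apply: product_measure_unique => A B mA mB.
  have GA : G A by rewrite -mE.
  transitivity (m1 A * nu B)%E; last by [].
  have -> : m1 A = P (A `&` D) by exact: m1E.
  rewrite /m2 /= /pushforward /mrestr.
  rewrite (_ : _ `&` D = (A `&` D) `&` U @^-1` B); last first.
    by apply/seteqP; split=> w /=; tauto.
  by rewrite indep//; exact: sigma_algebra_setI.
pose H (p : TG * S) := h p.1 p.2.
have H0 p : (0 <= H p)%E by exact: h0.
have E : (\int[m2]_p H p = \int[m1 \x nu]_p H p)%E.
  by apply: eq_measure_integral => C mC _; exact/esym/m12.
have mF : @measurable_fun _ _ TG _ setT (fun w => \int[nu]_y h w y)%E.
  exact: (measurable_fun_fubini_tonelli_F (m2 := nu) H).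
have F0 w : (0 <= \int[nu]_y h w y)%E by exact: integral_ge0.
transitivity (\int[mrestr P mD]_w H (J w))%E.
  by rewrite ge0_integral_mrestr//; exact: (measurableT_comp mh mJ).
transitivity (\int[mrestr P mD]_w \int[nu]_y h w y)%E; last first.
  by rewrite ge0_integral_mrestr//; exact: (measurableT_comp mF mid).
transitivity (\int[m2]_p H p)%E; first by rewrite ge0_integral_pushforward.
rewrite E fubini_tonelli1//.
rewrite -[RHS](ge0_integral_pushforward mid (mrestr P mD) (D := setT) (f := fubini_F nu H))//; last first.
  by move=> y _; exact: F0.
by apply: eq_measure_integral => A mA _; exact: m1E.
Qed.

End sub_sigma_algebras.

Lemma bounded_convergence d (T : measurableType d) (R : realType) (P : probability T R)
    (D : set T) (f_ : nat -> T -> R) (f : T -> R) (K : R) : measurable D ->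
  (forall n, measurable_fun setT (f_ n)) -> measurable_fun setT f ->
  {ae P, forall w, f_ n w @[n --> \oo] --> f w} ->
  {ae P, forall w, forall n, `|f_ n w| <= K} ->
  (\int[P]_(w in D) (f_ n w)%:E @[n --> \oo] --> \int[P]_(w in D) (f w)%:E)%E.
Proof.
move=> mD mf_ mf f_f fK.
have [] := @dominated_convergence _ _ _ P D mD
   (fun n w => (f_ n w)%:E) (fun w => (f w)%:E) (cst K%:E).
- by move=> n; apply/measurable_EFinP; exact: measurable_funTS.
- by apply/measurable_EFinP; exact: measurable_funTS.
- by apply: filterS f_f => w fw _; apply: cvg_EFin => //; near=> n.
- exact: finite_measure_integrable_cst.
- by apply: filterS fK => w fw n _; rewrite lee_fin.
by [].
Unshelve. all: by end_near. Qed.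

Lemma ge0_integral_setID d (T : measurableType d) (R : realType) (P : probability T R)
    (A D : set T) (f : T -> R) : measurable A -> measurable D -> measurable_fun setT f ->
  (forall w, 0 <= f w) ->
  (\int[P]_(w in A) (f w)%:E =
   \int[P]_(w in A `&` D) (f w)%:E + \int[P]_(w in A `&` ~` D) (f w)%:E)%E.
Proof.
move=> mA mD mf f0; rewrite -[in LHS](setIT A) -(setUv D) setIUr ge0_integral_setU//.
- exact: measurableI.
- by apply: measurableI => //; exact: measurableC.
- by apply/measurable_EFinP; exact: measurable_funTS.
- by move=> w _; rewrite lee_fin.
- by apply/disj_setPS => w /= [[_ Dw] [_]].
Qed.

Lemma integral_itv01 d (T : measurableType d) (R : realType) (P : probability T R)
    (f : T -> R) : measurable_fun setT f -> (forall w, 0 <= f w <= 1) ->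
  exists2 r, 0 <= r <= 1 & (\int[P]_w (f w)%:E = r%:E)%E.
Proof.
move=> mf f01; have f0 w : (0 <= (f w)%:E)%E by rewrite lee_fin; case/andP: (f01 w).
have I0 : (0 <= \int[P]_w (f w)%:E)%E by exact: integral_ge0.
have I1 : (\int[P]_w (f w)%:E <= 1)%E.
  apply: (@le_trans _ _ (\int[P]_w (cst 1%E w))%E); last first.
    by rewrite integral_cst//= probability_setT mul1e.
  apply: ge0_le_integral => //; first exact/measurable_EFinP.
  by move=> w _; rewrite lee_fin; case/andP: (f01 w).
have E : (fine (\int[P]_w (f w)%:E))%:E = (\int[P]_w (f w)%:E)%E.
  by rewrite fineK// ge0_fin_numE// (le_lt_trans I1) ?ltry.
by exists (fine (\int[P]_w (f w)%:E)); rewrite -?lee_fin ?E ?I0.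
Qed.

Lemma bounded_integrable d (T : measurableType d) (R : realType) (P : probability T R)
    (M : T -> R) (K : R) : measurable_fun setT M ->
  {ae P, forall w, `|M w| <= K} -> P.-integrable setT (EFin \o M).
Proof.
move=> mM MK; apply/integrableP; split; first exact/measurable_EFinP.
apply: (@le_lt_trans _ _ (\int[P]_w (cst `|K|%:E w))%E); last first.
  by rewrite integral_cst//= probability_setT mule1 ltry.
apply: ae_ge0_le_integral => //.
- by apply: measurableT_comp => //; exact/measurable_EFinP.
- by move=> w _; rewrite lee_fin.
- by apply: filterS MK => w MKw _; rewrite lee_fin (le_trans MKw)// ler_norm.
Qed.

(** The events over which both integrals agree form a Dynkin system. *)
Lemma eq_integral_generated d (T : measurableType d) (R : realType) (P : probability T R)
    (C : set (set T)) (f g : T -> R) (K : R) : setI_closed C -> C setT -> C `<=` measurable ->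
  measurable_fun setT f -> measurable_fun setT g -> (forall w, 0 <= f w) -> (forall w, 0 <= g w) ->
  {ae P, forall w, f w <= K} -> {ae P, forall w, g w <= K} ->
  (forall A, C A -> \int[P]_(w in A) (f w)%:E = \int[P]_(w in A) (g w)%:E)%E ->
  forall A, <<s C >> A -> (\int[P]_(w in A) (f w)%:E = \int[P]_(w in A) (g w)%:E)%E.
Proof.
move=> CI CT Cm mf mg f0 g0 fK gK fg.
have Csm : <<s C >> `<=` measurable.
  by apply: smallest_sub => //; exact: sigma_algebra_measurable.
have fin (h : T -> R) (D : set T) : measurable_fun setT h -> (forall w, 0 <= h w) ->
    {ae P, forall w, h w <= K} -> measurable D -> (\int[P]_(w in D) (h w)%:E)%E \is a fin_num.
  move=> mh h0 hK mD; rewrite ge0_fin_numE; last by apply: integral_ge0 => w _; rewrite lee_fin.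
  apply: (@le_lt_trans _ _ (\int[P]_(w in D) (cst `|K|%:E w))%E).
    apply: ae_ge0_le_integral => //.
    - by move=> w _; rewrite lee_fin.
    - by apply/measurable_EFinP; exact: measurable_funTS.
    - by move=> w _; rewrite lee_fin.
    - by apply: filterS hK => w hw _; rewrite lee_fin (le_trans hw)// ler_norm.
  rewrite integral_cst// lte_mul_pinfty// ?lee_fin//.
  by apply: le_lt_trans (probability_le1 P mD) _; rewrite ltry.
have mE : @measurable _ (g_sigma_algebraType C) = <<s C >> by [].
apply: (dynkin_induction mE CI) => //.
- exact: fg.
- move=> A /Csm mA fgA.
  have := fg _ CT; rewrite !(ge0_integral_setID P measurableT mA)// !setTI fgA.
  move/(congr1 (fun x => x - \int[P]_(w in A) (g w)%:E)%E).
  by rewrite !(addeC (\int[P]_(w in A) (g w)%:E)%E) !addeK// fin.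
- move=> A mA tA fgA.
  rewrite !ge0_integral_bigcup//; first by apply: eq_eseriesr => n _; exact: fgA.
  + by move=> n; exact: Csm (mA n).
  + by apply/measurable_EFinP; exact: measurable_funTS.
  + by move=> w _; rewrite lee_fin.
  + by move=> n; exact: Csm (mA n).
  + by apply/measurable_EFinP; exact: measurable_funTS.
  + by move=> w _; rewrite lee_fin.
Qed.

Section sampling.
Context d (T : measurableType d) (R : realType) (P : probability T R).
Variables (F : R -> set (set T)) (g : R -> T -> R) (k : T -> R) (K : R).
Hypothesis filF : filtration F.
Hypotheses (mg : forall t, 0 <= t -> measurable_fun setT (g t))
  (rg : forall w, rcont (g^~ w)) (g0 : forall t w, 0 <= t -> 0 <= g t w)
  (gK : {ae P, forall w, forall t, 0 <= t -> `|g t w| <= K}).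
Hypotheses (mk : measurable_fun setT k) (k0 : forall w, 0 <= k w).
Hypothesis gk : forall t, 0 <= t -> forall A, F t A ->
  (\int[P]_(w in A) (g t w)%:E = \int[P]_(w in A) (k w)%:E)%E.

(** Approximating the random time from above by grid times turns the claim into
    a sum of instances of the hypothesis; right-continuity and boundedness take
    care of the limit. The grid times are strictly above tau, so that they are
    controlled by the events before t; this covers first passage times above a
    level, which are only optional times. *)
Lemma sampling (tau : T -> \bar R) (A : set T) :
  (forall w, (0 <= tau w)%E) -> measurable_fun setT tau ->
  (forall t, 0 < t -> F t [set w | (tau w < t%:E)%E]) ->
  measurable A -> (forall t, 0 < t -> F t (A `&` [set w | (tau w < t%:E)%E])) ->
  A `<=` [set w | (tau w < +oo)%E] ->
  (\int[P]_(w in A) (g (fine (tau w)) w)%:E = \int[P]_(w in A) (k w)%:E)%E.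
Proof.
move=> tau0 mtau Ftau mA FA Afin; have [sF Fm monF] := filF.
pose r w := fine (tau w).
have r0 w : 0 <= r w by exact: fine_ge0.
have mr : measurable_fun setT r by exact: measurableT_comp.
have gn n : (\int[P]_(w in A) (g (grid_above n (r w)) w)%:E = \int[P]_(w in A) (k w)%:E)%E.
  (* On B i the grid time above tau is t i, and B i is known at t i. *)
  pose t i : R := i.+1%:R / n.+1%:R.
  have t0 i : 0 < t i by rewrite divr_gt0.
  pose B i := A `&` [set w | Num.truncn (n.+1%:R * r w) = i].
  have FB i : F (t i) (B i).
    have -> : B i = (A `&` [set w | (tau w < (t i)%:E)%E]) `\`
        [set w | (tau w < (i%:R / n.+1%:R)%:E)%E].
      apply/seteqP; split=> w /=.
        move=> [Aw /= /eqP]; rewrite truncn_eq ?mulr_ge0// => /andP[h1 h2].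
        have tE : tau w = (r w)%:E by rewrite /r fineK// ge0_fin_numE//; exact: Afin.
        rewrite tE !lte_fin; split; first by rewrite ltr_pdivlMr// mulrC.
        by apply/negP; rewrite -leNgt ler_pdivrMr// mulrC.
      move=> [[Aw h2] h1]; split => //=; apply/eqP; move: h1 h2.
      have tE : tau w = (r w)%:E by rewrite /r fineK// ge0_fin_numE//; exact: Afin.
      rewrite tE !lte_fin => /negP; rewrite -leNgt truncn_eq ?mulr_ge0//.
      by rewrite ler_pdivrMr// ltr_pdivlMr// mulrC => -> ->.
    apply: sigma_algebra_setD; [exact/sF/ltW|exact: FA|].
    case: i => [|i].
      rewrite mul0r (_ : [set _ | _] = set0); last first.
        by apply/seteqP; split=> w //=; rewrite ltNge tau0.
      rewrite -setCT; apply: sigma_algebra_setC; first exact/sF/ltW.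
      by apply: sigma_algebra_setT; exact/sF/ltW.
    have i0 : 0 < i.+1%:R / n.+1%:R :> R by rewrite divr_gt0.
    apply: (monF _ _ (ltW i0)); last exact: Ftau.
    by rewrite ler_pM2r ?invr_gt0// ler_nat.
  have mB i : measurable (B i) by apply: (Fm (t i)) => //; exact: ltW.
  have tB : trivIset setT B.
    apply/trivIsetP => i j _ _ /eqP ij; apply/seteqP; split=> w //=.
    by move=> [[_ /= wi] [_ /= wj]]; apply: ij; rewrite -wi -wj.
  have AB : A = \bigcup_i B i.
    by apply/seteqP; split=> [w Aw|w [i _ []]//]; exists (Num.truncn (n.+1%:R * r w)).
  rewrite AB !ge0_integral_bigcup//; last 4 first.
  - by apply/measurable_EFinP; exact: measurable_funTS.
  - by move=> w _; rewrite lee_fin.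
  - apply/measurable_EFinP; apply: measurable_funTS.
    exact: measurable_grid_above.
  - by move=> w _; rewrite lee_fin g0// divr_ge0.
  apply: eq_eseriesr => i _; rewrite -(gk (ltW (t0 i)) (FB i)).
  by apply: eq_integral => w; rewrite inE => -[_ /= wi]; rewrite /grid_above wi.
have cvgk : ((\int[P]_(w in A) (g (grid_above n (r w)) w)%:E) @[n --> \oo] -->
    \int[P]_(w in A) (g (r w) w)%:E)%E.
  apply: (bounded_convergence (K := K) mA) => [n|||].
  - exact: measurable_grid_above.
  - exact: measurable_eval.
  - by apply: aeW => w; exact: (@grid_above_cvg _ (g^~ w)).
  - by apply: filterS gK => w gw n; rewrite gw// divr_ge0.
apply: (cvg_unique (@ereal_hausdorff R) cvgk).
rewrite /= (_ : (fun n => _) = cst (\int[P]_(w in A) (k w)%:E)%E); last exact/funext.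
exact: cvg_cst.
Qed.

End sampling.

(** * Stopping times *)

Section stopping_times.
Context d (T : measurableType d) (R : realType).
Variable F : R -> set (set T).
Hypothesis hF : filtration F.
Implicit Types (tau sigma : T -> \bar R) (A : set T).
Let sF t : 0 <= t -> sigma_algebra setT (F t). Proof. by case: hF => + _ _; apply. Qed.
Let Fm t : 0 <= t -> F t `<=` measurable. Proof. by case: hF => _ + _; apply. Qed.
Let Fmon s t : 0 <= s -> s <= t -> F s `<=` F t.
Proof. by case: hF => _ _; apply. Qed.

Lemma sigma_algebra_infty : sigma_algebra setT (sigma_infty F).
Proof. exact: smallest_sigma_algebra. Qed.

Lemma sub_sigma_infty t : 0 <= t -> F t `<=` sigma_infty F.
Proof. by move=> t0 A FA; apply: sub_sigma_algebra; exists t. Qed.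

Lemma sigma_infty_measurable : sigma_infty F `<=` measurable.
Proof.
apply: smallest_sub; first exact: sigma_algebra_measurable.
by move=> A [t /= t0]; exact: Fm.
Qed.

(** Before time t the minimum of t and sigma is observed as sigma itself; at time t
    nothing remains to be known. *)
Lemma optional_min_measurable sigma t : 0 <= t -> (forall w, (0 <= sigma w)%E) ->
  (forall u, 0 < u -> F u [set w | (sigma w < u%:E)%E]) ->
  measurable_wrt (F t) (fun w => Order.min t%:E (sigma w)).
Proof.
move=> t0 s0 Fs; apply: (@measurable_ge0_lt _ (g_sigma_algebraType (F t))).
  by move=> w; rewrite le_min lee_fin t0 s0.
move=> u u0; rewrite (measurable_g_measurableTypeE (sF t0)).
have [tu|ut] := ltP t u.
  rewrite (_ : [set _ | _] = setT); first by apply: sigma_algebra_setT; exact: sF.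
  by apply/seteqP; split=> w //= _; rewrite gt_min lte_fin tu.
apply: (Fmon (ltW u0) ut).
rewrite [X in F u X](_ : _ = [set w | (sigma w < u%:E)%E]); first exact: Fs.
by apply/seteqP; split=> w /=; rewrite gt_min lte_fin (ltNge t u) ut.
Qed.

Lemma optional_measurable_infty sigma : (forall w, (0 <= sigma w)%E) ->
  (forall u, 0 < u -> F u [set w | (sigma w < u%:E)%E]) ->
  measurable_wrt (sigma_infty F) sigma.
Proof.
move=> s0 Fs; apply: (@measurable_ge0_lt _ (g_sigma_algebraType (sigma_infty F))) => // u u0.
rewrite (measurable_g_measurableTypeE sigma_algebra_infty).
by apply: (sub_sigma_infty (ltW u0)); exact: Fs.
Qed.

Section stopped_events.
Variable tau : T -> \bar R.
Hypotheses (tau0 : forall w, (0 <= tau w)%E)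
  (Ftau : forall t, 0 <= t -> F t [set w | (tau w <= t%:E)%E])
  (Ftau' : forall t, 0 < t -> F t [set w | (tau w < t%:E)%E]).

Lemma sigma_algebra_stopped : sigma_algebra setT (stopped_sigma F tau).
Proof.
split.
- split; first by have [] := sigma_algebra_infty.
  by move=> t t0; rewrite set0I; have [] := sF t0.
- move=> A [iA FA]; split=> [|t t0]; first by have [_ + _] := sigma_algebra_infty; exact.
  rewrite (_ : _ `&` _ = [set w | (tau w <= t%:E)%E] `\` (A `&` [set w | (tau w <= t%:E)%E])).
    by apply: sigma_algebra_setD; [exact: sF|exact: Ftau|exact: FA].
  by apply/seteqP; split=> w /=; tauto.
- move=> A FA; split=> [|t t0].
    by have [_ _] := sigma_algebra_infty; apply => n; have [] := FA n.
  rewrite setI_bigcupl; have [_ _] := sF t0; apply=> n.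
  by have [_] := FA n; exact.
Qed.

Lemma stopped_sigma_measurable : stopped_sigma F tau `<=` measurable.
Proof. by move=> A [/sigma_infty_measurable]. Qed.

Lemma stopped_sigma_lt A t : stopped_sigma F tau A -> 0 < t ->
  F t (A `&` [set w | (tau w < t%:E)%E]).
Proof.
move=> [_ FA] t0; rewrite (_ : _ `&` _ = (A `&` [set w | (tau w <= t%:E)%E]) `&`
    [set w | (tau w < t%:E)%E]).
  by apply: sigma_algebra_setI; [exact/sF/ltW|exact/FA/ltW|exact: Ftau'].
by apply/seteqP; split=> w /=; [move=> [? h]; do !split=> //; exact: ltW|tauto].
Qed.

Lemma le_stopped_sigma sigma : (forall w, (sigma w <= tau w)%E) ->
  stopped_sigma F sigma `<=` stopped_sigma F tau.
Proof.
move=> st A [iA FA]; split=> // t t0.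
rewrite (_ : _ `&` _ = (A `&` [set w | (sigma w <= t%:E)%E]) `&` [set w | (tau w <= t%:E)%E]).
  by apply: sigma_algebra_setI; [exact: sF|exact: FA|exact: Ftau].
apply/seteqP; split=> w /=; last by tauto.
by move=> [Aw wt]; do !split=> //; exact: le_trans (st w) wt.
Qed.

Lemma stopped_sigma_fin : stopped_sigma F tau [set w | (tau w < +oo)%E].
Proof.
have mtau := optional_measurable_infty tau0 Ftau'.
split.
  rewrite -(measurable_g_measurableTypeE sigma_algebra_infty) -[X in _ X]setTI.
  by apply: emeasurable_fun_infty_o.
move=> t t0; rewrite (_ : _ `&` _ = [set w | (tau w <= t%:E)%E]); first exact: Ftau.
by apply/seteqP; split=> w /=; [case|move=> wt; split=> //; exact: le_lt_trans wt (ltry t)].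
Qed.

(** On the event that tau is at most t, comparing sigma with tau amounts to
    comparing their minima with t, both of which are known at t. *)
Lemma stopped_sigma_passed sigma : (forall w, (0 <= sigma w)%E) ->
  (forall u, 0 < u -> F u [set w | (sigma w < u%:E)%E]) ->
  stopped_sigma F tau [set w | (sigma w < tau w)%E].
Proof.
move=> s0 Fs; split.
  rewrite -(measurable_g_measurableTypeE sigma_algebra_infty) -[X in _ X]setTI.
  by apply: measurable_lte => //; exact: optional_measurable_infty.
move=> t t0; rewrite (_ : _ `&` _ =
    [set w | (Order.min t%:E (sigma w) < Order.min t%:E (tau w))%E] `&`
    [set w | (tau w <= t%:E)%E]).
  apply: sigma_algebra_setI; [exact: sF| |exact: Ftau].
  rewrite -(measurable_g_measurableTypeE (sF t0)) -[X in _ X]setTI.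
  by apply: measurable_lte => //; exact: optional_min_measurable.
apply/seteqP; split=> w /= [h wt]; split=> //.
  by rewrite [X in (_ < X)%E]min_r// gt_min h orbT.
move: h; rewrite [X in (_ < X)%E]min_r// gt_min => /orP[tw|//].
by have := lt_le_trans tw wt; rewrite ltxx.
Qed.

(** Membership in the stopped sigma-algebra is tested on the events that tau is at
    most t, on which N may be replaced by N_ t. *)
Lemma stopped_sigma_fun d' (S : measurableType d') (N : T -> S) (N_ : R -> T -> S) :
  measurable_wrt (sigma_infty F) N ->
  (forall t, 0 <= t -> measurable_wrt (F t) (N_ t)) ->
  (forall t w, 0 <= t -> (tau w <= t%:E)%E -> N w = N_ t w) ->
  measurable_wrt (stopped_sigma F tau) N.
Proof.
move=> mN mN_ NE; apply/sub_measurable_funP; first exact: sigma_algebra_stopped.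
move=> B mB; split.
  by move/(sub_measurable_funP _ sigma_algebra_infty) : mN; exact.
move=> t t0; rewrite (_ : _ `&` _ = N_ t @^-1` B `&` [set w | (tau w <= t%:E)%E]).
  apply: sigma_algebra_setI; [exact: sF| |exact: Ftau].
  by move/(sub_measurable_funP _ (sF t0)) : (mN_ _ t0); exact.
by apply/seteqP; split=> w /= [h wt]; split=> //; move: h; rewrite (NE t).
Qed.

End stopped_events.

End stopping_times.

(** * Killing at an exponential time *)

Section exponential_time.
Context d (T : measurableType d) (R : realType).
Variables (P : R -> probability T R) (q : R) (e : T -> \bar R).
Hypotheses (he : exponential_time P q e) (q_ge0 : 0 <= q).

Lemma exponential_time_measurable : measurable_fun setT e.
Proof. by case: he. Qed.

Lemma exponential_time_gt_measurable t : measurable [set w | (t < e w)%E].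
Proof.
rewrite -[X in measurable X]setTI; apply: emeasurable_fun_o_infty => //.
exact: exponential_time_measurable.
Qed.

Lemma exponential_prob_itvNyc (r t : R) : 0 <= r -> 0 <= t ->
  exponential_prob r `]-oo, t] = (1 - (expR (- r * t))%:E)%E.
Proof.
move=> r0 t0; transitivity (exponential_prob r `[0, t]).
  rewrite /exponential_prob.
  transitivity (\int[lebesgue_measure]_(y in `]-oo, t])
      ((EFin \o exponential_pdf r) \_ `[0%R, +oo[) y)%E.
    apply: eq_integral => y _; rewrite /exponential_pdf !patchE /=.
    by case: ifP => // yn; rewrite /patch yn.
  rewrite -integral_mkcondr; congr (integral _ _ _).
  apply/seteqP; split=> y /=; rewrite !in_itv/= ?andbT; first by move=> [-> ->].
  by move=> /andP[-> ->].
move: t0; rewrite le_eqVlt => /predU1P[<-|t0]; last exact: exponential_prob_itv0c.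
rewrite mulr0 expR0 subee// /exponential_prob set_itv1 integral_set1//.
Qed.

Lemma exponential_time_finite x : 0 < q -> {ae P x, forall w, (e w < +oo)%E}.
Proof.
move=> q0; have [_ e1] := he.2 x; pose N := e @^-1` (EFin @` setT).
have mN : measurable N.
  rewrite -[X in measurable X]setTI; apply: exponential_time_measurable => //.
  by apply: measurable_image_EFin; exact: measurableT.
exists (~` N); split; first exact: measurableC.
  have -> : P x (~` N) = (1 - P x N)%E by exact: probability_setC.
  by rewrite e1// /exponential_prob integral_exponential_pdf// subee.
by move=> w /= ew [y _ ye]; apply: ew; rewrite -ye ltry.
Qed.

(** For q > 0 the law is given on the real line only; its total mass one leaves no
    mass for infinite values. *)
Lemma exponential_tail x t : 0 <= t -> P x [set w | (t%:E < e w)%E] = (expR (- q * t))%:E.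
Proof.
move=> t0; have mgt := exponential_time_gt_measurable t%:E.
have [e0 e1] := he.2 x; move: q_ge0; rewrite le_eqVlt => /predU1P[q0|q0].
  rewrite -q0 oppr0 mul0r expR0.
  have [N [mN N0 sN]] := e0 (esym q0).
  apply/eqP; rewrite eq_le probability_le1//=.
  apply: (@le_trans _ _ (P x (~` N))); first by rewrite probability_setC// N0 sube0.
  apply: le_measure; rewrite ?inE//; first exact: measurableC.
  move=> w Nw /=; suff -> : e w = +oo%E by rewrite ltry.
  by apply: contrapT => ew; apply: Nw; exact: sN.
have me B : measurable B -> measurable (e @^-1` (EFin @` B)).
  move=> mB; rewrite -[X in measurable X]setTI; apply: exponential_time_measurable => //.
  exact: measurable_image_EFin.
pose N := e @^-1` (EFin @` setT).
have mN : measurable N by exact: me.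
have PN : P x N = 1%E.
  by rewrite e1//; exact: integral_exponential_pdf.
have mB : measurable (e @^-1` (EFin @` `]-oo, t])) by exact: me.
have -> : P x [set w | (t%:E < e w)%E] = P x (N `\` e @^-1` (EFin @` `]-oo, t])).
  apply/eqP; rewrite eq_le; apply/andP; split.
    apply: (@le_trans _ _ (P x ((N `\` e @^-1` (EFin @` `]-oo, t])) `|` ~` N))).
      apply: le_measure; rewrite ?inE//; first by apply: measurableU; [exact: measurableD|exact: measurableC].
      move=> w /= tw; have [Nw|] := pselect (N w); last by right.
      left; split=> //= -[y]; rewrite /= in_itv/= => yt ye.
      by move: tw; rewrite -ye lte_fin ltNge yt.
    apply: (@le_trans _ _ (P x (N `\` e @^-1` (EFin @` `]-oo, t])) + P x (~` N))%E).
      by apply: measureU2; [exact: measurableD|exact: measurableC].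
    have -> : P x (~` N) = 0%E by rewrite probability_setC// PN subee.
    by rewrite adde0.
  apply: le_measure; rewrite ?inE//; first exact: measurableD.
  move=> w /= [[y _ ye] nw]; rewrite -ye lte_fin ltNge; apply/negP => yt.
  by apply: nw; exists y.
rewrite measureD//= ?PN ?ltry// setIidr; last by move=> w [y _ ye]; exists y.
rewrite e1// exponential_prob_itvNyc//.
by rewrite -!EFinB; congr EFin; ring.
Qed.

Lemma exponential_tail_integral x (S : \bar R) (v : R) : (0 <= S)%E -> 0 <= v ->
  (\int[P x]_w (if (S < e w)%E then v else 0)%:E =
   (if (S < +oo)%E then v * expR (- q * fine S) else 0)%:E)%E.
Proof.
move=> S0 v0; have mgt := exponential_time_gt_measurable S.
transitivity (\int[P x]_(w in [set w | (S < e w)%E]) v%:E)%E.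
  rewrite [RHS]integral_mkcond; apply: eq_integral => w _; rewrite /patch.
  by case: ifPn => Sw; [rewrite mem_set|rewrite memNset//=; exact/negP].
rewrite integral_cst//; case: S S0 mgt => [s||]//= s0 mgt; last first.
  rewrite (_ : [set _ | _] = set0) ?measure0 ?mule0//.
  by apply/seteqP; split=> w //=; rewrite ltNge leey.
by rewrite ltry exponential_tail.
Qed.

(** Given G, the time e exceeds S with probability exp(- q S). *)
Lemma exponential_freezing x (G : set (set T)) A (S : T -> \bar R) (V : T -> R) :
  sigma_algebra setT G -> G `<=` measurable -> independent (P x) (sigma_rv e) G -> G A ->
  measurable_wrt G S -> (forall w, (0 <= S w)%E) ->
  measurable_wrt G V -> (forall w, 0 <= V w) ->
  (\int[P x]_(w in A) (if (S w < e w)%E then V w else 0)%:E =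
   \int[P x]_(w in A) (if (S w < +oo)%E then V w * expR (- q * fine (S w)) else 0)%:E)%E.
Proof.
move=> sG Gm ind GA mS S0 mV V0.
pose E : {mfun T >-> \bar R} := mfun_Sub (mem_set exponential_time_measurable).
pose h w y := (if (S w < y)%E then V w else 0)%:E.
rewrite (@freezing _ _ _ (P x) G A _ _ e (distribution (P x) E) h)//; last 4 first.
- exact: exponential_time_measurable.
- move=> B C GB _ mC; rewrite setIC ind//; last by exists C => //; rewrite setTI.
  by rewrite muleC.
- apply/measurable_EFinP; apply: measurable_fun_ifT => //.
  + apply: measurable_fun_lte => //; exact: (measurableT_comp mS).
  + exact: (measurableT_comp mV).
- by move=> w y; rewrite /h lee_fin; case: ifP.
apply: eq_integral => w _.
rewrite (ge0_integral_distribution E (f := h w))//; last first.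
- by move=> y; rewrite /h lee_fin; case: ifP.
- apply/measurable_EFinP; apply: measurable_fun_ifT => //.
  exact: measurable_fun_lte.
exact: exponential_tail_integral.
Qed.

End exponential_time.

(** * Discounts and the space of cadlag paths *)

Section discount.
Variables (R : realType) (om : R -> R) (q : R).
Hypotheses (om_meas : measurable_fun setT om) (om_ge0 : forall y, 0 <= om y).
Hypotheses (om_loc : locally_bounded om) (q_ge0 : 0 <= q).
Implicit Types (f : R -> R) (c s t : R).

(** Killing at the exponential time will turn out to be discounting at rate q; a
    passage that does not occur contributes nothing. *)
Definition discount c f : R :=
  if (hit c f < +oo)%E then
    expR (- clock om f (fine (hit c f)) - q * fine (hit c f))
  else 0.

Lemma discount_ge0 c f : 0 <= discount c f.
Proof. by rewrite /discount; case: ifP => // _; exact: expR_ge0. Qed.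

Lemma discount_le1 c f : discount c f <= 1.
Proof.
rewrite /discount; case: ifP => // _; rewrite -expR0 ler_expR.
have := clock_ge0 om_ge0 f (fine (hit c f)).
have : 0 <= q * fine (hit c f) by rewrite mulr_ge0// fine_ge0// hit_ge0.
by lra.
Qed.

Lemma discount_gt0 c f : (hit c f < +oo)%E -> 0 < discount c f.
Proof. by rewrite /discount => ->; exact: expR_gt0. Qed.

Lemma discount_fin c f t : hit c f = t%:E ->
  discount c f = expR (- clock om f t - q * t).
Proof. by rewrite /discount => ->; rewrite ltry. Qed.

Lemma discount0 c f : rcont f -> c < f 0 -> discount c f = 1.
Proof.
move=> rf cf; rewrite (@discount_fin _ _ 0) ?hit_eq0//.
by rewrite clock0 oppr0 mulr0 subr0 expR0.
Qed.

Lemma discount_shift c f t : cadlag f -> 0 <= t -> (t%:E <= hit c f)%E ->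
  discount c f = expR (- clock om f t - q * t) * discount c (fun u => f (t + u)).
Proof.
move=> cf t0 th; have hE := hit_shift cf.1 t0 th.
have [hoo|] := boolP (hit c (fun u => f (t + u)%R) < +oo)%E; last first.
  rewrite ltey negbK => /eqP h.
  by rewrite {2}/discount h mulr0 /discount hE h addeC.
move: hE; rewrite {1}(hit_finE hoo) -EFinD => hE.
rewrite (discount_fin hE) (discount_fin (hit_finE hoo)).
rewrite clock_add ?fine_ge0 ?hit_ge0// -expRD; congr expR; ring.
Qed.

Lemma eq_discount c (f g : R -> R) : (forall u, 0 <= u -> f u = g u) -> discount c f = discount c g.
Proof.
move=> fg; rewrite /discount (eq_hit c fg); case: ifP => // _.
rewrite (_ : clock om f _ = clock om g (fine (hit c g)))//.
by apply: eq_clock => u /andP[u0 _]; exact: fg.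
Qed.

Lemma discount_stop c f t : (hit c f < t%:E)%E ->
  discount c (fun u => f (Num.min u t)) = discount c f.
Proof.
move=> ht; have hoo : (hit c f < +oo)%E by exact: lt_trans (ltry t).
have hE : hit c (fun u => f (Num.min u t)) = hit c f.
  have t0 : 0 <= t by rewrite -lee_fin (le_trans (hit_ge0 c f))// ltW.
  have := hit_stop c f t0; rewrite !min_r//; first exact: ltW.
  by apply: ltW; apply/hit_stop_lt.
rewrite /discount hE hoo.
rewrite (_ : clock om (fun u => f (Num.min u t)) _ = clock om f (fine (hit c f)))//.
apply: eq_clock => u /andP[_ uh].
rewrite min_l// (le_trans uh)//; move: ht; rewrite {1}(hit_finE hoo) lte_fin; exact: ltW.
Qed.

Lemma measurable_discount c d (T : measurableType d) (V : R -> T -> R) :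
  (forall t, 0 <= t -> measurable_fun setT (V t)) -> (forall w, cadlag (V^~ w)) ->
  measurable_fun setT (fun w => discount c (V^~ w)).
Proof.
move=> mV cV; have rV w := (cV w).1.
have mh := measurable_hit c mV rV.
have mr : measurable_fun setT (fun w => fine (hit c (V^~ w))) by exact: measurableT_comp.
apply: measurable_fun_ifT; last exact: measurable_cst.
  by apply: measurable_fun_lte => //; exact: measurable_cst.
apply: measurableT_comp => //; apply: measurable_funB.
  apply: measurableT_comp => //.
  apply: (@measurable_eval _ _ _ (fun t w => clock om (V^~ w) t)) => //.
  - by move=> t _; exact: measurable_clock.
  - by move=> w; exact: clock_rcont.
  - by move=> w; rewrite fine_ge0// hit_ge0.
by apply: measurable_funM => //; exact: measurable_cst.
Qed.

End discount.

Section path_space.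
Variable R : realType.

(** The law of the process is carried by a space of cadlag paths, on which passage
    times and additive functionals are measurable. *)
Definition cadlag_path := {f : R -> R | cadlag f}.

HB.instance Definition _ := gen_eqMixin cadlag_path.
HB.instance Definition _ := gen_choiceMixin cadlag_path.
HB.instance Definition _ := isPointed.Build cadlag_path (exist _ _ (cadlag_cst 0)).

Definition coord (t : R) (f : cadlag_path) : R := sval f t.

Definition cylinder (l : seq (R * R)) : set cadlag_path :=
  [set f | all (fun p => coord p.1 f < p.2) l].

Definition cylinders : set (set cadlag_path) :=
  [set cylinder l | l in [set l | all (fun p => 0 <= p.1) l]].

Local Notation paths := (g_sigma_algebraType cylinders).

Lemma coord_cadlag (f : paths) : cadlag (coord^~ f).
Proof. by case: f. Qed.

Lemma measurable_cylinder l : all (fun p => 0 <= p.1) l ->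
  measurable (cylinder l : set paths).
Proof. by move=> l0; apply: sub_sigma_algebra; exists l. Qed.

Lemma measurable_coord t : 0 <= t -> measurable_fun [set: paths] (coord t).
Proof.
move=> t0; apply: (measurability (@RGenInftyO.G R)).
  exact: RGenInftyO.measurableE.
move=> _ [_ [a ->] <-]; rewrite setTI.
rewrite (_ : _ @^-1` _ = cylinder [:: (t, a)]); first by apply: measurable_cylinder; rewrite /= t0.
by apply/seteqP; split=> f; rewrite /cylinder/= in_itv/= andbT.
Qed.

Lemma measurable_to_paths d (T : measurableType d) (U : T -> paths) :
  (forall t, 0 <= t -> measurable_fun setT (fun w => coord t (U w))) ->
  measurable_fun setT U.
Proof.
move=> mU; apply: (@measurability _ _ T paths setT U cylinders) => // _ [_ [l l0 <-] <-]; rewrite setTI.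
elim: l l0 => [_|[t a] l IH /= /andP[t0 /IH ml]].
  rewrite (_ : _ @^-1` _ = setT)//; exact/seteqP.
rewrite (_ : _ @^-1` _ = (fun w => coord t (U w)) @^-1` `]-oo, a[ `&` U @^-1` cylinder l).
  by apply: measurableI => //; rewrite -[_ @^-1` _]setTI; exact: mU.
apply/seteqP; split=> w; rewrite /cylinder/= in_itv/=; first by case/andP.
by case=> -> ->.
Qed.

Lemma cylinders_setI : setI_closed cylinders.
Proof.
move=> _ _ [l l0 <-] [l' l'0 <-]; exists (l ++ l'); first by rewrite /= all_cat; apply/andP.
by apply/seteqP; split=> f; rewrite /cylinder/= all_cat; [move/andP|move=> h; apply/andP].
Qed.

Lemma paths_measure_unique (m1 m2 : {measure set paths -> \bar R}) :
  (m1 setT < +oo)%E ->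
  (forall l, all (fun p => 0 <= p.1) l -> m1 (cylinder l) = m2 (cylinder l)) ->
  forall C, measurable C -> m1 C = m2 C.
Proof.
move=> m1oo m12 C mC; apply: (@measure_unique _ R paths cylinders (fun=> setT)) => //.
- exact: cylinders_setI.
- by move=> _; exists [::] => //; apply/seteqP; split.
- by rewrite bigcup_const.
- by move=> _ [l l0 <-]; exact: m12.
Qed.

End path_space.

Arguments coord {R} t f.

(** * Inverting the clock of a path *)

Section additive_functional.
Context d (T : measurableType d) (R : realType).
Variables (om : R -> R) (X : R -> T -> R) (w : T).
Hypotheses (om_meas : measurable_fun setT om) (om_ge0 : forall y, 0 <= om y).
Hypotheses (om_loc : locally_bounded om) (cX : cadlag (X^~ w)).

Lemma additive_functional_clock t :
  additive_functional X om t%:E w = (clock om (X^~ w) t)%:E.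
Proof.
rewrite EFin_clock// /additive_functional; congr (integral _ _ _).
by apply/seteqP; split=> u /=; rewrite in_itv/= lee_fin => /andP.
Qed.

Lemma additive_functional_neg t : (t < 0)%E -> additive_functional X om t w = 0%E.
Proof.
move=> t0; rewrite /additive_functional (_ : [set _ | _] = set0) ?integral_set0//.
apply/seteqP; split=> u //= [u0 ut]; have := le_lt_trans ut t0.
by rewrite lte_fin ltNge u0.
Qed.

(** The functional is also needed at an infinite time, where it need not be finite:
    it is then the limit of its values at integer times. *)
Lemma additive_functional_pinfty :
  (clock om (X^~ w) n%:R)%:E @[n --> \oo] --> additive_functional X om +oo%E w.
Proof.
pose D n := [set u : R | 0 <= u /\ (u%:E <= (n%:R : R)%:E)%E].
have DE n : D n = `[0, n%:R]%classic.
  by apply/seteqP; split=> u; rewrite /D /= in_itv/= lee_fin => /andP.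
have -> : (fun n => (clock om (X^~ w) n%:R)%:E) =
    (fun n => \int[lebesgue_measure]_(u in D n) (om (X u w))%:E)%E.
  by apply/funext => n; rewrite -additive_functional_clock.
rewrite /additive_functional.
have -> : [set u : R | 0 <= u /\ (u%:E <= +oo)%E] = \bigcup_n D n.
  apply/seteqP; split=> u /=; last by move=> [n _ [u0 _]]; split; rewrite ?leey.
  move=> [u0 _]; exists (Num.truncn u).+1 => //; split=> //.
  by rewrite lee_fin ltW// truncnS_gt.
apply: ge0_nondecreasing_set_cvg_integral => //.
- move=> m n mn; apply/subsetPset => u [u0 um]; split=> //; apply: le_trans um _.
  by rewrite lee_fin ler_nat.
- by move=> n; rewrite DE.
- move=> n; apply: (eq_measurable_fun (fun u : R => (om (X (Num.max 0 u) w))%:E)).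
    by move=> u /set_mem[u0 _]; rewrite max_r.
  by apply: measurable_funTS; exact: (measurable_om_path om_meas cX.1).
- by move=> n u _; rewrite lee_fin.
Qed.

End additive_functional.

Section time_change.
Context d (T : measurableType d) (R : realType).
Variables (om : R -> R) (X : R -> T -> R) (w : T).
Hypotheses (om_meas : measurable_fun setT om) (om_gt0 : forall y, 0 < om y).
Hypotheses (om_loc : locally_bounded om) (cX : cadlag (X^~ w)).
Let om_ge0 y : 0 <= om y. Proof. exact: ltW. Qed.
Local Notation A := (clock om (X^~ w)).
Local Notation rho s := (time_change X om s w).

Lemma time_changeE s : rho s = ereal_inf [set t%:E | t in [set t | 0 <= t /\ s < A t]].
Proof.
congr ereal_inf; apply/seteqP; split=> _ [t [t0 st] <-]; exists t => //; split=> //;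
  by move: st; rewrite additive_functional_clock// lte_fin.
Qed.

Lemma time_change_ge0 s : (0 <= rho s)%E.
Proof. by apply: le_ereal_inf_tmp => _ [t [t0 _] <-]; rewrite lee_fin. Qed.

Lemma clock_near_left t s : 0 < t -> s < A t -> exists2 u, 0 <= u < t & s < A u.
Proof.
move=> t0 st; have [d' d'0 H] := clock_continuous om_meas om_ge0 om_loc cX (ltW t0)
  (e := A t - s) ltac:(lra).
exists (Num.max 0 (t - d' / 2)).
  by rewrite /Num.max; case: ifPn; lra.
have := H (Num.max 0 (t - d' / 2)).
rewrite !ltr_distl /Num.max; case: ifPn => ? ; lra.
Qed.

(** The inverse clock passes t when the clock passes s: as the clock is continuous,
    this holds for both the strict and the weak inequality. *)
Lemma time_change_lt s t : 0 <= s -> 0 <= t -> (rho s < t%:E)%E = (s < A t).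
Proof.
move=> s0 t0; apply/idP/idP; rewrite time_changeE.
  move=> /ereal_inf_lt[_ [u [u0 su] <-]]; rewrite lte_fin => ut.
  by apply: lt_le_trans su _; apply: clock_le => //; rewrite u0 ltW.
move: t0; rewrite le_eqVlt => /predU1P[<-|t0]; first by rewrite clock0 ltNge s0.
move=> st; have [u /andP[u0 ut] su] := clock_near_left t0 st.
apply: (@le_lt_trans _ _ u%:E); last by rewrite lte_fin.
by apply: ereal_inf_lbound; exists u.
Qed.

Lemma time_change_le s t : 0 <= s -> 0 <= t -> (rho s <= t%:E)%E = (s <= A t).
Proof.
move=> s0 t0; apply/idP/idP => [rt|st].
  rewrite leNgt; apply/negP => ts.
  have [d' d'0 H] := clock_continuous om_meas om_ge0 om_loc cX t0 (e := s - A t) ltac:(lra).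
  have : (rho s < (t + d' / 2)%:E)%E.
    by apply: le_lt_trans rt _; rewrite lte_fin; lra.
  rewrite time_change_lt//; last by lra.
  have := H (t + d' / 2); rewrite !ltr_distl; lra.
apply/lee_addgt0Pr => e e0; rewrite -EFinD; apply: ltW.
rewrite time_change_lt//; last by lra.
by apply: le_lt_trans st _; apply: clock_lt => //; lra.
Qed.

Lemma clock_time_change s r : 0 <= s -> rho s = r%:E -> A r = s.
Proof.
move=> s0 rs; have r0 : 0 <= r by rewrite -lee_fin -rs time_change_ge0.
apply/eqP; rewrite eq_le -time_change_le// rs lexx andbT leNgt -time_change_lt// rs.
by rewrite lte_fin ltxx.
Qed.

Lemma time_change_clock t : 0 <= t -> rho (A t) = t%:E.
Proof.
move=> t0; have A0 := clock_ge0 om_ge0 (X^~ w) t.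
apply/eqP; rewrite eq_le time_change_le// lexx/= leNgt time_change_lt//.
by rewrite ltxx.
Qed.

Lemma le_time_change s t : s <= t -> (rho s <= rho t)%E.
Proof.
move=> st; rewrite !time_changeE; apply: le_ereal_inf_tmp => _ [u [u0 tu] <-].
by apply: ereal_inf_lbound; exists u => //; split=> //; exact: le_lt_trans tu.
Qed.

Lemma time_change_pinfty s : 0 <= s ->
  (rho s < +oo)%E = (s%:E < additive_functional X om +oo%E w)%E.
Proof.
move=> s0; have cA := additive_functional_pinfty om_meas om_ge0 om_loc cX.
apply/idP/idP => [roo|].
  have rE : rho s = (fine (rho s))%:E by rewrite fineK// ge0_fin_numE// time_change_ge0.
  set r := fine (rho s) in rE; have r0 : 0 <= r by rewrite -lee_fin -rE time_change_ge0.
  rewrite -(clock_time_change s0 rE).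
  apply: (@lt_le_trans _ _ (A (Num.truncn r).+1%:R)%:E).
    by rewrite lte_fin; apply: clock_lt => //; exact: truncnS_gt.
  rewrite -(cvg_lim _ cA)//; apply: lime_ge; first exact: cvgP cA.
  near=> n; rewrite lee_fin; apply: clock_le => //; rewrite ler0n ler_nat/=.
  by near: n; exact: nbhs_infty_ge.
rewrite !ltNge; apply: contra; rewrite leye_eq => /eqP roo.
rewrite -(cvg_lim _ cA)//; apply: lime_le; first exact: cvgP cA.
apply: nearW => n; rewrite lee_fin leNgt -time_change_lt// roo -leNgt.
exact: leey.
Unshelve. all: by end_near. Qed.

(** The lifetime is the clock time of e, so that both sides compare s with the
    clock at e, including when e is infinite or negative. *)
Lemma lt_lifetime (e : T -> \bar R) s : 0 <= s ->
  (s%:E < lifetime X e om w)%E = (rho s < e w)%E.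
Proof.
move=> s0; rewrite /lifetime; have r0 := time_change_ge0 s.
case: (e w) => [t||]; last 2 first.
- by rewrite time_change_pinfty.
- rewrite additive_functional_neg ?ltNy0// lte_fin ltNge s0.
  by apply/esym/negbTE; rewrite -leNgt leNye.
have [t0|t0] := leP 0 t.
  by rewrite additive_functional_clock// lte_fin time_change_lt.
rewrite additive_functional_neg ?lte_fin//.
rewrite ltNge s0; apply/esym/negbTE; rewrite -leNgt (le_trans _ r0)//.
by rewrite lee_fin ltW.
Qed.

Lemma YprocE (e : T -> \bar R) s : 0 <= s ->
  Yproc X e om s w = if (rho s < e w)%E then Some (X (fine (rho s)) w) else None.
Proof. by move=> s0; rewrite /Yproc lt_lifetime. Qed.

(** The time-changed path exceeds c at the clock times of those instants before e at
    which the path exceeds c; the clock is continuous, so that it maps the infimum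
    of these instants to the infimum of their clock times. *)
Lemma Ypassage_timeE (e : T -> \bar R) c : Ypassage_time X e om c w =
  if (hit c (X^~ w) < e w)%E then (A (fine (hit c (X^~ w))))%:E else +oo%E.
Proof.
set tau := hit c _.
have E : Ypassage_time X e om c w =
    ereal_inf [set (A r)%:E | r in [set r | [/\ 0 < r, c < X r w & (r%:E < e w)%E]]].
  congr ereal_inf; apply/seteqP; split=> z /=.
    move=> [s [s0 [y Yy cy]] <-]; move: Yy; rewrite YprocE; last exact: ltW.
    case: ifPn => // re; case=> Xy; have roo : (rho s < +oo)%E by exact: lt_le_trans re (leey _).
    have rE : rho s = (fine (rho s))%:E by rewrite fineK// ge0_fin_numE// time_change_ge0.
    set r := fine (rho s) in rE Xy; have r0 : 0 <= r by rewrite -lee_fin -rE time_change_ge0.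
    have Ar := clock_time_change (ltW s0) rE.
    exists r; last by rewrite Ar.
    split; [|by rewrite Xy|by rewrite -rE].
    by rewrite lt_neqAle r0 andbT; apply/eqP => r0'; move: s0; rewrite -Ar -r0' clock0 ltxx.
  move=> [r [r0 cr re] <-]; exists (A r) => //; split; first exact: clock_gt0.
  exists (X r w) => //; rewrite YprocE ?clock_ge0// time_change_clock ?ltW// re.
  by [].
rewrite E; case: ifPn => [te|]; last first.
  rewrite -leNgt => et; rewrite (_ : [set r | [/\ 0 < r, c < X r w & (r%:E < e w)%E]] = set0) ?image_set0 ?ereal_inf0//.
  apply/seteqP; split=> r //= [r0 cr re].
  have : (tau <= r%:E)%E by apply: ereal_inf_lbound; exists r.
  by rewrite leNgt (lt_le_trans re).
have tau0 : (0 <= tau)%E := hit_ge0 c (X^~ w).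
have tE : tau = (fine tau)%:E by rewrite fineK// ge0_fin_numE//; exact: lt_le_trans te (leey _).
have t0 : 0 <= fine tau by exact: fine_ge0.
apply: eq_lt_ereal.
- by apply: le_ereal_inf_tmp => _ [r _ <-]; rewrite lee_fin clock_ge0.
- by rewrite lee_fin clock_ge0.
move=> t _; split=> [/ereal_inf_lt[_ [r [r0 cr re] <-]]|].
  apply: le_lt_trans; rewrite lee_fin; apply: clock_le => //; rewrite t0/= -lee_fin -tE.
  by apply: ereal_inf_lbound; exists r.
rewrite lte_fin => At.
have [d' d'0 H] := clock_continuous om_meas om_ge0 om_loc cX t0 (e := t - A (fine tau)) ltac:(lra).
have : (tau < Order.min (e w) (fine tau + d')%:E)%E.
  by rewrite lt_min te tE lte_fin; lra.
rewrite {1}/tau /hit => /ereal_inf_lt[_ [r [r0 cr] <-]]; rewrite lt_min => /andP[re].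
rewrite lte_fin => rd.
have tr : fine tau <= r by rewrite -lee_fin -tE; apply: ereal_inf_lbound; exists r.
apply: (@le_lt_trans _ _ (A r)%:E); first by apply: ereal_inf_lbound; exists r.
rewrite lte_fin; have := H r (ltW r0).
rewrite !ltr_distl; lra.
Qed.

(** Composition with the inverse clock, which is continuous and increasing until
    it reaches infinity at a finite or infinite time, preserves cadlag paths; at
    a finite explosion time a left limit is due to a limit at infinity. *)
Lemma cadlag_time_change (f : R -> R) (l : R) : cadlag f -> cvg (f t @[t --> +oo]) ->
  cadlag (fun s => if (rho s < +oo)%E then f (fine (rho s)) else l).
Proof.
have rfin s : (rho s < +oo)%E -> rho s = (fine (rho s))%:E.
  by move=> roo; rewrite fineK// ge0_fin_numE// time_change_ge0.
have r0 s : 0 <= fine (rho s) by rewrite fine_ge0// time_change_ge0.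
move=> cf foo; split=> s s0.
  have [roo|roo] := boolP (rho s < +oo)%E; last first.
    apply: cvg_near_cst; near=> u; rewrite ifF//; apply/negbTE; apply: contra roo.
    by apply: le_lt_trans; apply: le_time_change; near: u; exact: nbhs_right_ge.
  have rE := rfin _ roo; set r := fine (rho s) in rE *.
  apply/cvgrPdist_lt => ep ep0.
  have [d' d'0 H] := rcontP cf.1 (r0 s) ep0.
  have Ar := clock_time_change s0 rE.
  near=> u.
  have su : s <= u by near: u; exact: nbhs_right_ge.
  have ur : (rho u < (r + d')%:E)%E.
    rewrite time_change_lt; [|exact: le_trans su|by rewrite addr_ge0 ?r0 ?ltW].
    near: u; apply: nbhs_right_lt; rewrite -Ar; apply: clock_lt => //; first exact: r0.
    by rewrite ltrDl.
  have uoo : (rho u < +oo)%E by exact: lt_le_trans ur (leey _).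
  rewrite uoo; apply: H.
  have := le_time_change su; rewrite rE (rfin _ uoo) lee_fin => ->/=.
  by rewrite -lte_fin -rfin.
have [roo|roo] := boolP (rho s < +oo)%E.
  have rE := rfin _ roo; set r := fine (rho s) in rE *.
  have Ar := clock_time_change (ltW s0) rE.
  have rp : 0 < r.
    rewrite lt_neqAle r0 andbT; apply/eqP => r0'; move: s0.
    by rewrite -Ar -r0' clock0 ltxx.
  have /cvg_ex[m fm] := cf.2 r rp.
  apply/cvg_ex; exists m; apply/cvgrPdist_lt => ep ep0.
  move/cvgrPdist_lt : fm => /(_ _ ep0) [d' /= d'0 H].
  near=> u.
  have u0 : 0 <= u by near: u; exact: nbhs_left_ge.
  have us : u < s by near: u; exact: nbhs_left_lt.
  have ur : (rho u < r%:E)%E by rewrite time_change_lt ?ltW// Ar.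
  have uoo : (rho u < +oo)%E by exact: lt_le_trans ur (leey _).
  rewrite uoo.
  have ur' : fine (rho u) < r by rewrite -lte_fin -rfin.
  apply: H => //=; rewrite ger0_norm ?subr_ge0 ?ltW// ltrBlDr -ltrBlDl.
  have : ((Num.max 0 (r - d'))%:E < rho u)%E.
    rewrite ltNge time_change_le ?le_max ?lexx// -ltNge.
    near: u; apply: nbhs_left_gt; rewrite -Ar; apply: clock_lt => //.
      by rewrite le_max lexx.
    by rewrite gt_max rp/= ltrBlDr ltrDl.
  by rewrite (rfin _ uoo) lte_fin gt_max => /andP[].
(* Either the inverse clock is infinite already before s, or it explodes at s. *)
have [[u0 [u00 u0s uoo]]|noex] := pselect (exists u0, [/\ 0 <= u0, u0 < s & ~~ (rho u0 < +oo)%E]).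
  apply/cvg_ex; exists l; apply: cvg_near_cst; near=> u; rewrite ifF//.
  apply/negbTE; apply: contra uoo; apply: le_lt_trans; apply: le_time_change.
  by near: u; exact: nbhs_left_ge.
have /cvg_ex[m fm] := foo.
apply/cvg_ex; exists m; apply/cvgrPdist_lt => ep ep0.
move/cvgrPdist_lt : fm => /(_ _ ep0) [M [_ H]].
have M0 : 0 <= Num.max 0 M by rewrite le_max lexx.
near=> u.
have u0 : 0 <= u by near: u; exact: nbhs_left_ge.
have us : u < s by near: u; exact: nbhs_left_lt.
have uoo : (rho u < +oo)%E by apply: contrapT => /negP un; apply: noex; exists u; split.
rewrite uoo; apply: H.
have : ((Num.max 0 M)%:E < rho u)%E.
  rewrite ltNge time_change_le// -ltNge; near: u; apply: nbhs_left_gt.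
  apply: (@lt_le_trans _ _ (A (Num.max 0 M + 1))).
    by apply: clock_lt => //; rewrite ltrDl.
  rewrite leNgt -time_change_lt; [|exact: ltW|by rewrite addr_ge0].
  apply: contra roo => h; exact: lt_le_trans h (leey _).
by rewrite (rfin _ uoo) lte_fin gt_max => /andP[].
Unshelve. all: by end_near. Qed.

Section killed_path.
Variables (e : T -> \bar R) (c : R) (g : R -> R).
Local Notation tau := (hit c (X^~ w)).

(** The stopped time-changed process, read in the original time scale, in which the
    inverse clock may be infinite. *)
Definition killed_path (t : \bar R) : R :=
  if (Order.min t tau < e w)%E then g (fine (Order.min t tau)) else 0.

Lemma killed_path_cadlag : cadlag g -> cadlag (fun t : R => killed_path t%:E).
Proof.
move=> cg; have t0 := hit_ge0 c (X^~ w); have [te|et] := boolP (tau < e w)%E.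
  have tE : tau = (fine tau)%:E.
    by rewrite fineK// ge0_fin_numE//; exact: lt_le_trans te (leey _).
  rewrite (_ : (fun _ => _) = (fun t => g (Num.min t (fine tau)))).
    by apply: cadlag_stop => //; rewrite fine_ge0.
  apply/funext => t; rewrite /killed_path gt_min te orbT; congr g.
  by rewrite tE -EFin_min.
have -> : (fun t : R => killed_path t%:E) = (fun t => if (t%:E < e w)%E then g t else 0).
  apply/funext => t; rewrite /killed_path gt_min (negbTE et) orbF.
  case: ifP => // te; rewrite min_l// ltW//; apply: lt_le_trans te _.
  by rewrite leNgt.
split=> t t0'.
  have [te|te] := boolP (t%:E < e w)%E; last first.
    apply: cvg_near_cst; near=> u; rewrite ifF//; apply/negbTE.
    apply: contra te; apply: le_lt_trans; rewrite lee_fin; near: u.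
    exact: nbhs_right_ge.
  have te' : \forall u \near t^'+, (u%:E < e w)%E.
    move: te; case: (e w) => [r||] te; last by rewrite ltNge leNye in te.
      by near=> u; rewrite lte_fin; near: u; apply: nbhs_right_lt; rewrite -lte_fin.
    by near=> u; rewrite ltry.
  apply: cvg_trans (cg.1 t t0'); apply: near_eq_cvg; near=> u; rewrite ifT//.
  by near: u.
have [te|te] := boolP (t%:E <= e w)%E; last first.
  have te' : \forall u \near t^'-, (e w <= u%:E)%E.
    move: te; rewrite -ltNge; case: (e w) => [r||] // te; last by near=> u; rewrite leNye.
    by near=> u; rewrite lee_fin; near: u; apply: nbhs_left_ge; rewrite -lte_fin.
  apply/cvg_ex; exists 0; apply: cvg_near_cst; near=> u; rewrite ifF//; apply/negbTE.
  by rewrite -leNgt; near: u.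
have /cvg_ex[l gl] := cg.2 t t0'.
apply/cvg_ex; exists l; apply: cvg_trans gl; apply: near_eq_cvg; near=> u; rewrite ifT//.
apply: lt_le_trans te; rewrite lte_fin; near: u; exact: nbhs_left_lt.
Unshelve. all: by end_near. Qed.

Lemma killed_path_cvg : (e w < +oo)%E \/ (tau < +oo)%E \/ cvg (g t @[t --> +oo]) ->
  cvg (killed_path t%:E @[t --> +oo]).
Proof.
have t0 := hit_ge0 c (X^~ w).
have [too|too] := boolP (tau < +oo)%E.
  have tE := hit_finE too.
  move=> _; apply/cvg_ex; exists (killed_path tau); apply: cvg_near_cst; near=> t.
  rewrite /killed_path minxx (_ : Order.min t%:E tau = tau)//.
  rewrite min_r// tE lee_fin; near: t; exists (fine tau); split; first exact: num_real.
  by move=> ? /ltW.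
have {}too : tau = +oo%E by apply/eqP; rewrite -leye_eq leNgt.
have kE t : killed_path t%:E = if (t%:E < e w)%E then g t else 0.
  by rewrite /killed_path too miney.
move=> H; have [eoo|eoo] := boolP (e w < +oo)%E.
  move: eoo; case E : (e w) => [r||]// _; apply/cvg_ex; exists 0; apply: cvg_near_cst;
    near=> t; rewrite kE E ?ltNge ?leNye// ifF//; apply/negbTE; rewrite negbK.
  rewrite lee_fin; near: t; exists r; split; first exact: num_real.
  by move=> ? /ltW.
case: H => [h|[//|H]]; first by rewrite h in eoo.
rewrite (_ : (fun _ => _) = g)//; apply/funext => t; rewrite kE ifT//.
apply: lt_le_trans (ltry _) _; by rewrite leNgt.
Unshelve. all: by end_near. Qed.

Lemma killed_path_time_change_cadlag : cadlag g ->
  (e w < +oo)%E \/ (tau < +oo)%E \/ cvg (g t @[t --> +oo]) ->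
  cadlag (fun s => killed_path (rho s)).
Proof.
move=> cg H; have := @cadlag_time_change (fun t => killed_path t%:E) (killed_path +oo%E)
  (killed_path_cadlag cg) (killed_path_cvg H).
congr cadlag; apply/funext => s; have := time_change_ge0 s.
by case: (rho s) => [r||]//=; rewrite ltry.
Qed.

End killed_path.

(** Stopping and killing may be carried out before the time change, because the
    inverse clock takes the clock time of the passage to the passage time. *)
Lemma stopped_time_change (e : T -> \bar R) c (gam : R) (H : R -> R) s : 0 <= s ->
  stopped (fun s w => if Yproc X e om s w is Some y then expR (- gam * s) * H y else 0)
    (Ypassage_time X e om c) s w =
  killed_path e c (fun t => expR (- gam * A t) * H (X t w)) (rho s).
Proof.
move=> s0; rewrite /stopped Ypassage_timeE /killed_path; set tau := hit c _.
have tau0 : (0 <= tau)%E := hit_ge0 c (X^~ w).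
have [te|et] := boolP (tau < e w)%E.
  have tE : tau = (fine tau)%:E by rewrite fineK// ge0_fin_numE//; exact: lt_le_trans te (leey _).
  have t0 : 0 <= fine tau by exact: fine_ge0.
  have At0 := clock_ge0 om_ge0 (X^~ w) (fine tau).
  rewrite gt_min te orbT -EFin_min /= YprocE; last by rewrite le_min s0.
  have rE : rho (Num.min s (A (fine tau))) = Order.min (rho s) tau.
    have [sA|As] := leP s (A (fine tau)).
      by rewrite min_l// tE time_change_le.
    by rewrite time_change_clock// -tE min_r// tE -time_change_clock//; apply: le_time_change; exact: ltW.
  rewrite rE gt_min te orbT; congr (expR (_ * _) * _).
  have mE : Order.min (rho s) tau = (fine (Order.min (rho s) tau))%:E.
    rewrite fineK// ge0_fin_numE ?le_min ?time_change_ge0// gt_min.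
    by rewrite (lt_le_trans te (leey _)) orbT.
  by apply/esym; apply: clock_time_change; [rewrite le_min s0|rewrite rE].
rewrite miney /= YprocE// gt_min (negbTE et) orbF; case: ifPn => // re.
have rt : (rho s <= tau)%E by apply: le_trans (ltW re) _; rewrite leNgt.
rewrite min_l//; congr (expR (_ * _) * _); apply/esym/clock_time_change => //.
by rewrite fineK// ge0_fin_numE ?time_change_ge0//; exact: lt_le_trans re (leey _).
Qed.

End time_change.

(** * The Markov and strong Markov properties *)

(** Evaluated along the paths after time t, the indicator of a cylinder need not be
    right-continuous in t. It is therefore approximated by the continuous
    functions soft_below n, built from approximations soft_pos n of the indicator
    of the positive half-line. *)
Section soft_indicator.
Variable R : realType.
Implicit Types (f : R -> R) (l : seq (R * R)).

Definition soft_pos (n : nat) (y : R) : R := 1 - expR (- (`|y| + y)) ^+ n.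

Fixpoint soft_below (n : nat) l f : R :=
  if l is p :: l' then soft_pos n (p.2 - f p.1) * soft_below n l' f else 1.

Lemma expRN_itv (y : R) : 0 <= expR (- (`|y| + y)) <= 1.
Proof.
rewrite expR_ge0 -expR0 ler_expR oppr_le0 -lerBlDr sub0r.
by rewrite -normrN ler_norm.
Qed.

Lemma soft_pos_itv n y : 0 <= soft_pos n y <= 1.
Proof.
have /andP[h0 h1] := expRN_itv y; rewrite /soft_pos subr_ge0 exprn_ile1//.
by rewrite gerBl exprn_ge0.
Qed.

Lemma soft_below_itv n l f : 0 <= soft_below n l f <= 1.
Proof.
elim: l => [|p l /andP[h0 h1]] /=; first by rewrite ler01 lexx.
have /andP[s0 s1] := soft_pos_itv n (p.2 - f p.1).
by rewrite mulr_ge0//= mulr_ile1.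
Qed.

Lemma cvg_soft_pos (y : R) : soft_pos n y @[n --> \oo] --> ((0 < y)%R%:R : R).
Proof.
have [y0|y0] := ltP 0 y.
  rewrite -[X in _ --> X]subr0; apply: cvgB; first exact: cvg_cst.
  apply: cvg_expr; rewrite ger0_norm ?expR_ge0// -expR0 ltr_expR oppr_lt0.
  by rewrite ltr_wpDl.
rewrite (_ : soft_pos ^~ y = cst 0); first exact: cvg_cst.
apply/funext => n; rewrite /soft_pos ler0_norm// addNr oppr0 expR0 expr1n.
by rewrite subrr.
Qed.

Lemma cvg_soft_below l f :
  soft_below n l f @[n --> \oo] --> ((all (fun p => f p.1 < p.2)%R l)%:R : R).
Proof.
elim: l => [|p l IH] /=; first exact: cvg_cst.
rewrite (_ : (_ && _)%:R = (0 < p.2 - f p.1)%R%:R *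
    (all (fun p => f p.1 < p.2)%R l)%:R :> R); last first.
  by rewrite subr_gt0; case: (_ < _); rewrite ?mul1r ?mul0r.
by apply: cvgM => //; exact: cvg_soft_pos.
Qed.

Lemma soft_pos_cvg (T : Type) (G : set_system T) (FG : Filter G) n (h : T -> R) (y : R) :
  h x @[x --> G] --> y -> soft_pos n (h x) @[x --> G] --> soft_pos n y.
Proof.
move=> hy; apply: cvgB; first exact: cvg_cst.
have hE : expR (- (`|h x| + h x)) @[x --> G] --> expR (- (`|y| + y)).
  apply: (@cvg_comp _ _ _ (fun x => - (`|h x| + h x)) expR G (nbhs (- (`|y| + y))));
    last exact: continuous_expR.
  by apply: cvgN; apply: cvgD => //; exact: cvg_norm.
elim: n => [|n IH]; first by under eq_fun do rewrite expr0; exact: cvg_cst.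
by rewrite exprS; under eq_fun do rewrite exprS; exact: cvgM.
Qed.

Lemma soft_below_cvg (T : Type) (G : set_system T) (FG : Filter G) n l
    (h : T -> R -> R) f : (forall p, p \in l -> h x p.1 @[x --> G] --> f p.1) ->
  soft_below n l (h x) @[x --> G] --> soft_below n l f.
Proof.
elim: l => [|p l IH] hf /=; first exact: cvg_cst.
apply: cvgM; last by apply: IH => p' p'l; apply: hf; rewrite inE p'l orbT.
by apply: soft_pos_cvg; apply: cvgB; [exact: cvg_cst|apply: hf; rewrite inE eqxx].
Qed.

Lemma measurable_soft_below d (T : measurableType d) n l (h : T -> R -> R) :
  (forall p, p \in l -> measurable_fun setT (fun w => h w p.1)) ->
  measurable_fun setT (fun w => soft_below n l (h w)).
Proof.
elim: l => [|p l IH] mh /=; first exact: measurable_cst.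
apply: measurable_funM; last by apply: IH => p' p'l; apply: mh; rewrite inE p'l orbT.
apply: (@measurableT_comp _ _ _ _ _ _ (soft_pos n)).
  by apply: continuous_measurable_fun => y; exact: soft_pos_cvg.
by apply: measurable_funB; [exact: measurable_cst|apply: mh; rewrite inE eqxx].
Qed.

End soft_indicator.

Section levy.
Context d (Omega : measurableType d) (R : realType).
Variables (P : R -> probability Omega R) (X : R -> Omega -> R).
Variable (F : R -> set (set Omega)).
Hypotheses (hX : spectrally_negative_levy P X) (hF : filtration F)
  (hFX : adapted F X) (hFinc : forall x, independent_increments (P x) F X).
Local Notation paths := (g_sigma_algebraType (@cylinders R)).

Let sF t : 0 <= t -> sigma_algebra setT (F t). Proof. by case: hF => + _ _; apply. Qed.
Let Fm t : 0 <= t -> F t `<=` measurable. Proof. by case: hF => _ + _; apply. Qed.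
Let Fmon s t : 0 <= s -> s <= t -> F s `<=` F t.
Proof. by case: hF => _ _; apply. Qed.

Lemma levy_measurable t : 0 <= t -> measurable_fun setT (X t).
Proof. by case: hX => -[mX _] _ _ _ _; exact: mX. Qed.

Lemma levy_cadlag w : cadlag (X^~ w).
Proof. by case: hX => -[_ cX] _ _ _ _; exact: cX. Qed.

Lemma levy_adapted s t : 0 <= s -> s <= t ->
  measurable_wrt (F t) (X s).
Proof.
move=> s0 st; apply/sub_measurable_funP; first exact/sF/(le_trans s0).
move=> B mB; apply: (Fmon s0 st); apply: hFX => //.
by exists B => //; rewrite setTI.
Qed.

Lemma stopped_path_adapted u t : 0 <= u -> 0 <= t ->
  measurable_wrt (F t) (X (Num.min u t)).
Proof.
by move=> u0 t0; apply: levy_adapted; rewrite ?le_min ?u0// ge_min lexx orbT.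
Qed.

Lemma stopped_path_cadlag t w : 0 <= t -> cadlag (fun u => X (Num.min u t) w).
Proof. exact: (@cadlag_stop _ (X^~ w)) (levy_cadlag w). Qed.

Lemma path_event_coord_diff s t (B : set R) : 0 <= s -> 0 <= t -> measurable B ->
  path_events [set f : R -> R | B (f t - f s)].
Proof.
move=> s0 t0 mB.
pose G := \bigcup_(t in [set t : R | 0 <= t]) sigma_rv (fun f : R -> R => f t).
have mc u : 0 <= u ->
    measurable_wrt G (fun f : R -> R => f u).
  move=> u0 _ C mC; apply: sub_sigma_algebra; exists u => //.
  by exists C.
have := @measurable_funB _ (g_sigma_algebraType G) R setT _ _ (mc _ t0) (mc _ s0).
by move=> /(_ measurableT B mB); rewrite setTI.
Qed.

Lemma path_event_coord t (B : set R) : 0 <= t -> measurable B ->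
  path_events [set f : R -> R | B (f t)].
Proof.
move=> t0 mB; apply: sub_sigma_algebra; exists t => //; exists B => //.
by rewrite setTI.
Qed.

Lemma levy_start x : {ae P x, forall w, X 0 w = x}.
Proof.
have [_ _ [N [mN N0 sN]] _ law] := hX.
have mX0 y : measurable [set w | X 0 w = y].
  rewrite (_ : [set _ | _] = X 0 @^-1` [set y])//.
  by rewrite -[_ @^-1` _]setTI; exact: levy_measurable.
exists (~` [set w | X 0 w = x]); split=> //; first exact: measurableC.
rewrite probability_setC// (_ : P x _ = 1%E) ?subee//.
have := law x [set f | f 0 = x] (@path_event_coord _ [set x] (lexx _) (measurable_set1 x)).
rewrite /= => ->.
rewrite (_ : [set w | _] = [set w | X 0 w = 0]); last first.
  by apply/seteqP; split=> w /=; [move/eqP; rewrite -subr_eq0 addrAC subrr add0r => /eqP|move=> ->; rewrite addr0].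
apply/eqP; rewrite -[P 0 _]fineK ?fin_num_measure// eqe -subr_eq0 -oppr_eq0 opprB; apply/eqP.
apply: EFin_inj; rewrite EFinB fineK ?fin_num_measure// -probability_setC//.
by apply/eqP; rewrite -measure_le0 -N0; apply: le_measure; rewrite ?inE//; exact: measurableC.
Qed.

Definition levy_increment (t : R) : {mfun Omega >-> R} :=
  mfun_Sub (mem_set (measurable_funB
    (@levy_measurable (Num.max 0 t) ltac:(by rewrite le_max lexx))
    (@levy_measurable 0 (lexx 0)))).

Definition increment_law (t : R) : probability R R := distribution (P 0) (levy_increment t).

Lemma levy_increment_law x s t (B : set R) : 0 <= s -> s <= t -> measurable B ->
  P x [set w | B (X t w - X s w)] = increment_law (t - s) B.
Proof.
move=> s0 st mB; have [_ _ _ [_ stat] law] := hX.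
have t0 := le_trans s0 st.
have := law x [set f | B (f t - f s)] (path_event_coord_diff s0 t0 mB).
rewrite /= => ->.
rewrite (_ : [set w | _] = [set w | B (X t w - X s w)]); last first.
  by apply/funext => w /=; congr B; ring.
rewrite stat// /increment_law /distribution /pushforward /=.
by congr (P 0 _); apply/funext => w /=; rewrite max_r// subr_ge0.
Qed.

Lemma levy_indep_increment x s t A (B : set R) : 0 <= s -> s <= t -> F s A -> measurable B ->
  P x (A `&` (fun w => X t w - X s w) @^-1` B) = (P x A * increment_law (t - s) B)%E.
Proof.
move=> s0 st FA mB; rewrite setIC (@hFinc x s t)//; last by exists B => //; rewrite setTI.
by rewrite muleC -(levy_increment_law x s0 st mB).
Qed.

(** The probability that, over the times listed in l, a path at y at time t0 is
    below the listed levels, computed by integrating out one increment after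
    the other. *)
Fixpoint below_levels (t0 : R) (l : seq (R * R)) (y : R) : \bar R :=
  if l is (t, a) :: l' then
    (\int[increment_law (t - t0)]_z
       ((\1_(`]-oo, a[%classic : set R) (y + z))%:E * below_levels t l' (y + z)))%E
  else 1%E.

Lemma below_levels_ge0 t0 l y : (0 <= below_levels t0 l y)%E.
Proof.
elim: l t0 y => [|[t a] l IH] t0 y //=; apply: integral_ge0 => z _.
by rewrite mule_ge0// lee_fin.
Qed.

Lemma measurable_below_levels t0 l : measurable_fun setT (below_levels t0 l).
Proof.
elim: l t0 => [|[t a] l IH] t0 /=; first exact: measurable_cst.
pose h (p : R * R) := ((\1_(`]-oo, a[%classic : set R) (p.1 + p.2))%:E *
   below_levels t l (p.1 + p.2))%E.
have mD : measurable_fun setT (fun p : R * R => p.1 + p.2).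
  by apply: measurable_funD.
have mh : measurable_fun setT h.
  apply: emeasurable_funM; last exact: measurableT_comp.
  by apply/measurable_EFinP; apply: measurableT_comp mD; exact: measurable_indic.
apply: (measurable_fun_fubini_tonelli_F (m2 := increment_law (t - t0)) h mh) => p.
by rewrite /h mule_ge0 ?below_levels_ge0// lee_fin.
Qed.

(** By induction on the times: the next increment is independent of the past, so
    that freezing the present position integrates it out. *)
Lemma below_levels_integral x s t0 l (Y : Omega -> R) A :
  0 <= s -> 0 <= t0 -> path <=%R t0 (map fst l) ->
  measurable_wrt (F (s + t0)) Y -> F (s + t0) A ->
  P x (A `&` [set w | all (fun p => Y w + (X (s + p.1) w - X (s + t0) w) < p.2) l]) =
  (\int[P x]_(w in A) below_levels t0 l (Y w))%E.
Proof.
move=> s0; elim: l t0 Y A => [|[t a] l IH] t0 Y A t00 /=.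
  move=> _ _ FA; rewrite (_ : [set _ | _] = setT); last exact/seteqP.
  by rewrite setIT integral_cst ?mul1e//; apply: (Fm _ FA); exact: addr_ge0.
move=> /andP[t0t pl] mY FA; have t0' := le_trans t00 t0t.
have st00 : 0 <= s + t0 by exact: addr_ge0.
have st : s + t0 <= s + t by rewrite lerD2l.
have st' : 0 <= s + t by exact: addr_ge0.
pose D w := X (s + t) w - X (s + t0) w.
have mD : measurable_fun setT D by apply: measurable_funB; exact: levy_measurable.
pose Y' w := Y w + D w.
have mY0 := sub_measurable_fun (Fm st00) (sF st00) mY.
have mY' : measurable_wrt (F (s + t)) Y'.
  apply: measurable_funD; last by apply: measurable_funB; exact: levy_adapted.
  apply/(sub_measurable_funP _ (sF st')) => B mB; apply: (Fmon st00 st).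
  by move: B mB; apply/sub_measurable_funP; [exact: sF|exact: mY].
have FA' : F (s + t) (A `&` Y' @^-1` `]-oo, a[).
  apply: sigma_algebra_setI; [exact: sF|exact: (Fmon st00 st)|].
  by move/(sub_measurable_funP _ (sF st')): mY'; apply; exact: measurable_itv.
transitivity (P x ((A `&` Y' @^-1` `]-oo, a[) `&`
    [set w | all (fun p => Y' w + (X (s + p.1) w - X (s + t) w) < p.2) l])).
  congr (P x _); apply/seteqP; split=> w /=.
    move=> [Aw /andP[h1 h2]]; split; first by split=> //; rewrite in_itv.
    by apply: sub_all h2 => p; rewrite /Y' /D; congr (_ < _); ring.
  move=> [[Aw h1] h2]; split=> //; apply/andP; split; first by move: h1; rewrite in_itv.
  by apply: sub_all h2 => p; rewrite /Y' /D; congr (_ < _); ring.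
rewrite IH//.
rewrite integral_mkcondr.
pose h w z := ((\1_(`]-oo, a[%classic : set R) (Y w + z))%:E * below_levels t l (Y w + z))%E.
rewrite (eq_integral (fun w => h w (D w))); last first.
  move=> w _; rewrite /h /patch indicE.
  rewrite -[_ + _ \in _]/(w \in Y' @^-1` `]-oo, a[%classic).
  by case: ifPn => _; rewrite ?mul1e ?mul0e.
apply: (@freezing _ _ _ _ (F (s + t0)) A _ _ D (increment_law (t - t0)) h) => //.
- exact: sF.
- exact: Fm.
- move=> A0 B FA0 _ mB.
  by rewrite levy_indep_increment// (_ : s + t - (s + t0) = t - t0)//; ring.
- have mYD : measurable_fun [set: g_sigma_algebraType (F (s + t0)) * R]
      (fun p => Y p.1 + p.2).
    by apply: measurable_funD => //; exact: (measurableT_comp mY).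
  apply: emeasurable_funM; last exact: (measurableT_comp (measurable_below_levels _ _)).
  by apply/measurable_EFinP; apply: measurableT_comp mYD; exact: measurable_indic.
- by move=> w z; rewrite /h mule_ge0 ?below_levels_ge0// lee_fin.
Qed.

Lemma increment_cadlag s w : cadlag (fun u => X (Num.max 0 s + u) w - X (Num.max 0 s) w).
Proof.
have c := @cadlag_shift _ (X^~ w) (Num.max 0 s) (levy_cadlag w).
have := @cadlag_addl _ _ (- X (Num.max 0 s) w) (c _).
rewrite le_max lexx => /(_ erefl); congr cadlag; apply/funext => u; ring.
Qed.

(** For negative s the increments are taken from time zero, so that the path is
    cadlag in all cases. *)
Definition increment_path s w : paths := exist _ _ (increment_cadlag s w).

Lemma coord_increment_path s u w : 0 <= s ->
  coord u (increment_path s w) = X (s + u) w - X s w.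
Proof. by move=> s0; rewrite /coord/= max_r. Qed.

Lemma measurable_increment_path s : 0 <= s -> measurable_fun setT (increment_path s).
Proof.
move=> s0; apply: measurable_to_paths => t t0.
rewrite (_ : (fun w => _) = (fun w => X (s + t) w - X s w)); last first.
  by apply/funext => w; rewrite coord_increment_path.
by apply: measurable_funB; apply: levy_measurable => //; exact: addr_ge0.
Qed.

Definition origin_path : {mfun Omega >-> paths} :=
  mfun_Sub (mem_set (measurable_increment_path (lexx 0))).

(** As the process starts almost surely at zero under P 0, this is the law of its
    paths. *)
Definition levy_law : probability paths R := distribution (P 0) origin_path.

Lemma increment_path_cylinder x s A l : 0 <= s -> F s A -> all (fun p => 0 <= p.1) l ->
  P x (A `&` increment_path s @^-1` cylinder l) =
  (P x A * below_levels 0 (sort (fun p p' => p.1 <= p'.1)%R l) 0)%E.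
Proof.
move=> s0 FA l0.
have mA : measurable A by exact: Fm FA.
pose l' := sort (fun p p' => p.1 <= p'.1)%R l.
have pl : path <=%R 0 (map fst l').
  rewrite path_sortedE; last exact: le_trans.
  rewrite all_map (eq_all (a2 := fun p : R * R => 0 <= p.1))// all_sort l0/=.
  rewrite sorted_map; apply: sort_sorted => p p'; exact: le_total.
have := @below_levels_integral x s 0 l' (cst 0) A s0 (lexx _) pl.
rewrite addr0 => /(_ (measurable_cst _) FA).
rewrite (eq_integral (cst (below_levels 0 l' 0)))// integral_cst// muleC => <-.
congr (P x (_ `&` _)).
have E w : all (fun p => coord p.1 (increment_path s w) < p.2) l =
    all (fun p => 0 + (X (s + p.1) w - X s w) < p.2) l'.
  by rewrite all_sort; apply: eq_all => p; rewrite coord_increment_path// add0r.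
by apply/seteqP; split=> w h; [rewrite /= -E|move: h; rewrite /= -E].
Qed.

Lemma levy_law_cylinder l : all (fun p => 0 <= p.1) l ->
  levy_law (cylinder l) = below_levels 0 (sort (fun p p' => p.1 <= p'.1)%R l) 0.
Proof.
have FT : F 0 setT by apply: sigma_algebra_setT; exact: sF.
by move=> /(increment_path_cylinder 0 (lexx 0) FT); rewrite setTI probability_setT mul1e => <-.
Qed.

(** Cylinders are closed under intersection and generate the path events. *)
Lemma law_from_cylinders x (U : Omega -> paths) A : measurable A -> measurable_fun setT U ->
  (forall l, all (fun p => 0 <= p.1) l ->
    P x (A `&` U @^-1` cylinder l) = (P x A * levy_law (cylinder l))%E) ->
  forall C, measurable C -> P x (A `&` U @^-1` C) = (P x A * levy_law C)%E.
Proof.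
move=> mA mU H C mC.
pose m1 := measure_function_pushforward__canonical__measure_function_Measure (mrestr (P x) mA) mU.
pose m2 := [the measure _ _ of mscale (NngNum (fine_ge0 (measure_ge0 (P x) A))) levy_law].
have E : (fine (P x A))%:E = P x A by rewrite fineK// fin_num_measure.
rewrite setIC; transitivity (m1 C); first by [].
transitivity (m2 C); last by rewrite /m2/= /mscale/= E.
apply: paths_measure_unique mC.
  by rewrite /m1/= /pushforward /mrestr preimage_setT setTI ltey_eq fin_num_measure.
by move=> l l0; rewrite /m1/= /pushforward /mrestr setIC H// /mscale/= E.
Qed.

Lemma markov x s A C : 0 <= s -> F s A -> measurable C ->
  P x (A `&` increment_path s @^-1` C) = (P x A * levy_law C)%E.
Proof.
move=> s0 FA mC; apply: law_from_cylinders mC; first exact: Fm FA.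
  exact: measurable_increment_path.
by move=> l l0; rewrite increment_path_cylinder// levy_law_cylinder.
Qed.

Lemma measurable_optional_time (tau : Omega -> \bar R) : (forall w, (0 <= tau w)%E) ->
  (forall t, 0 < t -> F t [set w | (tau w < t%:E)%E]) -> measurable_fun setT tau.
Proof.
move=> tau0 Ftau; apply: measurable_ge0_lt => // t t0.
by apply: (Fm (ltW t0)); exact: Ftau.
Qed.

(** The sigma-algebra usually written F_(tau+). *)
Definition right_events (tau : Omega -> \bar R) : set (set Omega) :=
  [set A | measurable A /\ forall t, 0 < t -> F t (A `&` [set w | (tau w < t%:E)%E])].

Lemma sigma_algebra_right_events (tau : Omega -> \bar R) :
  (forall t, 0 < t -> F t [set w | (tau w < t%:E)%E]) ->
  sigma_algebra setT (right_events tau).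
Proof.
move=> Ftau; split.
- split=> // t t0; rewrite set0I; have [] := sF (ltW t0); by [].
- move=> A [mA FA]; split=> [|t t0]; first by rewrite setTD; exact: measurableC.
  rewrite setTD setIC -setDE.
  rewrite (_ : _ `\` A = [set w | (tau w < t%:E)%E] `\` (A `&` [set w | (tau w < t%:E)%E])).
    by apply: sigma_algebra_setD; [exact/sF/ltW|exact: Ftau|exact: FA].
  by apply/seteqP; split=> w /=; tauto.
- move=> A FA; split=> [|t t0]; first by apply: bigcupT_measurable => n; have [] := FA n.
  rewrite setI_bigcupl; have [_ _] := sF (ltW t0); apply=> n.
  by have [_] := FA n; exact.
Qed.

(** A bounded functional of the path after time t that is right-continuous in t
    satisfies the hypothesis of the sampling lemma, by the Markov property at
    fixed times. *)
Lemma strong_markov x (tau : Omega -> \bar R) A C : (forall w, (0 <= tau w)%E) ->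
  (forall t, 0 < t -> F t [set w | (tau w < t%:E)%E]) ->
  right_events tau A -> A `<=` [set w | (tau w < +oo)%E] -> measurable C ->
  P x (A `&` (fun w => increment_path (fine (tau w)) w) @^-1` C) =
  (P x A * levy_law C)%E.
Proof.
move=> tau0 Ftau [mA FA] Afin mC.
have mtau := measurable_optional_time tau0 Ftau.
have r0 w : 0 <= fine (tau w) by exact: fine_ge0.
have mr : measurable_fun setT (fun w => fine (tau w)) by exact: measurableT_comp.
have rX u w : 0 <= u -> rcont (fun t => X (t + u) w - X t w).
  move=> u0 t t0; apply: cvgB; last exact: (levy_cadlag w).1.
  have := @rcont_shift _ _ u (levy_cadlag w).1 u0 t t0.
  by rewrite addrC; under eq_fun do rewrite addrC.
have mU : measurable_fun setT (fun w => increment_path (fine (tau w)) w).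
  apply: measurable_to_paths => u u0.
  rewrite (_ : (fun w => _) = (fun w => X (fine (tau w) + u) w - X (fine (tau w)) w)).
    apply: (@measurable_eval _ _ _ (fun t w => X (t + u) w - X t w)) => //.
      by move=> t t0; apply: measurable_funB; apply: levy_measurable => //; exact: addr_ge0.
    by move=> w; exact: rX.
  by apply/funext => w; rewrite coord_increment_path.
apply: law_from_cylinders mC => // l l0.
have mcyl := measurable_cylinder l0.
pose g n (t : R) w : R := soft_below n l (fun u => coord u (increment_path t w)).
have msoft n : measurable_fun [set: paths] (fun f : paths => soft_below n l (fun u => coord u f)).
  by apply: measurable_soft_below => p pl; apply: measurable_coord; exact: (allP l0).
pose k n : R := fine (\int[levy_law]_f (soft_below n l (fun u => coord u f))%:E)%E.
have s01 n f := soft_below_itv n l f.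
have kE n : (k n)%:E = (\int[levy_law]_f (soft_below n l (fun u => coord u f))%:E)%E.
  by have [r _ rE] := integral_itv01 levy_law (msoft n) (fun f => s01 n (coord^~ f)); rewrite /k rE.
have gk n : (\int[P x]_(w in A) (g n (fine (tau w)) w)%:E = P x A * (k n)%:E)%E.
  rewrite muleC -integral_cst//.
  apply: (@sampling _ _ _ (P x) F (g n) (cst (k n)) 1 hF _ _ _ _ _ _ _ tau A) => //.
  - move=> t t0; apply: measurable_soft_below => p pl; apply: measurableT_comp.
      by apply: measurable_coord; exact: (allP l0).
    exact: measurable_increment_path.
  - move=> w t t0; apply: soft_below_cvg => p pl.
    have p0 : 0 <= p.1 by exact: (allP l0).
    have := rX _ w p0 t t0.
    rewrite coord_increment_path//; apply: cvg_trans; apply: near_eq_cvg.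
    near=> s; rewrite coord_increment_path//.
    by apply: (le_trans t0); near: s; exact: nbhs_right_ge.
  - by move=> t w _; case/andP: (s01 n (fun u => coord u (increment_path t w))).
  - apply: aeW => w t _; have /andP[h0 h1] := s01 n (fun u => coord u (increment_path t w)).
    by rewrite ger0_norm.
  - by move=> w; rewrite -lee_fin kE; apply: integral_ge0 => f _; rewrite lee_fin;
      case/andP: (s01 n (coord^~ f)).
  - move=> t t0 B FB.
    pose h (_ : Omega) (f : paths) := (soft_below n l (fun u => coord u f))%:E.
    rewrite (@freezing _ _ _ (P x) (F t) B _ _ (increment_path t) levy_law h)//.
    + by apply: eq_integral => w _; rewrite /h -kE.
    + exact: sF.
    + exact: Fm.
    + exact: measurable_increment_path.
    + by move=> B' C' FB' _ mC'; exact: markov.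
    + by apply/measurable_EFinP; exact: (measurableT_comp (msoft n) measurable_snd).
    + by move=> w f; rewrite lee_fin; case/andP: (s01 n (coord^~ f)).
have kcvg : ((k n)%:E @[n --> \oo] --> levy_law (cylinder l))%E.
  rewrite (_ : (fun n => _) =
    (fun n => \int[levy_law]_f (soft_below n l (fun u => coord u f))%:E)%E); last first.
    by apply/funext => n; rewrite kE.
  rewrite -[cylinder l]setIT -(integral_indic _ _ mcyl)//.
  apply: (bounded_convergence (K := 1)) => //.
  - by apply: aeW => f; rewrite indicE mem_setE; exact: cvg_soft_below.
  - by apply: aeW => f n; have /andP[h0 h1] := s01 n (coord^~ f); rewrite ger0_norm.
have lcvg : ((\int[P x]_(w in A) (g n (fine (tau w)) w)%:E) @[n --> \oo] -->
    P x (A `&` (fun w => increment_path (fine (tau w)) w) @^-1` cylinder l))%E.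
  have mpre : measurable ((fun w => increment_path (fine (tau w)) w) @^-1` cylinder l).
    by rewrite -[_ @^-1` _]setTI; exact: mU.
  rewrite setIC -(integral_indic _ _ mpre)//.
  apply: (bounded_convergence (K := 1)) => //.
  - move=> n; exact: (measurableT_comp (msoft n) mU).
  - apply: aeW => w; pose f := increment_path (fine (tau w)) w.
    rewrite indicE (_ : _ \in _ = all (fun p => coord p.1 f < p.2) l).
      exact: (@cvg_soft_below _ l (coord^~ f)).
    by apply/idP/idP; rewrite inE.
  - apply: aeW => w n; have /andP[h0 h1] := s01 n (fun u => coord u (increment_path (fine (tau w)) w)).
    by rewrite ger0_norm.
apply: (cvg_unique (@ereal_hausdorff R) lcvg).
rewrite /= (_ : (fun n => _) = (fun n => P x A * (k n)%:E)%E); last exact/funext.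
by apply: cvgeZl => //; exact: fin_num_measure.
Unshelve. all: by end_near. Qed.

Lemma right_events_measurable (tau : Omega -> \bar R) : right_events tau `<=` measurable.
Proof. by move=> A []. Qed.

(** * The expected discount at a first passage *)

Definition level_time (c : R) (w : Omega) : \bar R := hit c (X^~ w).

Lemma level_time_ge0 c w : (0 <= level_time c w)%E. Proof. exact: hit_ge0. Qed.

Lemma level_time_optional c t : 0 < t -> F t [set w | (level_time c w < t%:E)%E].
Proof.
move=> t0; rewrite (_ : [set _ | _] = \bigcup_(r in [set r : rat | 0 < (ratr r : R) < t])
    (X (ratr r) @^-1` `]c, +oo[)).
  apply: sigma_algebra_bigcup_rat => [|r /= /andP[r0 rt]]; first exact/sF/ltW.
  apply: (Fmon (ltW r0) (ltW rt)); apply: (hFX (ltW r0)).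
  by exists `]c, +oo[%classic => //; rewrite setTI.
apply/seteqP; split=> w /=; first move=> /(hit_ltP _ _ (levy_cadlag w).1)[r [rt cr]].
  by exists r => //=; rewrite in_itv/= cr.
move=> [r rt]; rewrite /= in_itv/= andbT => cr.
by apply/(hit_ltP _ _ (levy_cadlag w).1); exists r.
Qed.

Lemma measurable_level_time c : measurable_fun setT (level_time c).
Proof.
exact: measurable_optional_time (level_time_ge0 c) (level_time_optional c).
Qed.

Lemma levy_no_jump x : {ae P x, forall w, no_positive_jumps (X^~ w)}.
Proof. by case: hX => _ nj _ _ _; apply: filterS (nj x) => w []. Qed.

Section passage.
Variables (om : R -> R) (q : R).
Hypotheses (om_meas : measurable_fun setT om) (om_ge0 : forall y, 0 <= om y).
Hypotheses (om_loc : locally_bounded om) (q_ge0 : 0 <= q).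
Local Notation disc := (discount om q).

Lemma measurable_discount_from d' (T : measurableType d') c (Y : T -> R) (U : T -> paths) :
  measurable_fun setT Y -> measurable_fun setT U ->
  measurable_fun setT (fun w => disc c (fun u => Y w + coord u (U w))).
Proof.
move=> mY mU.
apply: (@measurable_discount _ _ _ _ _ _ _ _ _ (fun u w => Y w + coord u (U w))) => //.
  move=> t t0; apply: measurable_funD => //.
  by apply: measurableT_comp mU; exact: measurable_coord.
by move=> w; apply: cadlag_addl; exact: coord_cadlag.
Qed.

Lemma passage_subproof : exists p : R -> R -> R, forall x c, 0 <= p x c <= 1 /\
  (p x c)%:E = (\int[levy_law]_f (disc c (fun u => x + coord u f))%:E)%E.
Proof.
exists (fun x c => fine (\int[levy_law]_f (disc c (fun u => x + coord u f))%:E)%E) => x c.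
have mD : measurable_fun [set: paths] (fun f => disc c (fun u => x + coord u f)).
  exact: measurable_discount_from.
have [r r01 ->] := integral_itv01 levy_law mD
  (fun f => ltac:(by rewrite discount_ge0 ?discount_le1)).
by [].
Qed.

(** The function B of the statement, with the exponential time integrated out. *)
Definition passage : R -> R -> R := sval (cid passage_subproof).

Lemma EFin_passage x c :
  (passage x c)%:E = (\int[levy_law]_f (disc c (fun u => x + coord u f))%:E)%E.
Proof. by have [] := svalP (cid passage_subproof) x c. Qed.

Lemma passage_ge0 x c : 0 <= passage x c.
Proof. by have [/andP[]] := svalP (cid passage_subproof) x c. Qed.

Lemma passage_le1 x c : passage x c <= 1.
Proof. by have [/andP[]] := svalP (cid passage_subproof) x c. Qed.

Lemma measurable_passage c : measurable_fun setT (passage^~ c).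
Proof.
apply/measurable_EFinP.
pose h (p : R * paths) := (disc c (fun u => p.1 + coord u p.2))%:E.
rewrite (_ : EFin \o _ = fubini_F levy_law h); last first.
  by apply/funext => x; rewrite /= EFin_passage.
apply: measurable_fun_fubini_tonelli_F.
  by apply/measurable_EFinP; exact: measurable_discount_from.
by move=> p; rewrite lee_fin discount_ge0.
Qed.

(** Freezing the variables known at time t, while the path after t is independent of
    them. *)
Lemma passage_markov x c t (Y W : Omega -> R) A : 0 <= t -> (forall w, 0 <= W w) ->
  measurable_wrt (F t) Y ->
  measurable_wrt (F t) W -> F t A ->
  (\int[P x]_(w in A) (W w * disc c (fun u => Y w + coord u (increment_path t w)))%:E =
   \int[P x]_(w in A) (W w * passage (Y w) c)%:E)%E.
Proof.
move=> t0 W0 mY mW FA.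
pose h w f := (W w * disc c (fun u => Y w + coord u f))%:E.
rewrite (@freezing _ _ _ (P x) (F t) A _ _ (increment_path t) levy_law h)//.
- apply: eq_integral => w _; rewrite EFinM EFin_passage -ge0_integralZl//.
  + by apply/measurable_EFinP; apply: measurable_discount_from => //; exact: measurable_cst.
  + by move=> f _; rewrite lee_fin discount_ge0.
  + by rewrite lee_fin.
- exact: sF.
- exact: Fm.
- exact: measurable_increment_path.
- by move=> B C FB _ mC; exact: markov.
- apply/measurable_EFinP; apply: measurable_funM.
    exact: measurableT_comp mW measurable_fst.
  apply: measurable_discount_from; last exact: measurable_snd.
  exact: measurableT_comp mY measurable_fst.
- by move=> w f; rewrite lee_fin mulr_ge0// discount_ge0.
Qed.

Lemma path_from_increment t w u : 0 <= t -> X (t + u) w = X t w + coord u (increment_path t w).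
Proof. by move=> t0; rewrite coord_increment_path// subrKC. Qed.

Lemma expected_discount x c :
  (\int[P x]_w (disc c (X^~ w))%:E = (passage x c)%:E)%E.
Proof.
transitivity (\int[P x]_w (1 * disc c (fun u => X 0 w + coord u (increment_path 0 w)))%:E)%E.
  apply: eq_integral => w _; congr EFin; rewrite mul1r; apply: eq_discount => u u0.
  by rewrite -path_from_increment// add0r.
rewrite (@passage_markov x c 0 (X 0) (cst 1))//; last 2 first.
- exact: levy_adapted.
- by apply: sigma_algebra_setT; exact: sF.
under eq_integral do rewrite mul1r.
rewrite (@ae_eq_integral _ _ _ _ _ (cst (passage x c)%:E))//.
- by rewrite integral_cst//= probability_setT mule1.
- apply/measurable_EFinP.
  apply: (@measurableT_comp _ _ _ _ _ _ (passage^~ c) _ (X 0)); first exact: measurable_passage.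
  exact: levy_measurable.
- by apply: filterS (levy_start x) => w -> _.
Qed.

Lemma measurable_discount_levy c : measurable_fun setT (fun w => disc c (X^~ w)).
Proof.
by apply: measurable_discount => //; [exact: levy_measurable|exact: levy_cadlag].
Qed.

Lemma right_events_discount c (B : set R) : measurable B ->
  right_events (level_time c)
    ([set w | (level_time c w < +oo)%E] `&` (fun w => disc c (X^~ w)) @^-1` B).
Proof.
move=> mB; split=> [|t t0].
  apply: measurableI; last by rewrite -[_ @^-1` _]setTI; exact: measurable_discount_levy.
  by rewrite -[[set _ | _]]setTI; apply: emeasurable_fun_infty_o => //; exact: measurable_level_time.
have t0' := ltW t0.
rewrite [X in F t X](_ : _ = (fun w => disc c (fun u => X (Num.min u t) w)) @^-1` B `&`
    [set w | (level_time c w < t%:E)%E]); last first.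
  have stopE w : (level_time c w < t%:E)%E ->
      disc c (fun u => X (Num.min u t) w) = disc c (X^~ w).
    by move=> h; exact: (@discount_stop _ om q c (X^~ w)).
  apply/seteqP; split=> w /=; first by move=> [[_ Bw] h]; split=> //; rewrite stopE.
  move=> [Bw h]; split=> //; split; first exact: lt_trans (ltry t).
  by rewrite stopE in Bw.
apply: sigma_algebra_setI; [exact: sF| |exact: level_time_optional].
move: B mB; apply/sub_measurable_funP; first exact: sF.
apply: (@measurable_discount R om q om_meas om_ge0 om_loc c _ (g_sigma_algebraType (F t))
  (fun u w => X (Num.min u t) w)) => //.
  by move=> u u0; exact: stopped_path_adapted.
by move=> w; exact: stopped_path_cadlag.
Qed.

(** Right after the passage, the discount up to it is known: it coincides with that
    of the path stopped at any later time. *)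
Lemma right_measurable_discount c :
  measurable_wrt (right_events (level_time c))
    (fun w => disc c (X^~ w)).
Proof.
have sG := sigma_algebra_right_events (@level_time_optional c).
pose D := [set w | (level_time c w < +oo)%E].
have GD : right_events (level_time c) D.
  have := right_events_discount c (B := setT) measurableT.
  by rewrite preimage_setT setIT.
apply/(sub_measurable_funP _ sG) => B mB.
have GB := right_events_discount c mB.
rewrite (_ : _ @^-1` B = (D `&` (fun w => disc c (X^~ w)) @^-1` B) `|`
   (~` D `&` [set w | B 0])); last first.
  apply/seteqP; split=> w /=.
    move=> Bw; have [Dw|Dw] := pselect (D w); [by left|right; split=> //].
    by move: Bw; rewrite /discount ifF//; apply/negbTE/negP.
  by move=> [[]//|[Dw B0]]; rewrite /discount ifF//; apply/negbTE/negP.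
apply: sigma_algebra_setU => //; have [B0|B0] := pselect (B 0).
  rewrite (_ : [set w | B 0] = setT) ?setIT; first exact: sigma_algebra_setC.
  by apply/seteqP; split.
rewrite (_ : [set w | B 0] = set0) ?setI0; first by have [] := sG.
by apply/seteqP; split.
Qed.

(** The discount up to the level c' splits at the passage of the level c, where
    the path starts afresh from exactly c because it has no positive jumps. *)
Lemma passage_mul x c c' : x <= c -> c <= c' ->
  passage x c' = passage x c * passage c c'.
Proof.
move=> xc cc'; apply: EFin_inj.
pose tau := level_time c.
pose D := [set w | (tau w < +oo)%E].
have mD : measurable D.
  by rewrite -[D]setTI; apply: emeasurable_fun_infty_o => //; exact: measurable_level_time.
pose U w := increment_path (fine (tau w)) w.
pose h w f := (disc c (X^~ w) * disc c' (fun u => c + coord u f))%:E.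
have h0 w f : (0 <= h w f)%E by rewrite lee_fin mulr_ge0// discount_ge0.
have r0 w : 0 <= fine (tau w) by rewrite fine_ge0// level_time_ge0.
have mr : measurable_fun setT (fun w => fine (tau w)).
  by apply: measurableT_comp => //; exact: measurable_level_time.
have mU : measurable_fun setT U.
  apply: measurable_to_paths => u u0.
  rewrite (_ : (fun w => _) = (fun w => X (fine (tau w) + u) w - X (fine (tau w)) w)).
    apply: measurable_funB; last first.
      by apply: measurable_eval => //; [exact: levy_measurable|move=> w; exact: (levy_cadlag w).1].
    apply: (@measurable_eval _ _ _ (fun t w => X t w) (fun w => fine (tau w) + u)) => //.
    + exact: levy_measurable.
    + by move=> w; exact: (levy_cadlag w).1.
    + by apply: measurable_funD => //; exact: measurable_cst.
    + by move=> w; exact: addr_ge0.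
  by apply/funext => w; rewrite coord_increment_path.
have sG := sigma_algebra_right_events (@level_time_optional c).
have GD : right_events tau D.
  have := right_events_discount c (B := setT) measurableT.
  by rewrite preimage_setT setIT.
rewrite -(expected_discount x c').
transitivity (\int[P x]_(w in D) h w (U w))%E.
  rewrite [RHS]integral_mkcond; apply: ae_eq_integral => //.
  - by apply/measurable_EFinP; exact: measurable_discount_levy.
  - apply/(measurable_restrictT _ mD); apply: measurable_funTS; apply/measurable_EFinP.
    apply: measurable_funM; first exact: measurable_discount_levy.
    by apply: measurable_discount_from => //; exact: measurable_cst.
  - apply: filterS2 (levy_start x) (levy_no_jump x) => w Xw0 njw _.
    rewrite /patch; case: ifPn; rewrite ?inE ?notin_setE /D /mkset => tw.
      have tE : tau w = (fine (tau w))%:E by exact: hit_finE.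
      have Xtau : X (fine (tau w)) w = c.
        by apply: (hit_val (levy_cadlag w) njw) => //; rewrite Xw0.
      rewrite /h; congr EFin.
      rewrite (@discount_shift _ _ q _ _ _ c' (X^~ w) (fine (tau w)))//.
      + congr (_ * _); first by rewrite (discount_fin _ _ tE).
        by apply: eq_discount => u u0; rewrite -Xtau -path_from_increment.
      + exact: levy_cadlag.
      + by rewrite -tE; exact: hit_le.
    congr EFin; rewrite /discount ifF//; apply/negbTE; apply: contra_notN tw.
    exact: le_lt_trans (hit_le _ cc').
rewrite (@freezing _ _ _ (P x) (right_events tau) D _ _ U levy_law h)//.
- transitivity (\int[P x]_(w in D) ((passage c c')%:E * (disc c (X^~ w))%:E))%E.
    apply: eq_integral => w _; rewrite EFin_passage muleC -ge0_integralZl//.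
    + apply/measurable_EFinP; apply: measurable_discount_from => //; exact: measurable_cst.
    + by move=> f _; rewrite lee_fin discount_ge0.
    + by rewrite lee_fin discount_ge0.
  rewrite ge0_integralZl//.
  + rewrite (_ : \int[P x]_(w in D) (disc c (X^~ w))%:E = (passage x c)%:E)%E.
      by rewrite muleC -EFinM.
    transitivity (\int[P x]_w (disc c (X^~ w))%:E)%E; last exact: expected_discount.
    rewrite [LHS]integral_mkcond; apply: eq_integral => w _.
    rewrite /patch; case: ifPn => //; rewrite notin_setE /D /= => tw.
    by rewrite /discount ifF//; apply/negbTE/negP.
  + by apply/measurable_EFinP; apply: measurable_funTS; exact: measurable_discount_levy.
  + by move=> w _; rewrite lee_fin discount_ge0.
  + by rewrite lee_fin passage_ge0.
- exact: right_events_measurable.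
- move=> A C GA AD mC; apply: (strong_markov _ (level_time_ge0 c)) => //.
  exact: level_time_optional.
- apply/measurable_EFinP; apply: measurable_funM; last first.
    by apply: measurable_discount_from; [exact: measurable_cst|exact: measurable_snd].
  apply: (@measurableT_comp _ _ _ _ (g_sigma_algebraType (right_events tau)) _
    (fun w => disc c (X^~ w)) _ fst); last exact: measurable_fst.
  exact: right_measurable_discount.
Qed.

Definition reach_prob (a : R) : \bar R := levy_law [set f | (hit a (coord^~ f) < +oo)%E].

Lemma measurable_reach a : measurable ([set f | (hit a (coord^~ f) < +oo)%E] : set paths).
Proof.
rewrite -[X in measurable X]setTI; apply: emeasurable_fun_infty_o => //.
apply: (@measurable_hit _ paths _ (@coord R)); first by move=> t; exact: measurable_coord.
by move=> f; exact: (coord_cadlag f).1.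
Qed.

Lemma reach_le a b : a <= b -> (reach_prob b <= reach_prob a)%E.
Proof.
move=> ab; apply: le_measure; rewrite ?inE; try exact: measurable_reach.
by move=> f /=; apply: le_lt_trans; exact: hit_le.
Qed.

(** Discounting does not affect which levels can be reached, and reaching a level
    only depends on the distance to it. *)
Lemma passage_eq0 x c : (passage x c == 0) = (reach_prob (c - x) == 0%E).
Proof.
have mD : measurable_fun [set: paths] (fun f => (disc c (fun u => x + coord u f))%:E).
  by apply/measurable_EFinP; exact: measurable_discount_from.
have absE : (\int[levy_law]_f `|(disc c (fun u => x + coord u f))%:E| = (passage x c)%:E)%E.
  by rewrite EFin_passage; apply: eq_integral => f _; rewrite gee0_abs// lee_fin discount_ge0.
apply/eqP/eqP => [p0|r0].
  have := (ae_eq_integral_abs levy_law measurableT mD).1; rewrite absE p0 => /(_ erefl).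
  move=> [N [mN N0 sN]]; apply/eqP; rewrite -measure_le0 -N0; apply: le_measure.
  - by rewrite inE; exact: measurable_reach.
  - by rewrite inE.
  - move=> f /= hf; apply: sN => /= /(_ Logic.I)[] /eqP; apply/negP.
    by rewrite gt_eqF// discount_gt0// hit_addl.
apply: EFin_inj; rewrite -absE.
apply/(ae_eq_integral_abs levy_law measurableT mD).
exists [set f | (hit (c - x) (coord^~ f) < +oo)%E]; split=> //; first exact: measurable_reach.
move=> f /= H; apply: contrapT => hf; apply: H => _; rewrite /discount ifF//.
by apply/negbTE/negP; rewrite hit_addl.
Qed.

(** If no positive level were reached, then almost surely the path would never exceed
    its value at any rational time, hence would be nonincreasing. *)
Lemma reach_pos : exists2 a, 0 < a & reach_prob a != 0%E.
Proof.
apply: contrapT => none.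
have r0 n : reach_prob n.+1%:R^-1 = 0%E.
  apply: contrapT => /eqP r0; apply: none; exists n.+1%:R^-1 => //; by rewrite invr_gt0.
(* Countably many events: the path never exceeds its value at a rational time by
   1 / (m + 1). *)
pose E (k : rat * nat) := [set w | 0 <= (ratr k.1 : R) ->
  hit k.2.+1%:R^-1 (coord^~ (increment_path (ratr k.1) w)) = +oo%E].
have aeE k : {ae P 0, forall w, E k w}.
  have [k0|k0] := leP 0 (ratr k.1 : R); last first.
    by apply: aeW => w; rewrite /E/= leNgt k0.
  exists (increment_path (ratr k.1) @^-1` [set f | (hit k.2.+1%:R^-1 (coord^~ f) < +oo)%E]).
  split.
  - rewrite -[_ @^-1` _]setTI; apply: (measurable_increment_path k0) => //.
    exact: measurable_reach.
  - rewrite -[_ @^-1` _]setTI (markov 0 k0); last exact: measurable_reach.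
      by rewrite [levy_law _]r0 mule0.
    by apply: sigma_algebra_setT; exact: sF.
  - by move=> w /= nE; rewrite ltey; apply/eqP => h; apply: nE.
have aeall : {ae P 0, forall w, forall k : rat * nat, E k w}.
  have H (n : nat) : {ae P 0, forall w, forall k : rat * nat, unpickle n = Some k -> E k w}.
    case: (unpickle n) => [k|]; last exact: aeW.
    by apply: filterS (aeE k) => w Ew _ [<-].
  apply: filterS (ae_foralln H) => w Ew k; exact: (Ew _ k (pickleK k)).
have [_ njm _ _ _] := hX.
have [N [mN N0 sN]] : {ae P 0, forall w, False}.
  apply: filterS2 aeall (njm 0) => w Ew [_]; apply; right => s t s0.
  rewrite le_eqVlt => /predU1P[->//|st]; rewrite leNgt; apply/negP => Xst.
  have e0 : 0 < (X t w - X s w) / 2 by rewrite divr_gt0// subr_gt0.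
  have [d' d'0 H] := @rcontP _ (X^~ w) s _ (levy_cadlag w).1 s0 e0.
  have /rat_in_itvoo[r] : s < Num.min t (s + d') by rewrite lt_min st ltrDl.
  rewrite in_itv/= lt_min => /and3P[sr rt rd].
  have r0' : 0 <= (ratr r : R) by rewrite (le_trans s0)// ltW.
  have [n /= ne] : exists n, (n.+1%:R^-1 : R) < (X t w - X s w) / 2.
    have [n _ /(_ n (leqnn n)) /= ne] := near_infty_natSinv_lt (PosNum e0).
    by exists n.
  have := Ew (r, n) r0' => /= hoo.
  have : ~ (n.+1%:R^-1 < coord (t - ratr r) (increment_path (ratr r) w)).
    move=> h; have : (hit n.+1%:R^-1 (coord^~ (increment_path (ratr r) w)) <= (t - ratr r)%:E)%E.
      by apply: ereal_inf_lbound; exists (t - ratr r) => //=; rewrite subr_gt0.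
    by rewrite hoo leye_eq.
  rewrite coord_increment_path// subrKC; apply.
  apply: (lt_trans ne); have := H (ratr r); rewrite (ltW sr) rd => /(_ erefl).
  by rewrite ltr_distl => /andP[h1 h2]; lra.
have : (P 0 setT <= P 0 N)%E by apply: le_measure; rewrite ?inE// => w _; exact: sN.
by rewrite N0 probability_setT lee_fin ler10.
Qed.

Lemma reach_add a b : 0 <= a -> 0 <= b -> reach_prob a != 0%E -> reach_prob b != 0%E ->
  reach_prob (a + b) != 0%E.
Proof.
move=> a0 b0 ra rb.
rewrite -[a + b]subr0 -(passage_eq0 0) (@passage_mul _ a)//; last by rewrite lerDl.
have abE : a + b - a = b by rewrite addrC addKr.
by apply: mulf_neq0; rewrite passage_eq0 ?subr0 ?abE.
Qed.

(** Levels add up along independent pieces of the path, so that arbitrarily high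
    levels are reached with positive probability. *)
Lemma reach_neq0 a : reach_prob a != 0%E.
Proof.
have [b b0 rb] := reach_pos.
have rn n : reach_prob (n.+1%:R * b) != 0%E.
  elim: n => [|n IH]; first by rewrite mul1r.
  by rewrite -[n.+2%:R]natr1 mulrDl mul1r reach_add// ?mulr_ge0// ltW.
have : a <= (Num.truncn (a / b)).+1%:R * b.
  by rewrite -ler_pdivrMr//; apply/ltW/truncnS_gt.
move=> /reach_le ra; apply: contra (rn (Num.truncn (a / b))) => /eqP ra0.
by rewrite -measure_le0 -ra0.
Qed.

Lemma passage_gt0 x c : 0 < passage x c.
Proof. by rewrite lt_def passage_ge0 passage_eq0 reach_neq0. Qed.

(** From c itself the passage is immediate: passage c c is positive and equal to
    its own square. *)
Lemma passage_eq1 x c : c <= x -> passage x c = 1.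
Proof.
rewrite le_eqVlt => /predU1P[->|cx].
  apply: (mulfI (lt0r_neq0 (passage_gt0 x x))).
  by rewrite mulr1 -passage_mul.
apply: EFin_inj; rewrite -expected_discount.
rewrite (@ae_eq_integral _ _ _ _ _ (cst 1%E))//.
- by rewrite integral_cst//= probability_setT mule1.
- by apply/measurable_EFinP; exact: measurable_discount_levy.
- apply: filterS (levy_start x) => w Xw0 _; rewrite discount0//; last by rewrite Xw0.
  exact: (levy_cadlag w).1.
Qed.

End passage.

(** * The scale function *)

Section scale_function.
Variables (om : R -> R) (q : R).
Hypotheses (om_meas : measurable_fun setT om) (om_ge0 : forall y, 0 <= om y).
Hypotheses (om_loc : locally_bounded om) (q_ge0 : 0 <= q).
Local Notation disc := (discount om q).
Local Notation passage := (passage om_meas om_ge0 om_loc q_ge0).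

Lemma levy_law_start : {ae levy_law, forall f : paths, coord 0 f = 0}.
Proof.
have m0 : measurable ([set f | coord 0 f != 0] : set paths).
  rewrite (_ : [set _ | _] = coord 0 @^-1` (~` [set 0])); last first.
    by apply/seteqP; split=> f /=; move/eqP.
  rewrite -[_ @^-1` _]setTI; apply: measurable_coord => //; exact: measurableC.
exists [set f | coord 0 f != 0]; split => //; last by move=> f /= /eqP.
transitivity (P 0 (increment_path 0 @^-1` [set f | coord 0 f != 0])); first by [].
rewrite (_ : _ @^-1` _ = set0) ?measure0//.
apply/seteqP; split=> w // h; have : coord 0 (increment_path 0 w) != 0 by exact: h.
by rewrite coord_increment_path// addr0 subrr eqxx.
Qed.

(** The origin is regular for the open half-line above it, because the discount
    at rate q + 1 up to the passage above the starting point is one. *)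
Lemma levy_law_regular : {ae levy_law, forall f : paths, hit 0 (coord^~ f) = 0%E}.
Proof.
(* For q = 0 and om = 0 the discount would not detect a positive passage time. *)
have q1 : 0 <= q + 1 by rewrite addr_ge0.
pose D f := discount om (q + 1) 0 (fun u => 0 + coord u f).
have D0 (f : paths) : 0 <= D f by exact: discount_ge0.
have D1 (f : paths) : D f <= 1 by exact: discount_le1.
have mD : measurable_fun [set: paths] D by exact: measurable_discount_from.
have ID : (\int[levy_law]_f (D f)%:E = 1)%E.
  by rewrite -EFin_passage// passage_eq1.
have I1 : (\int[levy_law]_f (1 - D f)%:E = 0)%E.
  have : (\int[levy_law]_f (D f)%:E + \int[levy_law]_f (1 - D f)%:E = 1)%E.
    rewrite -ge0_integralD//.
    - rewrite (eq_integral (cst 1%E)); first by rewrite integral_cst//= probability_setT mule1.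
      by move=> f _; rewrite -EFinD subrKC.
    - by move=> f _; rewrite lee_fin.
    - exact/measurable_EFinP.
    - by move=> f _; rewrite lee_fin subr_ge0.
    - by apply/measurable_EFinP; apply: measurable_funB => //; exact: measurable_cst.
  rewrite ID; set I := (\int[_]_f _)%E; case: I => [r||]//=.
  by rewrite -EFinD => -[] h; congr EFin; lra.
have mD1 : measurable_fun [set: paths] (fun f => (1 - D f)%:E).
  by apply/measurable_EFinP; apply: measurable_funB => //; exact: measurable_cst.
have := (ae_eq_integral_abs levy_law measurableT mD1).1.
have -> : (\int[levy_law]_f `|(1 - D f)%:E| = 0)%E.
  by rewrite -[RHS]I1; apply: eq_integral => f _; rewrite gee0_abs// lee_fin subr_ge0.
move=> /(_ erefl); apply: filterS => f /(_ Logic.I)[] /eqP; rewrite subr_eq0 => /eqP.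
have h0E : hit 0 (fun u => 0 + coord u f) = hit 0 (coord^~ f) by rewrite hit_addl subr0.
have [hoo|] := boolP (hit 0 (fun u => (0 + coord u f)%R) < +oo)%E; last first.
  by rewrite /D /discount => /negbTE-> /eqP; rewrite oner_eq0.
have hE := hit_finE hoo; set r := fine _ in hE.
rewrite /D (discount_fin _ _ hE) -[LHS]expR0 => /expR_inj.
have := clock_ge0 om_ge0 (fun u => 0 + coord u f) r.
have r0 : 0 <= r by rewrite fine_ge0// hit_ge0.
rewrite -h0E hE => h1 h2; congr EFin.
have : 0 <= q * r by exact: mulr_ge0.
by move: h2; rewrite mulrDl mul1r; lra.
Qed.

(** By regularity a slightly higher level is passed soon, and until then the rate of
    discounting is bounded uniformly for starting points in a bounded set. *)
Lemma passage_near1 M e : 0 < e -> exists2 d', 0 < d' &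
  forall x y, `|x| <= M -> x <= y -> y - x < d' -> 1 - e < passage x y.
Proof.
move=> e0; apply: contrapT => none.
(* Otherwise there are pairs of merging levels whose discount stays below 1 - e. *)
have {none} /choice[z zP] : forall n : nat, exists z : R * R,
    [/\ `|z.1| <= M, z.1 <= z.2, z.2 - z.1 < n.+1%:R^-1 & passage z.1 z.2 <= 1 - e].
  move=> n; apply: contrapT => H; apply: none.
  exists n.+1%:R^-1; first by rewrite invr_gt0.
  move=> x y xM xy yx; rewrite ltNge; apply/negP => h; apply: H.
  by exists (x, y).
have cvg1 : ((passage (z n).1 (z n).2)%:E @[n --> \oo] --> 1%E)%E.
  rewrite [X in X @ _ --> _](_ : _ = fun n =>
      (\int[levy_law]_f (disc (z n).2 (fun u => (z n).1 + coord u f))%:E)%E); last first.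
    by apply/funext => n; rewrite EFin_passage.
  rewrite [X in _ --> X](_ : _ = \int[levy_law]_f (cst 1 f)%:E)%E; last first.
    by rewrite (eq_integral (cst 1%E))// integral_cst//= probability_setT mule1.
  apply: (bounded_convergence (K := 1)) => //.
  - move=> n; by apply: measurable_discount_from => //; exact: measurable_cst.
  - apply: filterS2 levy_law_start levy_law_regular => f f0 hf.
    have cf := coord_cadlag f.
    have [K1 K10 HK1] := cadlag_bounded cf ler01.
    have [K K0 HK] := om_bounded om_loc (M + K1).
    apply/cvgrPdist_lt => eps eps0; rewrite /cst.
    have Kq : 0 < K + q + 1 by rewrite ltr_wpDl// addr_ge0.
    (* The passage occurs before a time s with (K + q) s < eps, where K bounds om. *)
    have [s /andP[s0 seta] fs] : exists2 s,
        0 < s < Num.min 1 (eps / (K + q + 1)) & 0 < coord s f.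
      apply/hit_lt; rewrite hf lte_fin lt_min ltr01 divr_gt0//.
    move: seta; rewrite lt_min ltr_pdivlMr// => /andP[s1 seps].
    near=> n; have [zM z12 zn _] := zP n; pose x := (z n).1; pose y := (z n).2.
    have hs : (hit y (fun u => (x + coord u f)%R) <= s%:E)%E.
      apply: ereal_inf_lbound; exists s => //=; split=> //.
      rewrite -ltrBlDl; apply: (lt_trans zn).
      by near: n; exact: (near_infty_natSinv_lt (PosNum fs)).
    have hoo : (hit y (fun u => (x + coord u f)%R) < +oo)%E by exact: le_lt_trans (ltry s).
    have hE := hit_finE hoo; set r := fine _ in hE.
    have r0 : 0 <= r by rewrite fine_ge0// hit_ge0.
    have rs : r <= s by rewrite -lee_fin -hE.
    have ck : clock om (fun u => x + coord u f) r <= K * r.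
      apply: clock_le_cst => //; first exact: cadlag_addl.
      move=> u /andP[u0 ur]; apply: HK.
      rewrite (le_trans (ler_normD _ _))// lerD// HK1// u0 (le_trans ur)//.
      by rewrite (le_trans rs)// ltW.
    have D1 := discount_le1 om_ge0 q_ge0 y (fun u => x + coord u f).
    rewrite ger0_norm ?subr_ge0// (discount_fin _ _ hE).
    have := expR_ge1Dx (- clock om (fun u => x + coord u f) r - q * r).
    have : (K + q) * r <= (K + q + 1) * s.
      by rewrite ler_pM// ?addr_ge0// lerDl.
    move: ck seps; set ex := expR _; move=> h1 h2 h3 h4.
    by move: h3; rewrite mulrDl => h3; rewrite mulrC in h2; lra.
  - apply: aeW => f n; rewrite ger0_norm ?discount_ge0//; exact: discount_le1.
have : (1 <= (1 - e)%:E)%E.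
  rewrite -(cvg_lim _ cvg1)//; apply: lime_le; first by apply: cvgP cvg1.
  by near=> n; rewrite lee_fin; have [] := zP n.
by rewrite lee_fin; lra.
Unshelve. all: by end_near. Qed.

(** The function H of the statement, with the exponential time integrated out; the
    level max x 0 may be replaced by any higher one. *)
Definition scale (x : R) : R :=
  passage x (Num.max x 0) / passage 0 (Num.max x 0).

Lemma scale_level x m : x <= m -> 0 <= m -> scale x = passage x m / passage 0 m.
Proof.
move=> xm m0; have Mm : Num.max x 0 <= m by rewrite ge_max xm.
rewrite (@passage_mul _ _ om_meas om_ge0 om_loc q_ge0 x (Num.max x 0) m)//; last by rewrite le_max lexx.
rewrite (@passage_mul _ _ om_meas om_ge0 om_loc q_ge0 0 (Num.max x 0) m)//; last by rewrite le_max lexx orbT.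
by rewrite /scale -mulf_div divff ?mulr1// lt0r_neq0// passage_gt0.
Qed.

Lemma scale_gt0 x : 0 < scale x.
Proof. by rewrite /scale divr_gt0// passage_gt0. Qed.

Lemma scale_passage x c : x <= c -> scale x = scale c * passage x c.
Proof.
move=> xc; pose m := Num.max c 0.
have cm : c <= m by rewrite le_max lexx.
have m0 : 0 <= m by rewrite le_max lexx orbT.
rewrite (scale_level (le_trans xc cm) m0) (scale_level cm m0).
by rewrite (@passage_mul _ _ om_meas om_ge0 om_loc q_ge0 x c m)// [RHS]mulrC mulrA.
Qed.

Lemma le_scale x y : x <= y -> scale x <= scale y.
Proof.
move=> xy; rewrite (scale_passage xy) ler_piMr ?passage_le1//; exact/ltW/scale_gt0.
Qed.

Lemma scale_continuous : continuous scale.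
Proof.
move=> x; apply/cvgrPdist_lt => e e0.
pose M := `|x| + 1.
have sM : 0 < scale M + 1 by rewrite addr_gt0// scale_gt0.
have [d' d'0 H] := @passage_near1 M (e / (scale M + 1)) (divr_gt0 e0 sM).
have close a b : `|a| <= M -> `|b| <= M -> a <= b -> b - a < d' -> `|scale b - scale a| < e.
  move=> aM bM ab ba; rewrite ger0_norm ?subr_ge0 ?le_scale// (scale_passage ab).
  have h := H a b aM ab ba.
  have p1 := @passage_le1 _ _ om_meas om_ge0 om_loc q_ge0 a b.
  have bM' : scale b <= scale M.
    by apply: le_scale; exact: le_trans (ler_norm b) bM.
  have sb := scale_gt0 b.
  have : scale b * (1 - passage a b) <= scale M * (1 - passage a b).
    by rewrite ler_wpM2r// subr_ge0.
  have : (scale M + 1) * (1 - passage a b) < e.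
    by rewrite mulrC -ltr_pdivlMr//; lra.
  by rewrite mulrDl mul1r mulrBr mulr1; lra.
exists (Num.min 1 d'); first by rewrite /= lt_min ltr01.
move=> y /=; rewrite lt_min => /andP[xy1 xyd].
have xM : `|x| <= M by rewrite lerDl.
have yM : `|y| <= M.
  by rewrite -[y](subrK x) (le_trans (ler_normD _ _))// addrC lerD2l distrC ltW.
have [xy|/ltW yx] := leP x y.
  by rewrite distrC close//; move: xyd; rewrite distrC ger0_norm// subr_ge0.
by rewrite close//; move: xyd; rewrite ger0_norm// subr_ge0.
Qed.

End scale_function.

(** * The stopped martingale *)

Section stopped_martingale.
Variables (om : R -> R) (q : R).
Hypotheses (om_meas : measurable_fun setT om) (om_ge0 : forall y, 0 <= om y).
Hypotheses (om_loc : locally_bounded om) (q_ge0 : 0 <= q).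
Local Notation disc := (discount om q).
Local Notation passage := (passage om_meas om_ge0 om_loc q_ge0).
Local Notation scale := (scale om_meas om_ge0 om_loc q_ge0).

Definition exp_scale (t : R) (w : Omega) : R :=
  expR (- clock om (X^~ w) t - q * t) * scale (X t w).

Variable c : R.
Local Notation Z := (stopped exp_scale (level_time c)).
Let stop (t : R) w : R := fine (Order.min t%:E (level_time c w)).

Lemma stopE t w : 0 <= t -> (stop t w)%:E = Order.min t%:E (level_time c w).
Proof.
move=> t0; rewrite /stop; have := level_time_ge0 c w.
by case: (level_time c w) => [r||]//= _; rewrite ?minEge /= ?minye ?miney//; case: ifP.
Qed.

Lemma stop_itv t w : 0 <= t -> 0 <= stop t w <= t.
Proof.
by move=> t0; rewrite -!lee_fin stopE// le_min lee_fin t0 level_time_ge0 ge_min lexx.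
Qed.

Lemma stop_le t w : 0 <= t -> ((stop t w)%:E <= level_time c w)%E.
Proof. by move=> t0; rewrite stopE// ge_min lexx orbT. Qed.

Lemma stop_before t w : (t%:E <= level_time c w)%E -> stop t w = t.
Proof. by move=> tt; rewrite /stop min_l. Qed.

Lemma stop_after t w : (level_time c w <= t%:E)%E -> stop t w = fine (level_time c w).
Proof. by move=> tt; rewrite /stop min_r. Qed.

Lemma measurable_scale : measurable_fun setT scale.
Proof. by apply: continuous_measurable_fun; exact: scale_continuous. Qed.

Lemma measurable_exp_scale d' (T : measurableType d') (V : R -> T -> R) (r : T -> R) :
  (forall t, 0 <= t -> measurable_fun setT (V t)) -> (forall w, cadlag (V^~ w)) ->
  measurable_fun setT r -> (forall w, 0 <= r w) ->
  measurable_fun setT (fun w => expR (- clock om (V^~ w) (r w) - q * r w) * scale (V (r w) w)).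
Proof.
move=> mV cV mr r0; apply: measurable_funM.
  apply: measurableT_comp => //; apply: measurable_funB.
    apply: measurableT_comp => //.
    apply: (@measurable_eval _ _ _ (fun t w => clock om (V^~ w) t)) => //.
      by move=> t _; exact: measurable_clock.
    by move=> w; exact: clock_rcont.
  by apply: measurable_funM => //; exact: measurable_cst.
apply: measurableT_comp; first exact: measurable_scale.
by apply: measurable_eval => // w; exact: (cV w).1.
Qed.

(** Up to time t the stopped process is a functional of the path stopped at t. *)
Lemma stopped_adapted t : 0 <= t ->
  measurable_wrt (F t) (Z t).
Proof.
move=> t0; pose V u w := X (Num.min u t) w.
pose r w := fine (Order.min t%:E (hit c (V^~ w))).
have cV w : cadlag (V^~ w) by exact: stopped_path_cadlag.
have mV u : 0 <= u -> measurable_wrt (F t) (V u).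
  by move=> u0; exact: stopped_path_adapted.
have rE w : r w = stop t w by rewrite /r /stop /level_time -(hit_stop c (X^~ w) t0).
have r0 w : 0 <= r w by rewrite rE; case/andP: (stop_itv w t0).
have mr : measurable_wrt (F t) r.
  apply: measurableT_comp => //; apply: measurable_mine => //.
  by apply: (@measurable_hit _ (g_sigma_algebraType (F t)) _ V) => // w; exact: (cV w).1.
have := @measurable_exp_scale _ (g_sigma_algebraType (F t)) V r mV cV mr r0.
congr measurable_fun; apply/funext => w.
have /andP[s0 st] := stop_itv w t0.
rewrite /stopped /exp_scale -/(stop t w) rE.
rewrite (_ : clock om (V^~ w) _ = clock om (X^~ w) (stop t w)) /V ?min_l//.
by apply: eq_clock => u /andP[_ us]; rewrite min_l// (le_trans us).
Qed.

Lemma exp_scale_cadlag w : cadlag (exp_scale^~ w).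
Proof.
apply: (@cadlagM _ (fun t => expR (- clock om (X^~ w) t - q * t)) (fun t => scale (X t w)));
  last by apply: (@cadlag_comp _ scale (X^~ w)) (levy_cadlag w); exact: scale_continuous.
apply: (@cadlag_comp _ expR (fun t => - clock om (X^~ w) t - q * t)); first exact: continuous_expR.
have [rc lc] := clock_cadlag om_meas om_ge0 om_loc (levy_cadlag w).
split=> t t0.
  apply: cvgB; first by apply: cvgN; exact: rc.
  by apply: cvgM; [exact: cvg_cst|apply: cvg_at_right_filter; exact: cvg_id].
apply: is_cvgB; first by apply: is_cvgN; exact: lc.
apply: is_cvgM; first exact: is_cvg_cst.
by apply/cvg_ex; exists t; apply: cvg_at_left_filter; exact: cvg_id.
Qed.

Lemma stopped_cadlag w : cadlag (Z^~ w).
Proof.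
have cZ := exp_scale_cadlag w.
have := level_time_ge0 c w; case E : (level_time c w) => [r||]// r0.
  rewrite (_ : Z^~ w = (fun u => exp_scale (Num.min u r) w)).
    exact: (@cadlag_stop _ (exp_scale^~ w) r).
  by apply/funext => t; rewrite /stopped E -EFin_min.
rewrite (_ : Z^~ w = exp_scale^~ w)//.
by apply/funext => t; rewrite /stopped E miney.
Qed.

Lemma exp_le1 t w : 0 <= t -> expR (- clock om (X^~ w) t - q * t) <= 1.
Proof.
move=> t0; rewrite -expR0 ler_expR.
have := clock_ge0 om_ge0 (X^~ w) t; have := mulr_ge0 q_ge0 t0; lra.
Qed.

Lemma exp_scale_ge0 t w : 0 <= exp_scale t w.
Proof. by rewrite mulr_ge0 ?expR_ge0//; exact/ltW/scale_gt0. Qed.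

Lemma stop_level x : {ae P x, forall w, forall t, 0 <= t -> X (stop t w) w <= Num.max c x}.
Proof.
apply: filterS2 (levy_start x) (levy_no_jump x) => w Xw0 njw t t0.
have /andP[s0 st] := stop_itv w t0.
have [xc|cx] := leP x c.
  by apply: (hit_val_le (levy_cadlag w) njw) => //; [rewrite Xw0|exact: stop_le].
rewrite (_ : stop t w = 0) ?Xw0//.
by rewrite stop_after /level_time hit_eq0// ?lee_fin ?Xw0//; exact: (levy_cadlag w).1.
Qed.

Lemma stopped_bounded x :
  {ae P x, forall w, forall t, 0 <= t -> `|Z t w| <= scale (Num.max c x)}.
Proof.
apply: filterS (stop_level x) => w Xm t t0.
rewrite ger0_norm ?exp_scale_ge0// -[leRHS]mul1r.
have /andP[s0 st] := stop_itv w t0.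
by apply: ler_pM; rewrite ?expR_ge0 ?exp_le1 ?(le_scale _ _ _ _ (Xm t t0))//;
  exact/ltW/scale_gt0.
Qed.

(** Started above c, the process is stopped at once. *)
Definition terminal (x : R) (w : Omega) : R :=
  if x <= c then scale c * disc c (X^~ w) else scale x.

Lemma terminal_ge0 x w : 0 <= terminal x w.
Proof.
rewrite /terminal; case: ifP => _; last exact/ltW/scale_gt0.
by rewrite mulr_ge0 ?discount_ge0//; exact/ltW/scale_gt0.
Qed.

Lemma measurable_terminal x : measurable_fun setT (terminal x).
Proof.
rewrite /terminal; case: (x <= c); last exact: measurable_cst.
apply: measurable_funM; first exact: measurable_cst.
exact: measurable_discount_levy.
Qed.

Lemma measurable_stopped t : 0 <= t -> measurable_fun setT (Z t).
Proof.
move=> t0; apply: sub_measurable_fun (stopped_adapted t0); [exact: Fm|exact: sF].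
Qed.

Lemma level_time_event t : 0 <= t -> F t [set w | (level_time c w < t%:E)%E].
Proof.
rewrite le_eqVlt => /predU1P[<-|]; last exact: level_time_optional.
rewrite (_ : [set _ | _] = set0); first by have [] := sF (lexx 0).
by apply/seteqP; split=> w //=; rewrite ltNge level_time_ge0.
Qed.

Lemma clock_adapted t : 0 <= t ->
  measurable_wrt (F t) (fun w => clock om (X^~ w) t).
Proof.
move=> t0; pose V u w := X (Num.min u t) w.
rewrite (_ : (fun w => _) = (fun w => clock om (V^~ w) t)); last first.
  by apply/funext => w; apply: eq_clock => u /andP[_ ut]; rewrite /V min_l.
apply: (@measurable_clock _ _ om_meas om_ge0 om_loc _ (g_sigma_algebraType (F t)) V) => //.
  by move=> u u0; exact: stopped_path_adapted.
by move=> w; exact: stopped_path_cadlag.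
Qed.

(** At the passage the path is at c, or at its starting point if that is above c. *)
Lemma terminal_stopped x : {ae P x, forall w,
  (if (level_time c w < +oo)%E then exp_scale (fine (level_time c w)) w else 0) = terminal x w}.
Proof.
apply: filterS2 (levy_start x) (levy_no_jump x) => w Xw0 njw.
rewrite /terminal; have [xc|cx] := leP x c; last first.
  rewrite (_ : level_time c w = 0%E) ?ltry; last first.
    by rewrite /level_time hit_eq0 ?Xw0//; exact: (levy_cadlag w).1.
  by rewrite /= /exp_scale clock0 mulr0 oppr0 addr0 expR0 mul1r Xw0.
rewrite /discount -/(level_time c w); case: ifPn => [too|_]; last by rewrite mulr0.
rewrite /exp_scale mulrC; congr (scale _ * _).
by apply: (hit_val (levy_cadlag w) njw); [rewrite Xw0|exact: hit_finE].
Qed.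

(** By the Markov property the stopped process consists of the conditional
    expectations of its terminal value: before the passage time, discounting up
    to it splits at t; after it, both sides agree. *)
Lemma stopped_integral x t A : 0 <= t -> F t A ->
  (\int[P x]_(w in A) (Z t w)%:E = \int[P x]_(w in A) (terminal x w)%:E)%E.
Proof.
move=> t0 FA; have mA : measurable A by exact: Fm FA.
have mZ := measurable_stopped t0; have mT := measurable_terminal x.
have [xc|cx] := leP x c; last first.
  apply: ae_eq_integral => //; try by apply/measurable_EFinP; exact: measurable_funTS.
  apply: filterS (levy_start x) => w Xw0 _; congr EFin.
  rewrite /terminal leNgt cx /= /stopped -/(stop t w) (_ : stop t w = 0); last first.
    by rewrite stop_after /level_time hit_eq0// ?lee_fin ?Xw0//; exact: (levy_cadlag w).1.
  by rewrite /exp_scale clock0 mulr0 oppr0 addr0 expR0 mul1r Xw0.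
pose D := [set w | (level_time c w < t%:E)%E].
have FD : F t D by exact: level_time_event.
have FAD : F t (A `&` ~` D).
  by apply: sigma_algebra_setI => //; [exact: sF|apply: sigma_algebra_setC => //; exact: sF].
have mD : measurable D by exact: Fm FD.
have mAD : measurable (A `&` D) by exact: measurableI.
have mAD' : measurable (A `&` ~` D) by exact: Fm FAD.
rewrite !(ge0_integral_setID (P x) mA mD)//; last 2 first.
- exact: terminal_ge0.
- by move=> w; exact: exp_scale_ge0.
congr (_ + _)%E.
  apply: ae_eq_integral => //; try by apply/measurable_EFinP; exact: measurable_funTS.
  apply: filterS (terminal_stopped x) => w <- [_ Dw]; congr EFin.
  by rewrite /stopped -/(stop t w) stop_after ?ltW// ifT//; exact: lt_trans Dw (ltry t).
pose W w := scale c * expR (- clock om (X^~ w) t - q * t).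
have W0 w : 0 <= W w by rewrite mulr_ge0 ?expR_ge0//; exact/ltW/scale_gt0.
have mW : measurable_wrt (F t) W.
  apply: measurable_funM; first exact: measurable_cst.
  apply: measurableT_comp => //; apply: measurable_funB; last exact: measurable_cst.
  by apply: measurableT_comp => //; exact: clock_adapted.
transitivity (\int[P x]_(w in A `&` ~` D) (W w * passage (X t w) c)%:E)%E.
  apply: ae_eq_integral => //.
  - by apply/measurable_EFinP; exact: measurable_funTS.
  - apply/measurable_EFinP; apply: measurable_funTS; apply: measurable_funM.
      by apply: sub_measurable_fun mW; [exact: Fm|exact: sF].
    apply: (@measurableT_comp _ _ _ _ _ _ (passage^~ c) _ (X t)); last exact: levy_measurable.
    exact: measurable_passage.
  - apply: filterS2 (levy_start x) (levy_no_jump x) => w Xw0 njw [_ Dw]; congr EFin.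
    have tw : (t%:E <= level_time c w)%E by rewrite leNgt; exact/negP.
    rewrite /stopped -/(stop t w) stop_before// /W mulrAC mulrC.
    rewrite -scale_passage//.
    by apply: (hit_val_le (levy_cadlag w) njw) => //; rewrite Xw0.
rewrite -(passage_markov _ _ _ _ x c t0 W0 (levy_adapted t0 (lexx t)) mW FAD).
apply: eq_integral => w; rewrite inE => -[_ Dw]; congr EFin.
have tw : (t%:E <= level_time c w)%E by rewrite leNgt; exact/negP.
rewrite /terminal xc /W -mulrA; congr (_ * _).
rewrite (@discount_shift _ _ q _ _ _ c (X^~ w) t)//; last exact: levy_cadlag.
by congr (_ * _); apply: eq_discount => u u0; rewrite -path_from_increment.
Qed.

Lemma stopped_martingale x : martingale (P x) F Z.
Proof.
split; first exact: hF.
- move=> t t0 _ [B mB <-]; rewrite setTI.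
  by move: B mB; apply/sub_measurable_funP; [exact: sF|exact: stopped_adapted].
- move=> t t0; apply: bounded_integrable; first exact: measurable_stopped.
  by apply: filterS (stopped_bounded x) => w; apply.
- move=> s t s0 st A FA; rewrite !stopped_integral//; first exact: le_trans st.
  exact: Fmon FA.
Qed.

Lemma stopped_sampling x (sigma : Omega -> \bar R) A : (forall w, (0 <= sigma w)%E) ->
  (forall t, 0 < t -> F t [set w | (sigma w < t%:E)%E]) -> right_events sigma A ->
  A `<=` [set w | (sigma w < +oo)%E] ->
  (\int[P x]_(w in A) (Z (fine (sigma w)) w)%:E = \int[P x]_(w in A) (terminal x w)%:E)%E.
Proof.
move=> s0 Fs [mA FA] Afin.
apply: (@sampling _ _ _ (P x) F Z (terminal x) (scale (Num.max c x)) hF) => //.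
- exact: measurable_stopped.
- by move=> w; exact: (stopped_cadlag w).1.
- by move=> t w _; exact: exp_scale_ge0.
- exact: stopped_bounded.
- exact: measurable_terminal.
- exact: terminal_ge0.
- by move=> t t0 B; exact: stopped_integral.
- exact: measurable_optional_time.
Qed.

Let exceed (eps : R) (n : R) w : \bar R := (n%:E + hit eps (fun u => Z (n + u)%R w))%E.

Let exceed_ge0 eps n w : 0 <= n -> (0 <= exceed eps n w)%E.
Proof. by move=> n0; rewrite adde_ge0 ?lee_fin// hit_ge0. Qed.

Let exceed_lt eps n w t : 0 <= n ->
  (exceed eps n w < t%:E)%E <-> exists r : rat, 0 < (ratr r : R) < t - n /\ eps < Z (n + ratr r) w.
Proof.
move=> n0; rewrite /exceed -lteBrDl// -EFinB; apply: (@hit_ltP _ eps (fun u => Z (n + u) w)).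
by apply: (@rcont_shift _ (Z^~ w)) => //; exact: (stopped_cadlag w).1.
Qed.

Let exceed_optional eps n t : 0 <= n -> 0 < t -> F t [set w | (exceed eps n w < t%:E)%E].
Proof.
move=> n0 t0; rewrite (_ : [set _ | _] = \bigcup_(r in [set r : rat | 0 < (ratr r : R) < t - n])
    (Z (n + ratr r) @^-1` `]eps, +oo[)).
  apply: sigma_algebra_bigcup_rat => [|r /= /andP[r0 rt]]; first exact/sF/ltW.
  have nr : 0 <= n + ratr r by rewrite addr_ge0// ltW.
  apply: (Fmon nr); first by lra.
  by move/(sub_measurable_funP _ (sF nr)): (stopped_adapted nr); apply; exact: measurable_itv.
apply/seteqP; split=> w /=.
  move/(exceed_lt _ _ _ n0) => [r [rt cr]]; exists r => //=.
  by rewrite in_itv/= cr.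
move=> [r rt]; rewrite /= in_itv/= andbT => cr.
by apply/(exceed_lt _ _ _ n0); exists r.
Qed.

Lemma integral_terminal_cvg0 x : x <= c ->
  (\int[P x]_w (terminal x w * \1_[set w | (n.+1%:R%:E <= level_time c w)%E] w)%:E
     @[n --> \oo] --> 0)%E.
Proof.
move=> xc; have mev n : measurable [set w | (n.+1%:R%:E <= level_time c w)%E].
  rewrite -[X in measurable X]setTI; apply: emeasurable_fun_c_infty => //.
  exact: measurable_level_time.
have := @bounded_convergence _ _ _ (P x) setT
  (fun n w => terminal x w * \1_[set w | (n.+1%:R%:E <= level_time c w)%E] w) (cst 0)
  (scale c) measurableT.
rewrite (_ : (\int[P x]_(w in setT) (cst 0 w)%:E = 0)%E); last by rewrite integral0.
apply.
- move=> n; apply: measurable_funM; first exact: measurable_terminal.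
  exact: measurable_indic.
- exact: measurable_cst.
- apply: aeW => w; rewrite /terminal xc.
  have [hoo|hoo] := boolP (level_time c w < +oo)%E; last first.
    rewrite (_ : disc c _ = 0); last by rewrite /discount ifF//; exact/negbTE.
    by under eq_fun do rewrite mulr0 mul0r; exact: cvg_cst.
  have tE := hit_finE hoo.
  apply: cvg_near_cst; near=> n; rewrite indicE memNset ?mulr0//=.
  apply/negP; rewrite -ltNge /level_time tE lte_fin.
  near: n; exists (Num.truncn (fine (hit c (X^~ w)))) => // n /= nk.
  by apply: lt_le_trans (truncnS_gt _) _; rewrite ler_nat ltnS.
- apply: aeW => w n; rewrite /terminal xc ger0_norm; last first.
    apply: mulr_ge0; last by rewrite indicE; case: (_ \in _).
    by apply: mulr_ge0; [exact/ltW/scale_gt0|exact: discount_ge0].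
  rewrite -mulrA ler_piMr//; first exact/ltW/scale_gt0.
  by rewrite mulr_ile1 ?discount_ge0 ?discount_le1// indicE; case: (_ \in _).
Unshelve. all: by end_near. Qed.

(** The maximal inequality, obtained by sampling at the first time after n at which
    the process exceeds eps: the probability that this happens while the level has
    not been passed by time n is at most 1 / eps times the part of the terminal
    value carried by paths that pass c after time n. *)
Lemma stopped_vanishes x eps : x <= c -> 0 < eps ->
  {ae P x, forall w, level_time c w = +oo%E -> exists n, forall u, n < u -> Z u w <= eps}.
Proof.
move=> xc eps0.
pose E n := [set w | (n.+1%:R%:E <= level_time c w)%E] `&` [set w | (exceed eps n.+1%:R w < +oo)%E].
have n0 n : 0 < n.+1%:R :> R by [].
have mex n : measurable_fun setT (exceed eps n.+1%:R).
  apply: measurable_optional_time; first by move=> w; exact: exceed_ge0.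
  by move=> t t0; exact: exceed_optional.
have mev n : measurable [set w | (n.+1%:R%:E <= level_time c w)%E].
  rewrite -[X in measurable X]setTI; apply: emeasurable_fun_c_infty => //.
  exact: measurable_level_time.
have mE n : measurable (E n).
  apply: measurableI; first exact: mev.
  by rewrite -[X in measurable X]setTI; apply: emeasurable_fun_infty_o.
have mT := measurable_terminal x.
have maximal n : (eps%:E * P x (E n) <=
    \int[P x]_w (terminal x w * \1_[set w | (n.+1%:R%:E <= level_time c w)%E] w)%:E)%E.
  apply: (@le_trans _ _ (\int[P x]_(w in E n) (terminal x w)%:E)%E); last first.
    rewrite integral_mkcond; apply: ge0_le_integral => //.
    - by move=> w _; rewrite /patch; case: ifP => // _; rewrite lee_fin terminal_ge0.
    - by apply/(measurable_restrictT _ (mE n)); apply: measurable_funTS; exact/measurable_EFinP.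
    - apply/measurable_EFinP; apply: measurable_funM => //; exact: measurable_indic.
    - move=> w _; rewrite /patch; case: ifPn => [|_]; last first.
        by rewrite lee_fin mulr_ge0// terminal_ge0.
      by rewrite inE => -[tw _]; rewrite indicE mem_set// mulr1.
  rewrite -(@stopped_sampling x (exceed eps n.+1%:R)); last 4 first.
  - by move=> w; exact: exceed_ge0.
  - by move=> t t0; exact: exceed_optional.
  - split=> // t t0; have [tn|nt] := leP t n.+1%:R.
      rewrite (_ : _ `&` _ = set0); first by have [] := sF (ltW t0).
      apply/seteqP; split=> w //= [_] /(exceed_lt _ _ _ (ltW (n0 n)))[r [/andP[r0 rt] _]].
      by have : 0 < t - n.+1%:R; [exact: lt_trans rt|rewrite subr_gt0 ltNge tn].
    rewrite (_ : _ `&` _ = [set w | (n.+1%:R%:E <= level_time c w)%E] `&`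
        [set w | (exceed eps n.+1%:R w < t%:E)%E]); last first.
      apply/seteqP; split=> w /=; first by move=> [[]].
      by move=> [h1 h2]; split=> //; split=> //; exact: lt_trans (ltry t).
    apply: sigma_algebra_setI; [exact/sF/ltW| |exact: exceed_optional].
    apply: (Fmon (ltW (n0 n)) (ltW nt)).
    rewrite (_ : [set _ | _] = ~` [set w | (level_time c w < n.+1%:R%:E)%E]).
      by apply: sigma_algebra_setC; [exact/sF/ltW|exact: level_time_event (ltW (n0 n))].
    by apply/seteqP; split=> w /=; rewrite leNgt => /negP.
  - by move=> w [].
  rewrite -integral_cst//.
  apply: ge0_le_integral => //.
  - by move=> w _; rewrite lee_fin ltW.
  - apply/measurable_EFinP; apply: measurable_funTS.
    apply: (@measurable_eval _ _ _ Z) => //.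
    + exact: measurable_stopped.
    + by move=> w; exact: (stopped_cadlag w).1.
    + exact: measurableT_comp.
    + by move=> w; rewrite fine_ge0// exceed_ge0.
  - move=> w [_ woo]; rewrite lee_fin.
    have : (hit eps (fun u => Z (n.+1%:R + u)%R w) < +oo)%E.
      by move: woo; rewrite /= /exceed; case: (hit _ _) => [r||]// _; rewrite ltry.
    move=> /hit_finE hE.
    rewrite /exceed hE /=.
    apply: (@hit_val_ge _ eps (fun u => Z (n.+1%:R + u)%R w)) hE.
    by apply: (@rcont_shift _ (Z^~ w)) => //; exact: (stopped_cadlag w).1.
have PE0 : P x (\bigcap_n E n) = 0%E.
  have mcap : measurable (\bigcap_n E n) by apply: bigcap_measurable => // n _; exact: mE.
  have le0 : (eps%:E * P x (\bigcap_n E n) <= 0)%E.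
    have cv := integral_terminal_cvg0 xc.
    rewrite -(cvg_lim _ cv)//; apply: lime_ge; first by apply: cvgP cv.
    apply: nearW => n; apply: le_trans (maximal n); rewrite lee_pmul2l//.
    by apply: le_measure; rewrite ?inE//; exact: bigcap_inf.
  apply/eqP; rewrite -measure_le0; move: le0.
  by rewrite -{1}(mule0 eps%:E) lee_pmul2l.
exists (\bigcap_n E n); split => //; first by apply: bigcap_measurable => // n _; exact: mE.
move=> w /= nw n _; split=> /=.
  by apply: contrapT => tw; apply: nw => toe; exfalso; apply: tw; rewrite toe leey.
apply: contrapT => /negP; rewrite -leNgt leye_eq => /eqP eoo; apply: nw => _.
exists n.+1%:R => u nu; rewrite leNgt; apply/negP => Zu.
have : (hit eps (fun u => Z (n.+1%:R + u)%R w) <= (u - n.+1%:R)%:E)%E.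
  apply: ereal_inf_lbound; exists (u - n.+1%:R) => //=; rewrite subr_gt0 subrKC.
  by split.
by move: eoo; rewrite /exceed; case: (hit _ _).
Qed.

Lemma stopped_terminal x : x <= c -> terminal_value (P x) Z (terminal x).
Proof.
move=> xc.
have vanish : {ae P x, forall w, forall m : nat, level_time c w = +oo%E ->
    exists n, forall u, n < u -> Z u w <= m.+1%:R^-1}.
  by apply: ae_foralln => m; apply: stopped_vanishes => //; rewrite invr_gt0.
apply: filterS2 vanish (terminal_stopped x) => w van <-.
have [hoo|hoo] := boolP (level_time c w < +oo)%E; last first.
  have too : level_time c w = +oo%E by apply/eqP; rewrite -leye_eq leNgt.
  apply/cvgrPdist_le => e e0.
  have [m _ /(_ m (leqnn m)) /= me] := near_infty_natSinv_lt (PosNum e0).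
  have [n Hn] := van m too.
  near=> u; rewrite sub0r normrN ger0_norm ?exp_scale_ge0//.
  apply: le_trans (ltW me); apply: Hn; near: u.
  by exists n; split=> //; exact: num_real.
have tE := hit_finE hoo.
apply: cvg_near_cst; near=> u.
rewrite /stopped -/(stop u w) stop_after// /level_time tE lee_fin; near: u.
by exists (fine (hit c (X^~ w))); split=> [|u /ltW//]; exact: num_real.
Unshelve. all: by end_near. Qed.

End stopped_martingale.

(** * Identification of the scale function *)

Section scale_function.
Variables (e : Omega -> \bar R) (q : R).
Hypotheses (q_ge0 : 0 <= q) (he : exponential_time P q e).
Hypothesis heX : forall x, independent (P x) (sigma_rv e) (sigma_process X [set t | 0 <= t]).
Variable om : R -> R.
Hypotheses (om_meas : measurable_fun setT om) (om_ge0 : forall y, 0 <= om y).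
Hypotheses (om_loc : locally_bounded om).
Local Notation scale := (scale om_meas om_ge0 om_loc q_ge0).
Local Notation passage := (passage om_meas om_ge0 om_loc q_ge0).

Lemma additive_functional_level_time c w : (level_time c w < +oo)%E ->
  additive_functional X om (level_time c w) w = (clock om (X^~ w) (fine (level_time c w)))%:E.
Proof.
move=> /hit_finE tE; rewrite {1}/level_time tE additive_functional_clock//.
exact: levy_cadlag.
Qed.

(** Averaging over the exponential time turns it into a discount at rate q. *)
Lemma passage_functionalE x c : passage_functional P X e om x c = passage x c.
Proof.
pose G := sigma_process X [set t | 0 <= t].
have sG : sigma_algebra setT G by exact: smallest_sigma_algebra.
have GX t : 0 <= t -> measurable_wrt G (X t).
  move=> t0; apply/sub_measurable_funP => // B mB.
  by apply: sub_sigma_algebra; exists t => //; exists B => //; rewrite setTI.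
have Gm : G `<=` measurable.
  apply: smallest_sub; first exact: sigma_algebra_measurable.
  move=> _ [t /= t0 [B mB <-]]; rewrite setTI -[_ @^-1` _]setTI.
  exact: (levy_measurable t0).
have cX := levy_cadlag.
have mtau : measurable_wrt G (level_time c).
  by apply: (@measurable_hit _ (g_sigma_algebraType G) _ X) => // w; exact: (cX w).1.
pose V w := expR (- clock om (X^~ w) (fine (level_time c w))).
have mV : measurable_wrt G V.
  apply: measurableT_comp => //; apply: measurableT_comp => //.
  apply: (@measurable_eval _ (g_sigma_algebraType G) _ (fun t w => clock om (X^~ w) t)).
  - by move=> t t0; exact: measurable_clock.
  - by move=> w; exact: clock_rcont.
  - exact: measurableT_comp.
  - by move=> w; rewrite fine_ge0// level_time_ge0.
rewrite /passage_functional unlock -[RHS]/(fine (passage x c)%:E); congr fine.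
rewrite -(expected_discount).
transitivity (\int[P x]_w (if (level_time c w < e w)%E then V w else 0)%:E)%E.
  apply: eq_integral => w _; congr EFin; rewrite indicE.
  rewrite -[passage_time X c w]/(level_time c w).
  have [te|te] := boolP (level_time c w < e w)%E; last first.
    by rewrite memNset ?mulr0//=; exact/negP.
  rewrite mem_set// mulr1 additive_functional_level_time//.
  exact: lt_le_trans te (leey _).
rewrite (exponential_freezing he q_ge0 sG Gm (heX x) (sigma_algebra_setT sG))//.
- apply: eq_integral => w _; congr EFin; rewrite /discount -/(level_time c w).
  by case: ifP => // _; rewrite /V expRD mulNr.
- by move=> w; exact: level_time_ge0.
- by move=> w; exact: expR_ge0.
Qed.

Lemma HfunE : Hfun P X e om = scale.
Proof. by apply/funext => x; rewrite /Hfun !passage_functionalE. Qed.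

Variable c : R.
Local Notation Z := (stopped (Zproc P X e q om) (passage_time X c)).

Lemma ZprocE : Zproc P X e q om = exp_scale om_meas om_ge0 om_loc q_ge0.
Proof.
apply/funext => t; apply/funext => w; rewrite /Zproc HfunE additive_functional_clock//.
exact: levy_cadlag.
Qed.

Lemma ZterminalE x w : x <= c ->
  Zterminal P X e q om c w = terminal om_meas om_ge0 om_loc q_ge0 c x w.
Proof.
move=> xc; rewrite /Zterminal HfunE /terminal xc -mulrA; congr (_ * _).
rewrite -[passage_time X c]/(level_time c) indicE /discount -/(level_time c w).
case: ifPn => [too|too]; last by rewrite memNset ?mulr0//=; exact/negP.
by rewrite mem_set// mulr1 additive_functional_level_time.
Qed.

Lemma stopped_Zproc x :
  [/\ martingale (P x) F Z, forall w, cadlag (Z^~ w), bounded_process (P x) Z &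
      x <= c -> terminal_value (P x) Z (Zterminal P X e q om c)].
Proof.
rewrite ZprocE -[passage_time X c]/(level_time c); split.
- exact: (stopped_martingale).
- exact: (stopped_cadlag om_meas om_ge0 om_loc q_ge0 c).
- by exists (scale (Num.max c x)); exact: (stopped_bounded).
- move=> xc; rewrite (_ : Zterminal P X e q om c = terminal om_meas om_ge0 om_loc q_ge0 c x).
    exact: (stopped_terminal).
  by apply/funext => w; exact: ZterminalE.
Qed.

End scale_function.

(** * The time-changed martingale *)

Section time_changed_process.
Variables (e : Omega -> \bar R) (q : R).
Hypotheses (q_ge0 : 0 <= q) (he : exponential_time P q e).
Hypothesis heX : forall x, independent (P x) (sigma_rv e) (sigma_process X [set t | 0 <= t]).
Hypothesis heF : forall x, independent (P x) (sigma_rv e) (sigma_infty F).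
Variables (om : R -> R) (gam c : R).
Hypotheses (om_meas : measurable_fun setT om) (om_gt0 : forall y, 0 < om y).
Hypotheses (om_loc : locally_bounded om) (gam_gt0 : 0 < gam).
Let om_ge0 y : 0 <= om y. Proof. exact: ltW. Qed.
Let gam_ge0 : 0 <= gam. Proof. exact: ltW. Qed.
Let omg_meas : measurable_fun setT (fun z => gam * om z).
Proof. by apply: measurable_funM => //; exact: measurable_cst. Qed.
Let omg_ge0 y : 0 <= gam * om y. Proof. by rewrite mulr_ge0. Qed.
Let omg_loc : locally_bounded (fun z => gam * om z). Proof. exact: locally_boundedM. Qed.

Local Notation scale := (scale omg_meas omg_ge0 omg_loc q_ge0).
Local Notation exp_scale := (exp_scale omg_meas omg_ge0 omg_loc q_ge0).
Local Notation terminal := (terminal omg_meas omg_ge0 omg_loc q_ge0 c).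
Local Notation tau := (level_time c).
Local Notation W := (stopped (Wproc P X e om gam) (Ypassage_time X e om c)).
Local Notation G := (Gfiltration X e om F).
Let cX w : cadlag (X^~ w). Proof. exact: levy_cadlag. Qed.
Let rho s w := time_change X om s w.


(** The factor of the martingale in the original time scale that remains when
    the discount at rate q is replaced by killing at the exponential time. *)
Definition pending t w := expR (- gam * clock om (X^~ w) t) * scale (X t w).

Lemma scale_pos y : 0 < scale y. Proof. exact: (scale_gt0). Qed.

Lemma pending_ge0 t w : 0 <= pending t w.
Proof. by rewrite mulr_ge0 ?expR_ge0//; exact/ltW/scale_pos. Qed.

Lemma pending_exp_scale t w : pending t w * expR (- q * t) = exp_scale t w.
Proof.
rewrite /pending /exp_scale (clockM om_meas om_ge0 om_loc gam_ge0 t (cX w)).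
by rewrite mulrAC -expRD; congr (expR _ * _); ring.
Qed.

Lemma stopped_WprocE s w : 0 <= s -> W s w = killed_path X w e c (pending^~ w) (rho s w).
Proof.
move=> s0; rewrite -(stopped_time_change om_meas om_gt0 om_loc (cX w) e c gam scale)//.
by rewrite /stopped /Wproc (HfunE q_ge0 he heX omg_meas omg_ge0 omg_loc).
Qed.

Lemma killed_path_ge0 w t : 0 <= killed_path X w e c (pending^~ w) t.
Proof. by rewrite /killed_path; case: ifP => // _; exact: pending_ge0. Qed.

Lemma rho_ge0 s w : (0 <= rho s w)%E.
Proof. exact: time_change_ge0. Qed.

(** The clock at time t is known at time t, and rho s <= t means that it has
    reached s. *)
Lemma rho_stopping s t : 0 <= s -> 0 <= t -> F t [set w | (rho s w <= t%:E)%E].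
Proof.
move=> s0 t0; rewrite [X in F t X](_ : _ = (fun w => clock om (X^~ w) t) @^-1` `[s, +oo[).
  by move/(sub_measurable_funP _ (sF t0)): (clock_adapted om_meas om_ge0 om_loc t0); apply; exact: measurable_itv.
by apply/seteqP; split=> w /=; rewrite in_itv/= andbT /rho
  (time_change_le om_meas om_gt0 om_loc (cX w)).
Qed.

Lemma rho_optional s t : 0 <= s -> 0 < t -> F t [set w | (rho s w < t%:E)%E].
Proof.
move=> s0 t0; have t0' := ltW t0.
rewrite [X in F t X](_ : _ = (fun w => clock om (X^~ w) t) @^-1` `]s, +oo[).
  by move/(sub_measurable_funP _ (sF t0')): (clock_adapted om_meas om_ge0 om_loc t0'); apply; exact: measurable_itv.
by apply/seteqP; split=> w /=; rewrite in_itv/= andbT /rho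
  (time_change_lt om_meas om_gt0 om_loc (cX w)).
Qed.

Lemma le_rho s t w : s <= t -> (rho s w <= rho t w)%E.
Proof. exact: (le_time_change om_meas om_gt0 om_loc (cX w)). Qed.

Local Notation Frho s := (stopped_sigma F (rho s)).

Lemma sigma_algebra_Frho s : 0 <= s -> sigma_algebra setT (Frho s).
Proof. by move=> s0; apply: (sigma_algebra_stopped hF) => t; exact: rho_stopping. Qed.

Lemma Frho_measurable s : Frho s `<=` measurable.
Proof. exact: (stopped_sigma_measurable hF). Qed.

Lemma le_Frho s t : 0 <= s -> s <= t -> Frho s `<=` Frho t.
Proof.
move=> s0 st; apply: (le_stopped_sigma hF) => [u|w]; last exact: le_rho.
by apply: rho_stopping; exact: le_trans st.
Qed.

Lemma measurable_rho s : 0 <= s -> measurable_fun setT (rho s).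
Proof.
move=> s0; apply: measurable_ge0_lt => [w|t t0]; first exact: rho_ge0.
by apply: (Fm (ltW t0)); exact: rho_optional.
Qed.

Definition alive u := [set w | (rho u w < e w)%E].

Lemma measurable_alive u : 0 <= u -> measurable (alive u).
Proof.
move=> u0; rewrite -[X in measurable X]setTI; apply: measurable_lte => //.
- exact: measurable_rho.
- exact: exponential_time_measurable he.
Qed.

Lemma stopped_sigma_Gfiltration s : Frho s `<=` G s.
Proof. by move=> A FA; apply: sub_sigma_algebra; left. Qed.

Lemma Gfiltration_alive u s : 0 <= u <= s -> G s (alive u).
Proof.
by move=> us; apply: sub_sigma_algebra; right; apply: sub_sigma_algebra; exists u.
Qed.

Lemma sigma_algebra_Gfiltration s : sigma_algebra setT (G s).
Proof. exact: smallest_sigma_algebra. Qed.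

Lemma Gfiltration_smallest s (H : set (set Omega)) : sigma_algebra setT H -> Frho s `<=` H ->
  (forall u, 0 <= u <= s -> H (alive u)) -> G s `<=` H.
Proof.
move=> sH FH aH; apply: smallest_sub => // A [/FH//|].
by apply: smallest_sub => // _ [u us ->]; exact: aH.
Qed.

Lemma filtration_Gfiltration : filtration G.
Proof.
split=> [t _|t t0|s t s0 st]; first exact: sigma_algebra_Gfiltration.
  apply: Gfiltration_smallest; [exact: sigma_algebra_measurable|exact: Frho_measurable|].
  by move=> u /andP[u0 _]; exact: measurable_alive.
apply: Gfiltration_smallest; first exact: sigma_algebra_Gfiltration.
  by move=> A /(le_Frho s0 st); exact: stopped_sigma_Gfiltration.
by move=> u /andP[u0 us]; apply: Gfiltration_alive; rewrite u0 (le_trans us).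
Qed.

(** Whether the process has been killed by time s is known at s: either it is alive
    at s or the passage preceded the killing, in which case there is a rational
    time between both. *)
Lemma Gfiltration_not_killed s : 0 <= s -> G s [set w | (Order.min (rho s w) (tau w) < e w)%E].
Proof.
move=> s0; rewrite [X in G s X](_ : _ = alive s `|`
    \bigcup_(r in [set r : rat | 0 <= (ratr r : R) <= s])
      ([set w | (tau w < rho (ratr r) w)%E] `&` alive (ratr r))).
  apply: (@sigma_algebra_setU _ _ (G s)); first exact: sigma_algebra_Gfiltration.
    by apply: Gfiltration_alive; rewrite s0 lexx.
  apply: (@sigma_algebra_bigcup_rat _ _ (G s)) => [|r /= rs]; first exact: sigma_algebra_Gfiltration.
  have /andP[r0 rs'] := rs.
  apply: (@sigma_algebra_setI _ _ (G s)); [exact: sigma_algebra_Gfiltration| |exact: Gfiltration_alive].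
  apply: stopped_sigma_Gfiltration; apply: (le_Frho r0 rs'); apply: (stopped_sigma_passed hF).
  - by move=> w; exact: rho_ge0.
  - by move=> t; exact: rho_stopping.
  - by move=> t; exact: rho_optional.
  - by move=> w; exact: level_time_ge0.
  - by move=> t; exact: (level_time_optional).
apply/seteqP; split=> w /=.
  rewrite gt_min => /orP[?|te]; first by left.
  have [rt|tr] := leP (rho s w) (tau w); first by left; exact: le_lt_trans te.
  right; have tE : tau w = (fine (tau w))%:E by apply: hit_finE; exact: lt_le_trans te (leey _).
  have t0 : 0 <= fine (tau w) by rewrite fine_ge0// level_time_ge0.
  (* Any rational between the clock values at tau and at y serves as r. *)
  have [y ty ym] : exists2 y, fine (tau w) < y & (y%:E < Order.min (rho s w) (e w))%E.
    have : (tau w < Order.min (rho s w) (e w))%E by rewrite lt_min tr.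
    rewrite {1}tE; case: (Order.min _ _) => [m||]//; last first.
      by exists (fine (tau w) + 1); rewrite ?ltrDl// ltry.
    by rewrite lte_fin => tm; exists ((fine (tau w) + m) / 2); rewrite ?lte_fin; lra.
  have y0 : 0 <= y by exact: ltW (le_lt_trans t0 ty).
  move: ym; rewrite lt_min => /andP[yr ye].
  have Ay : clock om (X^~ w) (fine (tau w)) < clock om (X^~ w) y.
    exact: (clock_lt om_meas om_ge0 om_loc (cX w)).
  have At0 := clock_ge0 om_ge0 (X^~ w) (fine (tau w)).
  have [r] := rat_in_itvoo Ay; rewrite in_itv/= => /andP[Ar rA].
  have r0 : 0 <= ratr r :> R by exact: ltW (le_lt_trans At0 Ar).
  have ry : (rho (ratr r) w < y%:E)%E.
    by rewrite /rho (time_change_lt om_meas om_gt0 om_loc (cX w)).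
  exists r => /=.
    rewrite r0/= ltW// (lt_trans rA)// ltNge.
    by rewrite -(time_change_le om_meas om_gt0 om_loc (cX w))// -ltNge.
  split; last exact: lt_trans ry ye.
  rewrite ltNge tE /rho (time_change_le om_meas om_gt0 om_loc (cX w))// -ltNge.
  by [].
move=> [se|[r /= /andP[r0 rs] [tr re]]]; first by rewrite gt_min se.
by rewrite gt_min (lt_trans tr re) orbT.
Qed.

Let stopped_time s w := Order.min (rho s w) (tau w).

Let stopped_time_ge0 s w : (0 <= stopped_time s w)%E.
Proof. by rewrite le_min rho_ge0 level_time_ge0. Qed.

Let stopped_time_optional s t : 0 <= s -> 0 < t -> F t [set w | (stopped_time s w < t%:E)%E].
Proof.
move=> s0 t0; rewrite [X in F t X](_ : _ = [set w | (rho s w < t%:E)%E] `|` [set w | (tau w < t%:E)%E]).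
  apply: (@sigma_algebra_setU _ _ (F t)); [exact/sF/ltW|exact: rho_optional|].
  exact: (level_time_optional).
by apply/seteqP; split=> w /=; rewrite gt_min => /orP.
Qed.

Lemma measurable_pending d' (T : measurableType d') (V : R -> T -> R) (r : T -> R) :
  (forall t, 0 <= t -> measurable_fun setT (V t)) -> (forall w, cadlag (V^~ w)) ->
  measurable_fun setT r -> (forall w, 0 <= r w) ->
  measurable_fun setT (fun w => expR (- gam * clock om (V^~ w) (r w)) * scale (V (r w) w)).
Proof.
move=> mV cV mr r0; apply: measurable_funM.
  apply: measurableT_comp => //; apply: measurable_funM; first exact: measurable_cst.
  apply: (@measurable_eval _ _ _ (fun t w => clock om (V^~ w) t)) => //.
    by move=> t _; exact: measurable_clock.
  by move=> w; exact: clock_rcont.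
apply: measurableT_comp; first exact: (measurable_scale).
by apply: measurable_eval => // w; exact: (cV w).1.
Qed.

Let value s w := pending (fine (stopped_time s w)) w.

(** On the event that rho s is at most t, the value at the minimum of both times only
    depends on the path stopped at t. *)
Lemma Frho_value s : 0 <= s ->
  measurable_wrt (Frho s) (value s).
Proof.
move=> s0; have os t := @stopped_time_optional s t s0.
pose V t u w := X (Num.min u t) w.
pose r t w := fine (Order.min t%:E (stopped_time s w)).
have r0 t w : 0 <= t -> 0 <= r t w.
  by move=> t0; rewrite fine_ge0// le_min lee_fin t0 stopped_time_ge0.
apply: (stopped_sigma_fun hF (fun t t0 => rho_stopping s0 t0)
  (N_ := fun t w => expR (- gam * clock om (V t ^~ w) (r t w)) * scale (V t (r t w) w))).
- apply: (@measurable_pending _ (g_sigma_algebraType (sigma_infty F)) X).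
  + move=> t t0; apply/sub_measurable_funP; first exact: sigma_algebra_infty.
    move=> B mB; apply: (sub_sigma_infty t0).
    move: B mB; apply/sub_measurable_funP; first exact: sF.
    exact: levy_adapted _ _ t0 (lexx t).
  + exact: cX.
  + have ms := optional_measurable_infty (stopped_time_ge0 s) os.
    by apply: (measurableT_comp _ ms).
  + by move=> w; rewrite fine_ge0// stopped_time_ge0.
- move=> t t0; apply: (@measurable_pending _ (g_sigma_algebraType (F t)) (V t)).
  + by move=> u u0; exact: (stopped_path_adapted).
  + by move=> w; exact: (stopped_path_cadlag).
  + have ms := optional_min_measurable hF t0 (stopped_time_ge0 s) os.
    by apply: (measurableT_comp _ ms).
  + by move=> w; exact: r0.
- move=> t w t0 rt.
  have st : (stopped_time s w <= t%:E)%E by rewrite ge_min rt.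
  have rE : r t w = fine (stopped_time s w) by rewrite /r min_r.
  have rt' : r t w <= t.
    by rewrite -lee_fin rE fineK// ge0_fin_numE ?stopped_time_ge0// (le_lt_trans st) ?ltry.
  rewrite /value /pending rE.
  rewrite (_ : clock om (V t ^~ w) _ = clock om (X^~ w) (fine (stopped_time s w))) /V ?min_l -?rE//.
  by apply: eq_clock => u /andP[_ us]; rewrite min_l// (le_trans us) -?rE.
Qed.

Lemma time_changed_adapted s : 0 <= s -> measurable_wrt (G s) (W s).
Proof.
move=> s0; rewrite (_ : W s = fun w => if (stopped_time s w < e w)%E then value s w else 0).
  apply: measurable_fun_ifT.
  - apply: (measurable_fun_bool true); rewrite setTI (measurable_g_measurableTypeE (@sigma_algebra_Gfiltration s)).
    rewrite [X in G s X](_ : _ = [set w | (stopped_time s w < e w)%E]); first exact: Gfiltration_not_killed.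
    by [].
  - apply/sub_measurable_funP; first exact: sigma_algebra_Gfiltration.
    move=> B mB; apply: stopped_sigma_Gfiltration; move: B mB.
    apply/sub_measurable_funP; [exact: sigma_algebra_Frho|exact: Frho_value].
  - exact: measurable_cst.
by apply/funext => w; rewrite stopped_WprocE.
Qed.

Lemma Gfiltration_measurable s : 0 <= s -> G s `<=` measurable.
Proof. by case: filtration_Gfiltration => _ + _; apply. Qed.

Lemma measurable_time_changed s : 0 <= s -> measurable_fun setT (W s).
Proof.
move=> s0; apply: sub_measurable_fun (time_changed_adapted s0); first exact: Gfiltration_measurable.
exact: sigma_algebra_Gfiltration.
Qed.

(** Averaging over the exponential time turns the stopped time-changed process into
    the stopped martingale of the original time scale, sampled at the stopping time
    rho s; where rho s is infinite the latter has reached its terminal value. *)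
Lemma time_changed_integral x s A : 0 <= s -> Frho s A ->
  (\int[P x]_(w in A) (W s w)%:E = \int[P x]_(w in A) (terminal x w)%:E)%E.
Proof.
move=> s0 FA; have mA := Frho_measurable FA.
have os t := @stopped_time_optional s t s0.
have mS := optional_measurable_infty (stopped_time_ge0 s) os.
have mS' : measurable_fun setT (stopped_time s).
  by apply: sub_measurable_fun mS; [exact: sigma_infty_measurable|exact: sigma_algebra_infty].
have mv : measurable_wrt (sigma_infty F) (value s).
  apply/sub_measurable_funP; first exact: sigma_algebra_infty.
  move=> B mB; have [+ _] : Frho s (value s @^-1` B); last by [].
  move: B mB; apply/sub_measurable_funP; [exact: sigma_algebra_Frho|exact: Frho_value].
pose K w := if (stopped_time s w < +oo)%E then exp_scale (fine (stopped_time s w)) w else 0.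
have KE w : K w = if (stopped_time s w < +oo)%E then
    value s w * expR (- q * fine (stopped_time s w)) else 0.
  by rewrite /K -pending_exp_scale.
have mK : measurable_fun setT K.
  rewrite (_ : K = fun w => if (stopped_time s w < +oo)%E then
      value s w * expR (- q * fine (stopped_time s w)) else 0); last exact/funext.
  apply: measurable_fun_ifT; last exact: measurable_cst.
    by apply: measurable_fun_lte => //; exact: measurable_cst.
  apply: measurable_funM.
    by apply: sub_measurable_fun mv; [exact: sigma_infty_measurable|exact: sigma_algebra_infty].
  apply: measurableT_comp => //; apply: measurable_funM; first exact: measurable_cst.
  by apply: (measurableT_comp _ mS').
have K0 w : 0 <= K w.
  by rewrite KE; case: ifP => // _; rewrite mulr_ge0 ?expR_ge0 ?pending_ge0.
have mT := measurable_terminal omg_meas omg_ge0 omg_loc q_ge0 c x.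
have T0 := terminal_ge0 omg_meas omg_ge0 omg_loc q_ge0 c x.
transitivity (\int[P x]_(w in A) (K w)%:E)%E.
  transitivity (\int[P x]_(w in A) (if (stopped_time s w < e w)%E then value s w else 0)%:E)%E.
    by apply: eq_integral => w _; rewrite stopped_WprocE.
  rewrite (exponential_freezing he q_ge0 (@sigma_algebra_infty _ _ _ F)
    (sigma_infty_measurable hF) (heF x) FA.1 mS (stopped_time_ge0 s) mv (fun w => pending_ge0 _ _)).
  by apply: eq_integral => w _; rewrite KE.
pose D := [set w | (rho s w < +oo)%E].
have FD : Frho s D.
  apply: stopped_sigma_fin => [w|t t0|t t0]; first exact: rho_ge0.
    exact: rho_stopping.
  exact: rho_optional.
have sFr := sigma_algebra_Frho s0.
have FAD : Frho s (A `&` D) by exact: sigma_algebra_setI.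
have mAD : measurable (A `&` D) by exact: Frho_measurable FAD.
have mAD' : measurable (A `&` ~` D).
  by apply: measurableI => //; apply: measurableC; exact: Frho_measurable FD.
rewrite !(ge0_integral_setID (P x) mA (Frho_measurable FD))//.
congr (_ + _)%E.
  rewrite -(@stopped_sampling _ _ omg_meas omg_ge0 omg_loc q_ge0 c x (rho s)); last 4 first.
  - by move=> w; exact: rho_ge0.
  - by move=> t t0; exact: rho_optional.
  - by split=> // t; apply: (stopped_sigma_lt hF _ FAD) => u u0; exact: rho_optional.
  - by move=> w [].
  apply: eq_integral => w; rewrite inE => -[_ Dw]; congr EFin.
  have rE : rho s w = (fine (rho s w))%:E by rewrite fineK// ge0_fin_numE// rho_ge0.
  rewrite /K ifT; last by rewrite gt_min Dw.
  by rewrite /stopped -rE.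
apply: ae_eq_integral => //; try by apply/measurable_EFinP; exact: measurable_funTS.
apply: filterS (terminal_stopped omg_meas omg_ge0 omg_loc q_ge0 c x) => w <- [_ /negP Dw]; congr EFin.
have roo : rho s w = +oo%E by apply/eqP; rewrite -leye_eq leNgt.
by rewrite /K /stopped_time roo minye.
Qed.

Lemma time_changed_bounded x : {ae P x, forall w, forall t, 0 <= t -> `|W t w| <= scale (Num.max c x)}.
Proof.
apply: filterS (stop_level c x) => w Xm t t0.
rewrite stopped_WprocE// ger0_norm ?killed_path_ge0//.
rewrite /killed_path -/(tau w) -/(stopped_time t w); case: ifPn => [te|_]; last exact/ltW/scale_pos.
have sE : stopped_time t w = (fine (stopped_time t w))%:E.
  by rewrite fineK// ge0_fin_numE ?stopped_time_ge0//; exact: lt_le_trans te (leey _).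
set r := fine _ in sE *; have r0 : 0 <= r by rewrite fine_ge0// stopped_time_ge0.
rewrite -[leRHS]mul1r; apply: ler_pM; rewrite ?expR_ge0//; first exact/ltW/scale_pos.
  rewrite -expR0 ler_expR mulNr oppr_le0 mulr_ge0//; exact: clock_ge0.
apply: (le_scale); have := Xm r r0.
by rewrite min_l// -sE /stopped_time ge_min lexx orbT.
Qed.

(** On the generating events the martingale property holds because, before the
    passage, being alive at time u is implied by a nonzero later value, whereas after
    the passage the process is constant. *)
Lemma time_changed_martingale x : martingale (P x) G W.
Proof.
have sGs := sigma_algebra_Gfiltration.
split; first exact: filtration_Gfiltration.
- move=> t t0 _ [B mB <-]; rewrite setTI.
  by move: B mB; apply/sub_measurable_funP; [exact: sGs|exact: time_changed_adapted].
- move=> t t0; apply: (bounded_integrable (K := scale (Num.max c x))); first exact: measurable_time_changed.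
  by apply: filterS (time_changed_bounded x) => w h; exact: h.
move=> s t s0 st A GA; have t0 := le_trans s0 st.
(* A family of generating events that is closed under intersection. *)
pose C := [set B | exists A' u, [/\ Frho s A', 0 <= u <= s & B = A' \/ B = A' `&` alive u]].
have sFs := sigma_algebra_Frho s0.
have CF A' : Frho s A' -> C A' by move=> FA; exists A', 0; split; [|rewrite lexx|left].
have GC : G s `<=` <<s C >>.
  apply: Gfiltration_smallest; first exact: smallest_sigma_algebra.
    by move=> A' FA'; apply: sub_sigma_algebra; exact: CF.
  move=> u us; apply: sub_sigma_algebra; exists setT, u; split=> //.
    exact: sigma_algebra_setT.
  by right; rewrite setTI.
have W0 r w : 0 <= r -> 0 <= W r w by move=> r0; rewrite stopped_WprocE// killed_path_ge0.
have Wb r : 0 <= r -> {ae P x, forall w, W r w <= scale (Num.max c x)}.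
  by move=> r0; apply: filterS (time_changed_bounded x) => w /(_ r r0); apply: le_trans; rewrite ler_norm.
apply: (@eq_integral_generated _ _ _ (P x) C (W t) (W s) (scale (Num.max c x))); last exact: GC.
- move=> B1 B2 [A1 [u1 [F1 u1s H1]]] [A2 [u2 [F2 u2s H2]]].
  have F12 : Frho s (A1 `&` A2) by exact: sigma_algebra_setI.
  case: H1 H2 => -> [] ->.
  + exact: CF.
  + by exists (A1 `&` A2), u2; split=> //; right; rewrite setIA.
  + by exists (A1 `&` A2), u1; split=> //; right; rewrite setIAC.
  + exists (A1 `&` A2), (Num.max u1 u2); split=> //.
      by rewrite le_max ge_max; case/andP: u1s => -> ->; case/andP: u2s => _ ->.
    right; rewrite setIACA; congr (_ `&` _); apply/seteqP; split=> w /=.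
      by move=> [h1 h2]; rewrite /alive /=; case: (leP u1 u2).
    by move=> h; split; apply: le_lt_trans h; apply: le_rho; rewrite le_max lexx ?orbT.
- by apply: CF; exact: sigma_algebra_setT.
- move=> _ [A' [u [FA' /andP[u0 us] [->|->]]]]; first exact: Frho_measurable FA'.
  by apply: measurableI; [exact: Frho_measurable FA'|exact: measurable_alive].
- exact: measurable_time_changed.
- exact: measurable_time_changed.
- by move=> w; exact: W0.
- by move=> w; exact: W0.
- exact: Wb.
- exact: Wb.
move=> B [A' [u [FA' /andP[u0 us] H]]].
have WA r A1 : s <= r -> Frho s A1 ->
    (\int[P x]_(w in A1) (W r w)%:E = \int[P x]_(w in A1) (terminal x w)%:E)%E.
  move=> sr FA1; apply: time_changed_integral; first exact: le_trans sr.
  exact: le_Frho FA1.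
case: H => [->|->]; first by rewrite !WA.
pose D := [set w | (tau w < rho u w)%E].
have FD : Frho s D.
  apply: (le_Frho u0 us); apply: (stopped_sigma_passed hF).
  - by move=> w; exact: rho_ge0.
  - by move=> r; exact: rho_stopping.
  - by move=> r; exact: rho_optional.
  - by move=> w; exact: level_time_ge0.
  - by move=> r; exact: (level_time_optional).
have mD := Frho_measurable FD.
have mA' := Frho_measurable FA'.
have ma := measurable_alive u0.
have FAD : Frho s (A' `&` ~` D).
  by apply: sigma_algebra_setI => //; exact: sigma_algebra_setC.
have after r : s <= r -> (\int[P x]_(w in (A' `&` alive u) `&` ~` D) (W r w)%:E =
    \int[P x]_(w in A' `&` ~` D) (W r w)%:E)%E.
  move=> sr; have r0 := le_trans s0 sr.
  rewrite setIAC integral_mkcondr; apply: eq_integral => w; rewrite inE => -[_ /negP Dw].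
  rewrite /patch; case: ifPn => // /negP; rewrite inE => nw.
  rewrite stopped_WprocE// /killed_path ifF//; apply/negbTE; apply/negP => h; apply: nw.
  apply: le_lt_trans h; rewrite le_min; apply/andP; split; last by rewrite leNgt.
  by apply: le_rho; exact: le_trans us sr.
rewrite (ge0_integral_setID (P x) (measurableI _ _ mA' ma) mD (measurable_time_changed t0)); last first.
  by move=> w; exact: W0.
rewrite (ge0_integral_setID (P x) (measurableI _ _ mA' ma) mD (measurable_time_changed s0)); last first.
  by move=> w; exact: W0.
have -> : (\int[P x]_(w in A' `&` alive u `&` ~` D) (W t w)%:E =
    \int[P x]_(w in A' `&` alive u `&` ~` D) (W s w)%:E)%E.
  by rewrite (after t st) (after s (lexx s)) (WA t _ st FAD) (WA s _ (lexx s) FAD).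
have -> : (\int[P x]_(w in A' `&` alive u `&` D) (W t w)%:E =
    \int[P x]_(w in A' `&` alive u `&` D) (W s w)%:E)%E; last by [].
apply: eq_integral => w; rewrite inE => -[_ /= Dw]; congr EFin.
have tr r : s <= r -> Order.min (rho r w) (tau w) = tau w.
  move=> sr; apply: min_r; apply: le_trans (ltW Dw) _; apply: le_rho; exact: le_trans us sr.
rewrite (stopped_WprocE w t0) (stopped_WprocE w s0) /killed_path -/(tau w).
by rewrite (tr t st) (tr s (lexx s)).
Qed.

(** If the exponential time is infinite then q = 0, and in this case the process
    before the passage is the martingale of the original time scale, which
    converges. *)
Lemma time_changed_cadlag x : cadlag_process (P x) W.
Proof.
have cvg_pending : {ae P x, forall w, (e w < +oo)%E \/ (tau w < +oo)%E \/
    cvg (pending t w @[t --> +oo])}.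
  have := q_ge0; rewrite le_eqVlt => /predU1P[q0|q0]; last first.
    by apply: filterS (exponential_time_finite he x q0) => w; left.
  have [xc|cx] := leP x c; last first.
    apply: filterS (levy_start x) => w Xw0; right; left.
    by rewrite (_ : tau w = 0%E) ?ltry// /level_time hit_eq0 ?Xw0//; exact: (cX w).1.
  apply: filterS (stopped_terminal omg_meas omg_ge0 omg_loc q_ge0 xc) => w cw.
  right; have [too|too] := boolP (tau w < +oo)%E; [by left|right].
  have {}too : tau w = +oo%E by apply/eqP; rewrite -leye_eq leNgt.
  apply/cvg_ex; exists (terminal x w); move: cw.
  rewrite (_ : (fun t => stopped exp_scale tau t w) = pending^~ w)//.
  by apply/funext => t; rewrite /stopped too miney /= -pending_exp_scale -q0 oppr0 mul0r expR0 mulr1.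
have pending_cadlag w : cadlag (pending^~ w).
  rewrite (_ : pending^~ w = fun t => exp_scale t w * expR (q * t)).
    apply: cadlagM; first exact: exp_scale_cadlag.
    apply: (@cadlag_comp _ expR (fun t => q * t)); first exact: continuous_expR.
    split=> t t0.
      by apply: cvgM; [exact: cvg_cst|apply: cvg_at_right_filter; exact: cvg_id].
    apply: is_cvgM; first exact: is_cvg_cst.
    by apply/cvg_ex; exists t; apply: cvg_at_left_filter; exact: cvg_id.
  by apply/funext => t; rewrite -pending_exp_scale -mulrA -expRD mulNr addNr expR0 mulr1.
apply: filterS cvg_pending => w H.
apply: (@eq_cadlag _ (fun s => killed_path X w e c (pending^~ w) (rho s w))).
  by move=> s s0; rewrite stopped_WprocE.
exact: (killed_path_time_change_cadlag om_meas om_gt0 om_loc (cX w) (pending_cadlag w) H).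
Qed.

End time_changed_process.

End levy.

Theorem proposition12 (R : realType) (d : measure_display)
    (Omega : measurableType d) (P : R -> probability Omega R)
    (X : R -> Omega -> R) (q : R) (e : Omega -> \bar R)
    (om : R -> R) (c gam : R) (F : R -> set (set Omega))
    (hX : spectrally_negative_levy P X)
    (hq : 0 <= q)
    (he : exponential_time P q e)
    (heX : forall x,
      independent (P x) (sigma_rv e) (sigma_process X [set t | 0 <= t]))
    (om_meas : measurable_fun setT om)
    (om_ge0 : forall y, 0 <= om y)
    (om_loc : locally_bounded om)
    (hgam : 0 < gam)
    (hF : filtration F)
    (hFX : adapted F X)
    (hFinc : forall x, independent_increments (P x) F X) :
  (forall x,
    let Ztau := stopped (Zproc P X e q om) (passage_time X c) in
    [/\ martingale (P x) F Ztau,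
        forall w, cadlag (Ztau^~ w),
        bounded_process (P x) Ztau &
        x <= c -> terminal_value (P x) Ztau (Zterminal P X e q om c)])
  /\
  ((forall y, 0 < om y) ->
   (forall x, independent (P x) (sigma_rv e) (sigma_infty F)) ->
   forall x,
    let WT := stopped (Wproc P X e om gam) (Ypassage_time X e om c) in
    [/\ martingale (P x) (Gfiltration X e om F) WT,
        cadlag_process (P x) WT &
        bounded_process (P x) WT]).
Proof.
split=> [x|om_gt0 heF x].
  exact: (stopped_Zproc hX hF hFX hFinc hq he heX om_meas om_ge0 om_loc c x).
split.
- exact: (time_changed_martingale hX hF hFX hFinc hq he heX heF c om_meas om_gt0 om_loc hgam).
- exact: (time_changed_cadlag hX hF hFX hFinc hq he heX c om_meas om_gt0 om_loc hgam).
- eexists; exact: (time_changed_bounded hX hF hFX hFinc hq he heX c om_meas om_gt0 om_loc hgam).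
Qed.
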